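(* Let $\mathfrak g$ be of type $E_6$ and let $\lambda\in P^+$ be such that $\lambda(h_3)=0$. Then $M(\lambda)$, regarded as a $\mathfrak g$-module (without taking the grading into account), is multiplicity free: for every $\mu\in P^+$, the irreducible $\mathfrak g$-module $V(\mu)$ occurs in $M(\lambda)$ with multiplicity at most $1$.
   Context: $\mathfrak g$ is the simple complex Lie algebra of type $E_6$, with Dynkin diagram nodes $I=\{1,\dots,6\}$ labelled so that $1-2-3-4-5$ is a chain and $6$ is joined to $3$. $\mathfrak h$ is a Cartan subalgebra, $R^+$ the positive roots, $\alpha_i$ simple roots, $h_i$ co-roots, $\omega_i$ fundamental weights, $P^+$ the dominant integral weights, $\mathfrak n^\pm$ the sums of positive/negative root spaces, $x_\alpha^\pm$ a generator of the root space $\mathfrak g_{\pm\alpha}$. $V(\mu)$ is the irreducible $\mathfrak g$-module of highest weight $\mu$. $\mathfrak g[t]=\mathfrak g\otimes\mathbb C[t]$, $x_{\alpha,r}^-=x_\alpha^-\otimes t^r$, and $x\in\mathfrak g$ is identified with $x\otimes1$. For $i\in I$, $m\in\mathbb Z_{\ge0}$, $M(m\omega_i)$ is the quotient of $U(\mathfrak g[t])$ by the left ideal generated by $\mathfrak n^+[t]$, $\mathfrak h\otimes t\mathbb C[t]$, $h_j$ and $x_{\alpha_j}^-$ ($j\ne i$), $h_i-m$, $(x_{\alpha_i}^-)^{m+1}$, $x_{\alpha_i,1}^-$; $v_{i,m}$ is the image of $1$; $R(i,m,r)=\{\alpha\in R^+:x_{\alpha,r}^-v_{i,m}=0\}$ for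 $r\in\mathbb Z_{\ge0}$; $R(\lambda,r)=\bigcap_{i\in I}R(i,\lambda(h_i),r)$. $M(\lambda)$ is the quotient of $U(\mathfrak g[t])$ by the left ideal generated by $\mathfrak n^+[t]$, $\mathfrak h\otimes t\mathbb C[t]$, $h_i-\lambda(h_i)$, $(x_{\alpha_i}^-)^{\lambda(h_i)+1}$, $x_{\alpha,r}^-$ for all $i\in I$, $r\in\mathbb Z_{\ge0}$, $\alpha\in R(\lambda,r)$; it is finite-dimensional. *)

(* Defs.v *)
From HB Require Import structures.
From mathcomp Require Import all_boot all_order all_algebra.
From mathcomp Require Import generic_quotient zify.
From mathcomp Require Import boolp classical_sets functions.

Set Implicit Arguments.
Unset Strict Implicit.
Unset Printing Implicit Defensive.

Import GRing.Theory.
Local Open Scope ring_scope.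
Local Open Scope quotient_scope.
Local Open Scope classical_set_scope.

(******************************************************************************)
(* Lie algebras and their modules                                             *)
(******************************************************************************)

HB.mixin Record Lmodule_isLie (F : fieldType) L of GRing.Lmodule F L := {
  lbr : L -> L -> L;
  lbr_linl : forall y, linear (lbr^~ y);
  lbr_linr : forall x, linear (lbr x);
  lbrxx : forall x, lbr x x = 0;
  lbr_jacobi : forall x y z,
    lbr x (lbr y z) + lbr y (lbr z x) + lbr z (lbr x y) = 0
}.

#[short(type="lieAlgType")]
HB.structure Definition LieAlgebra (F : fieldType) :=
  {L of GRing.Lmodule F L & Lmodule_isLie F L}.

#[short(type="fdLieAlgType")]
HB.structure Definition FDLieAlgebra (F : fieldType) :=
  {L of Vector F L & Lmodule_isLie F L}.

Section LieTheory.
Variables (F : fieldType) (L : lieAlgType F).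
Implicit Types x y z : L.

Lemma lbrDl x y z : lbr (x + y) z = lbr x z + lbr y z.
Proof. by have := lbr_linl z 1 x y; rewrite !scale1r. Qed.

Lemma lbrDr x y z : lbr x (y + z) = lbr x y + lbr x z.
Proof. by have := lbr_linr x 1 y z; rewrite !scale1r. Qed.

Lemma lbr0l x : lbr 0 x = 0.
Proof. by apply: (addrI (lbr 0 x)); rewrite -lbrDl !addr0. Qed.

Lemma lbr0r x : lbr x 0 = 0.
Proof. by apply: (addrI (lbr x 0)); rewrite -lbrDr !addr0. Qed.

Lemma lbrZl c x y : lbr (c *: x) y = c *: lbr x y.
Proof. by have := lbr_linl y c x 0; rewrite !addr0 lbr0l addr0. Qed.

Lemma lbrZr c x y : lbr x (c *: y) = c *: lbr x y.
Proof. by have := lbr_linr x c y 0; rewrite !addr0 lbr0r addr0. Qed.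

Lemma lbrC x y : lbr x y = - lbr y x.
Proof.
apply/eqP; rewrite -addr_eq0; apply/eqP.
by have := lbrxx (x + y); rewrite lbrDl !lbrDr !lbrxx add0r addr0.
Qed.

Lemma lbr_suml I (s : seq I) (P : pred I) (f : I -> L) y :
  lbr (\sum_(i <- s | P i) f i) y = \sum_(i <- s | P i) lbr (f i) y.
Proof.
by apply: (big_morph (lbr^~ y)) => [u v|]; rewrite ?lbrDl ?lbr0l.
Qed.

Lemma lbr_sumr I (s : seq I) (P : pred I) (f : I -> L) x :
  lbr x (\sum_(i <- s | P i) f i) = \sum_(i <- s | P i) lbr x (f i).
Proof.
by apply: (big_morph (lbr x)) => [u v|]; rewrite ?lbrDr ?lbr0r.
Qed.

End LieTheory.

Record lieMod (F : fieldType) (L : lieAlgType F) := LieMod {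
  lmcar :> lmodType F;
  lact : L -> lmcar -> lmcar;
  lact_linl : forall v, linear (lact^~ v);
  lact_linr : forall x, linear (lact x);
  lact_br : forall x y v,
    lact (lbr x y) v = lact x (lact y v) - lact y (lact x v)
}.

Record submod (F : fieldType) (V : lmodType F) := Submod {
  submod_set :> V -> Prop;
  submod0 : submod_set 0;
  submodD : forall u v, submod_set u -> submod_set v -> submod_set (u + v);
  submodZ : forall c v, submod_set v -> submod_set (c *: v)
}.

Section Span.
Variables (F : fieldType) (V : lmodType F) (S : set V).

Inductive span_pred : V -> Prop :=
| span_in v : S v -> span_pred v
| span_0 : span_pred 0
| span_D u v : span_pred u -> span_pred v -> span_pred (u + v)
| span_Z c v : span_pred v -> span_pred (c *: v).

Definition lspan : submod V := Submod span_0 span_D span_Z.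

End Span.

Section ModuleNotions.
Variables (F : fieldType) (L : lieAlgType F).
Implicit Types V W : lieMod L.

Definition is_hom V W (f : V -> W) :=
  linear f /\ forall x v, f (lact x v) = lact x (f v).

Definition irreducible V :=
  (exists v : V, v != 0) /\
  forall P : submod V, (forall x v, P v -> P (lact x v)) ->
    (forall v, P v -> v = 0) \/ (forall v, P v).

(* The direct sum of k copies of V embeds in W: the map                       *)
(* (v_1, ..., v_k) |-> f_1 v_1 + ... + f_k v_k is injective.                  *)
Definition copies_embed V W (k : nat) :=
  exists f : 'I_k -> V -> W,
    (forall j, is_hom (f j)) /\
    forall v : 'I_k -> V, \sum_j f j (v j) = 0 -> forall j, v j = 0.

(* The multiplicity of an irreducible V in a completely reducible W (such as  *)
(* a finite-dimensional module of a semisimple complex Lie algebra) is the    *)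
(* largest k such that k copies of V embed in W.                              *)
Definition mult_le V W (n : nat) :=
  forall k, copies_embed V W k -> (k <= n)%N.

End ModuleNotions.

(******************************************************************************)
(* The current algebra g[t]: an element sum_r x_r (x) t^r is represented by   *)
(* the finitely supported sequence r |-> x_r                                  *)
(******************************************************************************)

Definition fin_supp (V : nmodType) : pred (nat -> V) :=
  fun f => `[< exists N, forall r, (N <= r)%N -> f r = 0 >].
Arguments fin_supp {V}.

Record current (F : fieldType) (V : lmodType F) := Current {
  coef :> nat -> V;
  coef_fin : fin_supp coef
}.
Arguments coef {F V} _ _ : simpl never.

Lemma fin_supp_submod (F : fieldType) (V : lmodType F) :
  submod_closed (@fin_supp V).
Proof.
split; first by apply/asboolP; exists 0%N.
move=> c f h /asboolP[N hN] /asboolP[M hM]; apply/asboolP.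
exists (maxn N M) => r; rewrite geq_max => /andP[Nr Mr].
rewrite [LHS](_ : _ = c *: f r + h r) //.
by rewrite hN // hM // scaler0 addr0.
Qed.

HB.instance Definition _ (F : fieldType) (V : lmodType F) :=
  GRing.isSubmodClosed.Build F (nat -> V) (@fin_supp V)
    (@fin_supp_submod F V).
HB.instance Definition _ (F : fieldType) (V : lmodType F) :=
  [isSub for @coef F V].
HB.instance Definition _ (F : fieldType) (V : lmodType F) :=
  [Choice of current V by <:].
HB.instance Definition _ (F : fieldType) (V : lmodType F) :=
  [SubChoice_isSubLmodule of current V by <:].

Section CurrentAlgebra.
Variables (F : fieldType) (L : lieAlgType F).
Local Notation Lt := (current L).

Lemma current_eqP (f h : Lt) : (forall r, f r = h r) -> f = h.
Proof. by move=> fh; apply/val_inj/funext. Qed.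

Definition cbr_fun (f h : Lt) (r : nat) : L :=
  \sum_(i < r.+1) lbr (f i) (h (r - i)%N).

Lemma cbr_fin f h : fin_supp (cbr_fun f h).
Proof.
have /asboolP[N hN] := coef_fin f; have /asboolP[M hM] := coef_fin h.
apply/asboolP; exists (N + M)%N => r NMr; apply: big1 => i _.
have [Ni|iN] := leqP N i; first by rewrite hN // lbr0l.
rewrite hM ?lbr0r // leq_subRL.
  by rewrite (leq_trans _ NMr) // leq_add2r ltnW.
by rewrite -ltnS ltn_ord.
Qed.

Definition cbr f h : Lt := Current (cbr_fin f h).

Lemma coefD (f h : Lt) r : (f + h) r = f r + h r.
Proof. by []. Qed.

Lemma coefZ c (f : Lt) r : (c *: f) r = c *: f r.
Proof. by []. Qed.

Lemma coef0 r : (0 : Lt) r = 0.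
Proof. by []. Qed.

Lemma coef_cbr f h r : cbr f h r = \sum_(i < r.+1) lbr (f i) (h (r - i)%N).
Proof. by []. Qed.

Lemma cbr_linl h : linear (cbr^~ h).
Proof.
move=> c f f'; apply: current_eqP => r.
rewrite coefD coefZ !coef_cbr scaler_sumr -big_split; apply: eq_bigr => i _.
by rewrite coefD coefZ lbrDl lbrZl.
Qed.

Lemma cbr_linr f : linear (cbr f).
Proof.
move=> c h h'; apply: current_eqP => r.
rewrite coefD coefZ !coef_cbr scaler_sumr -big_split; apply: eq_bigr => i _.
by rewrite coefD coefZ lbrDr lbrZr.
Qed.

Lemma cbr_sum2 f h r : cbr f h r =
  \sum_(i < r.+1) \sum_(j < r.+1 | (i + j == r)%N) lbr (f i) (h j).
Proof.
rewrite coef_cbr; apply: eq_bigr => i _.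
have ir : (i <= r)%N by rewrite -ltnS.
have ri : (r - i < r.+1)%N by rewrite ltnS leq_subr.
rewrite (big_pred1 (Ordinal ri)) // => j.
by rewrite /= -val_eqE /=; apply/eqP/eqP; lia.
Qed.

Lemma cbrxx f : cbr f f = 0.
Proof.
apply: current_eqP => r; rewrite cbr_sum2 coef0.
rewrite pair_big_dep /=.
rewrite (bigID (fun p : 'I_r.+1 * 'I_r.+1 => (p.1 < p.2)%N)) /=.
rewrite [X in _ + X](bigID (fun p : 'I_r.+1 * 'I_r.+1 => (p.2 < p.1)%N)) /=.
rewrite [X in _ + (_ + X)]big1 ?addr0; last first.
  move=> [i j] /= /andP[/andP[_]]; rewrite -!leqNgt => ij ji.
  have -> : i = j by apply/val_inj/eqP; rewrite eqn_leq ij ji.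
  exact: lbrxx.
rewrite [X in _ + X](reindex_inj (h := fun p => (p.2, p.1))) /=; last first.
  by move=> [i j] [i' j'] [-> ->].
rewrite -[X in X + _]opprK -[X in - X + _]sumrN addrC.
apply/eqP; rewrite subr_eq0; apply/eqP; apply: eq_big => [[i j] /=|[i j] _ /=].
  by rewrite addnC; case: ltngtP; rewrite ?andbT ?andbF.
by rewrite lbrC.
Qed.

Lemma cbr_sum3 f h k r : cbr f (cbr h k) r =
  \sum_(i < r.+1) \sum_(j < r.+1) \sum_(l < r.+1)
    (if (i + j + l == r)%N then lbr (f i) (lbr (h j) (k l)) else 0).
Proof.
rewrite coef_cbr; apply: eq_bigr => i _.
have ir : (i <= r)%N by rewrite -ltnS.
have rir : ((r - i).+1 <= r.+1)%N by rewrite ltnS leq_subr.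
rewrite coef_cbr lbr_sumr.
rewrite (big_ord_widen r.+1 (fun j => lbr (f i) (lbr (h j) (k (r - i - j)%N)))) //.
rewrite big_mkcond; apply: eq_bigr => j _; rewrite -big_mkcond.
case: ifP => jri.
  have lr : (r - i - j < r.+1)%N by rewrite ltnS -subnDA leq_subr.
  have ijr : (i + j <= r)%N by rewrite -leq_subRL // -ltnS.
  rewrite (big_pred1 (Ordinal lr)) // => l.
  by rewrite /= -val_eqE /=; apply/eqP/eqP; lia.
rewrite big1 // => l /eqP ijl.
by move: jri; lia.
Qed.

Lemma cbr_jacobi f h k :
  cbr f (cbr h k) + cbr h (cbr k f) + cbr k (cbr f h) = 0.
Proof.
apply: current_eqP => r; rewrite 2!coefD coef0 !cbr_sum3.
pose s3 (G : nat -> nat -> nat -> L) :=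
  \sum_(i < r.+1) \sum_(j < r.+1) \sum_(l < r.+1)
    (if (i + j + l == r)%N then G i j l else 0).
have rot G : s3 G = s3 (fun i j l => G l i j).
  rewrite /s3 exchange_big; apply: eq_bigr => i _.
  rewrite exchange_big; apply: eq_bigr => j _.
  by apply: eq_bigr => l _; rewrite -addnA addnC.
rewrite -/(s3 (fun i j l => lbr (f i) (lbr (h j) (k l)))).
rewrite -/(s3 (fun i j l => lbr (h i) (lbr (k j) (f l)))).
rewrite -/(s3 (fun i j l => lbr (k i) (lbr (f j) (h l)))).
rewrite [X in _ + X + _]rot [X in _ + X + _]rot [X in _ + X]rot /s3.
rewrite -!big_split big1 // => i _; rewrite -!big_split big1 // => j _.
rewrite -!big_split big1 // => l _ /=.
by case: ifP => _; rewrite ?addr0 // lbr_jacobi.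
Qed.

HB.instance Definition _ :=
  Lmodule_isLie.Build F (current L) cbr_linl cbr_linr cbrxx cbr_jacobi.

(* x (x) t^r *)
Lemma tpow_fin (x : L) (r : nat) :
  fin_supp (fun s => if s == r then x else 0).
Proof. by apply/asboolP; exists r.+1 => s rs; rewrite gtn_eqF. Qed.

Definition tpow x r : current L := Current (tpow_fin x r).

Lemma coef_tpow x r s : tpow x r s = if s == r then x else 0.
Proof. by []. Qed.

Lemma tpow_br x y r s : lbr (tpow x r) (tpow y s) = tpow (lbr x y) (r + s).
Proof.
apply: current_eqP => n; rewrite [LHS]cbr_sum2 coef_tpow.
under eq_bigr => i _ do under eq_bigr => j _ do rewrite !coef_tpow.
have [->|nrs] := eqVneq n (r + s)%N.
  have hr : (r < (r + s).+1)%N by rewrite ltnS leq_addr.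
  have hs : (s < (r + s).+1)%N by rewrite ltnS leq_addl.
  rewrite (bigD1 (Ordinal hr)) //= (bigD1 (Ordinal hs)) //= !eqxx.
  rewrite !big1 ?addr0 // => [i ir|j /andP[_ js]].
    rewrite big1 // => j _.
    by rewrite -[_ == r :> nat]/(i == Ordinal hr) (negbTE ir) lbr0l.
  by rewrite -[_ == s :> nat]/(j == Ordinal hs) (negbTE js) lbr0r.
rewrite big1 // => i _; rewrite big1 // => j /eqP ij.
case: eqP => ir; last by rewrite lbr0l.
case: eqP => js; last by rewrite lbr0r.
by move: nrs ij; rewrite ir js => /eqP nrs ij; case: nrs.
Qed.

Lemma tpow_lin r : linear (tpow^~ r).
Proof.
move=> c x y; apply: current_eqP => s; rewrite coefD coefZ !coef_tpow.
by case: ifP => _; rewrite ?scaler0 ?addr0.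
Qed.

End CurrentAlgebra.

(******************************************************************************)
(* The universal enveloping algebra: the unital associative F-algebra         *)
(* presented by generators UGen x (x in L), subject to the linearity of UGen  *)
(* and to UGen [x, y] = UGen x * UGen y - UGen y * UGen x                     *)
(******************************************************************************)

Inductive uterm (F L : Type) :=
| UGen of L
| UConst of F
| UAdd of uterm F L & uterm F L
| UMul of uterm F L & uterm F L.
Arguments UGen {F L}.
Arguments UConst {F L}.

HB.instance Definition _ (F L : Type) := gen_eqMixin (uterm F L).
HB.instance Definition _ (F L : Type) := gen_choiceMixin (uterm F L).

Section Enveloping.
Variables (F : fieldType) (L : lieAlgType F).
Local Notation T := (uterm F L).

Inductive ueq : T -> T -> Prop :=
| ueq_refl a : ueq a a
| ueq_sym a b : ueq a b -> ueq b a
| ueq_trans a b c : ueq a b -> ueq b c -> ueq a c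
| ueq_add a a' b b' : ueq a a' -> ueq b b' -> ueq (UAdd a b) (UAdd a' b')
| ueq_mul a a' b b' : ueq a a' -> ueq b b' -> ueq (UMul a b) (UMul a' b')
| ueq_addA a b c : ueq (UAdd a (UAdd b c)) (UAdd (UAdd a b) c)
| ueq_addC a b : ueq (UAdd a b) (UAdd b a)
| ueq_add0 a : ueq (UAdd (UConst 0) a) a
| ueq_addN a : ueq (UAdd (UMul (UConst (-1)) a) a) (UConst 0)
| ueq_mulA a b c : ueq (UMul a (UMul b c)) (UMul (UMul a b) c)
| ueq_mul1 a : ueq (UMul (UConst 1) a) a
| ueq_mulDl a b c : ueq (UMul (UAdd a b) c) (UAdd (UMul a c) (UMul b c))
| ueq_mulDr a b c : ueq (UMul a (UAdd b c)) (UAdd (UMul a b) (UMul a c))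
| ueq_constC k a : ueq (UMul (UConst k) a) (UMul a (UConst k))
| ueq_constD k l : ueq (UConst (k + l)) (UAdd (UConst k) (UConst l))
| ueq_constM k l : ueq (UConst (k * l)) (UMul (UConst k) (UConst l))
| ueq_genD x y : ueq (UGen (x + y)) (UAdd (UGen x) (UGen y))
| ueq_genZ k x : ueq (UGen (k *: x)) (UMul (UConst k) (UGen x))
| ueq_genB x y : ueq (UGen (lbr x y))
    (UAdd (UMul (UGen x) (UGen y))
          (UMul (UConst (-1)) (UMul (UGen y) (UGen x)))).

Definition ueqb : rel T := fun a b => `[< ueq a b >].

Lemma ueqb_refl : reflexive ueqb.
Proof. by move=> a; apply/asboolP/ueq_refl. Qed.

Lemma ueqb_sym : symmetric ueqb.
Proof. by move=> a b; apply/asboolP/asboolP; apply: ueq_sym. Qed.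

Lemma ueqb_trans : transitive ueqb.
Proof.
move=> b a c /asboolP ab /asboolP bc; apply/asboolP; exact: ueq_trans ab bc.
Qed.

Canonical ueq_equiv := EquivRel ueqb ueqb_refl ueqb_sym ueqb_trans.

Definition uea : Type := {eq_quot ueq_equiv}.
HB.instance Definition _ := Choice.on uea.
HB.instance Definition _ := EqQuotient.on uea.

Lemma uea_piP (a b : T) : reflect (ueq a b) (\pi_uea a == \pi_uea b).
Proof. by rewrite eqmodE; apply: asboolP. Qed.

Lemma uea_pi (a b : T) : ueq a b -> \pi_uea a = \pi_uea b.
Proof. by move=> ab; apply/eqP/uea_piP. Qed.

Lemma uea_repr (a : T) : ueq (repr (\pi_uea a)) a.
Proof. by apply/uea_piP; rewrite reprK. Qed.

Definition uea_add (u v : uea) : uea := \pi_uea (UAdd (repr u) (repr v)).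
Definition uea_mul (u v : uea) : uea := \pi_uea (UMul (repr u) (repr v)).
Definition uea_const (k : F) : uea := \pi_uea (UConst k).
Definition uea_opp (u : uea) : uea := uea_mul (uea_const (-1)) u.
Definition uea_gen (x : L) : uea := \pi_uea (UGen x).

Lemma uea_addE a b : uea_add (\pi_uea a) (\pi_uea b) = \pi_uea (UAdd a b).
Proof. by apply: uea_pi; apply: ueq_add; apply: uea_repr. Qed.

Lemma uea_mulE a b : uea_mul (\pi_uea a) (\pi_uea b) = \pi_uea (UMul a b).
Proof. by apply: uea_pi; apply: ueq_mul; apply: uea_repr. Qed.

Lemma uea_addA : associative uea_add.
Proof.
elim/quotW=> a; elim/quotW=> b; elim/quotW=> c.
rewrite (uea_addE b c) (uea_addE a b) !uea_addE.
by apply: uea_pi; apply: ueq_addA.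
Qed.

Lemma uea_addC : commutative uea_add.
Proof.
elim/quotW=> a; elim/quotW=> b; rewrite !uea_addE.
by apply: uea_pi; apply: ueq_addC.
Qed.

Lemma uea_add0 : left_id (uea_const 0) uea_add.
Proof. by elim/quotW=> a; rewrite uea_addE; apply: uea_pi; apply: ueq_add0. Qed.

Lemma uea_addN : left_inverse (uea_const 0) uea_opp uea_add.
Proof.
elim/quotW=> a; rewrite /uea_opp (uea_mulE _ a) uea_addE.
by apply: uea_pi; apply: ueq_addN.
Qed.

HB.instance Definition _ :=
  GRing.isZmodule.Build uea uea_addA uea_addC uea_add0 uea_addN.

Lemma uea_mulA : associative uea_mul.
Proof.
elim/quotW=> a; elim/quotW=> b; elim/quotW=> c.
rewrite (uea_mulE b c) (uea_mulE a b) !uea_mulE.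
by apply: uea_pi; apply: ueq_mulA.
Qed.

Lemma uea_constC k (u : uea) : uea_mul (uea_const k) u = uea_mul u (uea_const k).
Proof. by elim/quotW: u => a; rewrite !uea_mulE; apply: uea_pi; apply: ueq_constC. Qed.

Lemma uea_mul1l : left_id (uea_const 1) uea_mul.
Proof. by elim/quotW=> a; rewrite uea_mulE; apply: uea_pi; apply: ueq_mul1. Qed.

Lemma uea_mul1r : right_id (uea_const 1) uea_mul.
Proof. by move=> u; rewrite -uea_constC uea_mul1l. Qed.

Lemma uea_mulDl : left_distributive uea_mul +%R.
Proof.
elim/quotW=> a; elim/quotW=> b; elim/quotW=> c.
rewrite [\pi_uea a + _]uea_addE uea_mulE (uea_mulE a) (uea_mulE b).
by rewrite [RHS]uea_addE; apply: uea_pi; apply: ueq_mulDl.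
Qed.

Lemma uea_mulDr : right_distributive uea_mul +%R.
Proof.
elim/quotW=> a; elim/quotW=> b; elim/quotW=> c.
rewrite [\pi_uea b + _]uea_addE uea_mulE (uea_mulE a b) (uea_mulE a c).
by rewrite [RHS]uea_addE; apply: uea_pi; apply: ueq_mulDr.
Qed.

(* The augmentation of the enveloping algebra, used for 1 != 0.               *)
Fixpoint ueps (a : T) : F :=
  match a with
  | UGen _ => 0
  | UConst k => k
  | UAdd a b => ueps a + ueps b
  | UMul a b => ueps a * ueps b
  end.

Lemma ueps_ueq a b : ueq a b -> ueps a = ueps b.
Proof.
elim=> //= *; rewrite ?(add0r, mulr0, mul0r, addr0, mul1r) //; try congruence.
- by rewrite addrA.
- by rewrite addrC.
- by rewrite mulN1r addNr.
- by rewrite mulrA.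
- by rewrite mulrDl.
- by rewrite mulrDr.
- by rewrite mulrC.
Qed.

Lemma uea_1neq0 : uea_const 1 != 0 :> uea.
Proof.
by apply/negP => /uea_piP/ueps_ueq/eqP; rewrite /= oner_eq0.
Qed.

HB.instance Definition _ := GRing.Zmodule_isNzRing.Build uea
  uea_mulA uea_mul1l uea_mul1r uea_mulDl uea_mulDr uea_1neq0.

Definition uea_scale (k : F) (u : uea) : uea := uea_const k * u.

Lemma uea_constM k l : uea_const (k * l) = uea_const k * uea_const l.
Proof. by rewrite [RHS]uea_mulE; apply: uea_pi; apply: ueq_constM. Qed.

Lemma uea_constD k l : uea_const (k + l) = uea_const k + uea_const l.
Proof. by rewrite [RHS]uea_addE; apply: uea_pi; apply: ueq_constD. Qed.

Lemma uea_scaleA k l u : uea_scale k (uea_scale l u) = uea_scale (k * l) u.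
Proof. by rewrite /uea_scale mulrA uea_constM. Qed.

Lemma uea_scale1 : left_id 1 uea_scale.
Proof. exact: uea_mul1l. Qed.

Lemma uea_scaleDr : right_distributive uea_scale +%R.
Proof. by move=> k u v; rewrite /uea_scale mulrDr. Qed.

Lemma uea_scaleDl u : {morph uea_scale^~ u : k l / k + l}.
Proof. by move=> k l; rewrite /uea_scale uea_constD mulrDl. Qed.

HB.instance Definition _ := GRing.Zmodule_isLmodule.Build F uea
  uea_scaleA uea_scale1 uea_scaleDr uea_scaleDl.

Lemma uea_scaleE k (u : uea) : k *: u = uea_const k * u.
Proof. by []. Qed.

Lemma uea_scaleAl k (u v : uea) : k *: (u * v) = (k *: u) * v.
Proof. by rewrite !uea_scaleE mulrA. Qed.

HB.instance Definition _ := GRing.Lmodule_isLalgebra.Build F uea uea_scaleAl.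

Lemma uea_scaleAr k (u v : uea) : k *: (u * v) = u * (k *: v).
Proof.
rewrite !uea_scaleE !mulrA; congr (_ * v); exact: uea_constC.
Qed.

HB.instance Definition _ := GRing.Lalgebra_isAlgebra.Build F uea uea_scaleAr.

Lemma uea_gen_linear : linear uea_gen.
Proof.
move=> k x y; rewrite uea_scaleE [_ * _]uea_mulE [RHS]uea_addE; apply: uea_pi.
apply: ueq_trans (ueq_genD _ _) _; apply: ueq_add (ueq_refl _); exact: ueq_genZ.
Qed.

Lemma uea_gen_br x y :
  uea_gen (lbr x y) = uea_gen x * uea_gen y - uea_gen y * uea_gen x.
Proof.
rewrite -scaleN1r uea_scaleE [uea_gen x * _]uea_mulE [uea_gen y * _]uea_mulE.
by rewrite [_ * _]uea_mulE [RHS]uea_addE; apply: uea_pi; apply: ueq_genB.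
Qed.

Lemma uea_ind (P : uea -> Prop) :
  (forall x, P (uea_gen x)) -> (forall k : F, P k%:A) ->
  (forall u v, P u -> P v -> P (u + v)) ->
  (forall u v, P u -> P v -> P (u * v)) ->
  forall u, P u.
Proof.
move=> Pg Pc Pa Pm; elim/quotW; elim=> [x|k|a Pa' b Pb|a Pa' b Pb].
- exact: Pg.
- by have := Pc k; rewrite uea_scaleE mulr1.
- by rewrite -uea_addE; exact: Pa.
- by rewrite -uea_mulE; exact: Pm.
Qed.

(* The universal property of the enveloping algebra.                          *)
Section Lift.
Variables (A : algType F) (f : L -> A).
Hypotheses (flin : linear f).
Hypotheses (fbr : forall x y, f (lbr x y) = f x * f y - f y * f x).

Fixpoint uterm_lift (a : T) : A :=
  match a with
  | UGen x => f x
  | UConst k => k%:A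
  | UAdd a b => uterm_lift a + uterm_lift b
  | UMul a b => uterm_lift a * uterm_lift b
  end.

Lemma uterm_lift_ueq a b : ueq a b -> uterm_lift a = uterm_lift b.
Proof.
have fD x y : f (x + y) = f x + f y by have := flin 1 x y; rewrite !scale1r.
have f0 : f 0 = 0 by apply: (addrI (f 0)); rewrite -fD !addr0.
have fZ k x : f (k *: x) = k *: f x.
  by have := flin k x 0; rewrite f0 !addr0.
elim=> //=; try (by move=> *; congruence).
- by move=> *; rewrite addrA.
- by move=> *; rewrite addrC.
- by move=> *; rewrite scale0r add0r.
- by move=> *; rewrite -scalerAl scaleN1r mul1r addNr scale0r.
- by move=> *; rewrite mulrA.
- by move=> *; rewrite scale1r mul1r.
- by move=> *; rewrite mulrDl.
- by move=> *; rewrite mulrDr.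
- by move=> *; rewrite -scalerAl -scalerAr mul1r mulr1.
- by move=> *; rewrite scalerDl.
- by move=> *; rewrite -scalerAl mul1r scalerA.
- by move=> *; rewrite -scalerAl mul1r fZ.
- by move=> *; rewrite -scalerAl mul1r scaleN1r fbr.
Qed.

Definition uea_lift (u : uea) : A := uterm_lift (repr u).

Lemma uea_liftE a : uea_lift (\pi_uea a) = uterm_lift a.
Proof. exact/uterm_lift_ueq/uea_repr. Qed.

Lemma uea_lift_gen x : uea_lift (uea_gen x) = f x.
Proof. exact: uea_liftE. Qed.

Lemma uea_liftD u v : uea_lift (u + v) = uea_lift u + uea_lift v.
Proof.
elim/quotW: u => a; elim/quotW: v => b.
by rewrite [_ + _]uea_addE !uea_liftE.
Qed.

Lemma uea_liftM u v : uea_lift (u * v) = uea_lift u * uea_lift v.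
Proof.
elim/quotW: u => a; elim/quotW: v => b.
by rewrite [_ * _]uea_mulE !uea_liftE.
Qed.

Lemma uea_liftA (k : F) : uea_lift k%:A = k%:A.
Proof. by rewrite uea_scaleE mulr1 uea_liftE. Qed.

Lemma uea_lift_unique (h : uea -> A) :
  {morph h : u v / u + v} -> {morph h : u v / u * v} ->
  (forall k : F, h k%:A = k%:A) -> (forall x, h (uea_gen x) = f x) ->
  h =1 uea_lift.
Proof.
move=> hD hM hA hg; elim/uea_ind=> [x|k|u v hu hv|u v hu hv].
- by rewrite hg uea_lift_gen.
- by rewrite hA uea_liftA.
- by rewrite hD uea_liftD hu hv.
- by rewrite hM uea_liftM hu hv.
Qed.

End Lift.

End Enveloping.

(******************************************************************************)
(* Quotients of vector spaces, and the cyclic L-module U(L) / J               *)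
(******************************************************************************)

Section QuotientSpace.
Variables (F : fieldType) (V : lmodType F) (W : submod V).

Definition eqmodW : rel V := fun u v => `[< W (u - v) >].

Lemma submodN u : W u -> W (- u).
Proof. by rewrite -scaleN1r; apply: submodZ. Qed.

Lemma eqmodW_refl : reflexive eqmodW.
Proof. by move=> u; apply/asboolP; rewrite subrr; apply: submod0. Qed.

Lemma eqmodW_sym : symmetric eqmodW.
Proof.
by move=> u v; apply/asboolP/asboolP => /submodN; rewrite opprB.
Qed.

Lemma eqmodW_trans : transitive eqmodW.
Proof.
move=> v u w /asboolP uv /asboolP vw; apply/asboolP.
by have := submodD uv vw; rewrite addrA subrK.
Qed.

Canonical eqmodW_equiv := EquivRel eqmodW eqmodW_refl eqmodW_sym eqmodW_trans.

Definition quotmod : Type := {eq_quot eqmodW_equiv}.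
HB.instance Definition _ := Choice.on quotmod.
HB.instance Definition _ := EqQuotient.on quotmod.

Definition quot_pi (v : V) : quotmod := \pi_quotmod v.

Lemma quot_piP u v : quot_pi u = quot_pi v <-> W (u - v).
Proof.
split=> [/eqP|uv]; first by rewrite eqmodE => /asboolP.
by apply/eqP; rewrite eqmodE; apply/asboolP.
Qed.

Lemma quot_pi_repr v : W (repr (quot_pi v) - v).
Proof. by apply/quot_piP; rewrite /quot_pi reprK. Qed.

Lemma quot_surj (q : quotmod) : exists v, q = quot_pi v.
Proof. by exists (repr q); rewrite /quot_pi reprK. Qed.

Definition quot_add (p q : quotmod) := quot_pi (repr p + repr q).
Definition quot_scale (k : F) (p : quotmod) := quot_pi (k *: repr p).
Definition quot_opp (p : quotmod) := quot_scale (-1) p.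

Lemma quot_addE u v : quot_add (quot_pi u) (quot_pi v) = quot_pi (u + v).
Proof.
apply/quot_piP; rewrite opprD addrACA.
by apply: submodD; apply: quot_pi_repr.
Qed.

Lemma quot_scaleE k u : quot_scale k (quot_pi u) = quot_pi (k *: u).
Proof. by apply/quot_piP; rewrite -scalerBr; apply/submodZ/quot_pi_repr. Qed.

Lemma quot_addA : associative quot_add.
Proof.
move=> p q r; have [u ->] := quot_surj p; have [v ->] := quot_surj q.
have [w ->] := quot_surj r; rewrite (quot_addE v w) (quot_addE u v) !quot_addE.
by rewrite addrA.
Qed.

Lemma quot_addC : commutative quot_add.
Proof.
move=> p q; have [u ->] := quot_surj p; have [v ->] := quot_surj q.
by rewrite !quot_addE addrC.
Qed.

Lemma quot_add0 : left_id (quot_pi 0) quot_add.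
Proof. by move=> p; have [u ->] := quot_surj p; rewrite quot_addE add0r. Qed.

Lemma quot_addN : left_inverse (quot_pi 0) quot_opp quot_add.
Proof.
move=> p; have [u ->] := quot_surj p.
by rewrite /quot_opp quot_scaleE quot_addE scaleN1r addNr.
Qed.

HB.instance Definition _ :=
  GRing.isZmodule.Build quotmod quot_addA quot_addC quot_add0 quot_addN.

Lemma quot_scaleA k l p : quot_scale k (quot_scale l p) = quot_scale (k * l) p.
Proof. by have [u ->] := quot_surj p; rewrite !quot_scaleE scalerA. Qed.

Lemma quot_scale1 : left_id 1 quot_scale.
Proof. by move=> p; have [u ->] := quot_surj p; rewrite quot_scaleE scale1r. Qed.

Lemma quot_scaleDr : right_distributive quot_scale +%R.
Proof.
move=> k p q; have [u ->] := quot_surj p; have [v ->] := quot_surj q.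
by rewrite /+%R /= !(quot_addE, quot_scaleE) scalerDr.
Qed.

Lemma quot_scaleDl p : {morph quot_scale^~ p : k l / k + l}.
Proof.
move=> k l; have [u ->] := quot_surj p.
by rewrite [RHS]/+%R /= !(quot_addE, quot_scaleE) scalerDl.
Qed.

HB.instance Definition _ := GRing.Zmodule_isLmodule.Build F quotmod
  quot_scaleA quot_scale1 quot_scaleDr quot_scaleDl.

Lemma quot_pi_linear : linear quot_pi.
Proof. by move=> k u v; rewrite -quot_addE -quot_scaleE. Qed.

Lemma quot_pi_eq0 u : quot_pi u = 0 <-> W u.
Proof. by rewrite -[u in W u]subr0; apply: quot_piP. Qed.

End QuotientSpace.

Section LeftIdeal.
Variables (F : fieldType) (A : algType F) (S : A -> Prop).

Inductive left_ideal_pred : A -> Prop :=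
| lideal_in a : S a -> left_ideal_pred a
| lideal_0 : left_ideal_pred 0
| lideal_D a b :
    left_ideal_pred a -> left_ideal_pred b -> left_ideal_pred (a + b)
| lideal_M a b : left_ideal_pred b -> left_ideal_pred (a * b).

Lemma lideal_Z c a : left_ideal_pred a -> left_ideal_pred (c *: a).
Proof. by rewrite -[a in _ (c *: a)]mul1r scalerAl; apply: lideal_M. Qed.

Definition left_ideal : submod A := Submod lideal_0 lideal_D lideal_Z.

End LeftIdeal.

Section CyclicModule.
Variables (F : fieldType) (L : lieAlgType F) (S : uea L -> Prop).
Local Notation M := (quotmod (left_ideal S)).
Local Notation "[ u ]_M" := (quot_pi (left_ideal S) u) (format "[ u ]_M").

Definition cyc_act (x : L) (p : M) : M := [ uea_gen x * repr p ]_M.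

Lemma cyc_actE x u : cyc_act x [ u ]_M = [ uea_gen x * u ]_M.
Proof.
apply/quot_piP; rewrite -mulrBr; apply: lideal_M.
exact: (quot_pi_repr (left_ideal S)).
Qed.

Lemma cyc_act_linl p : linear (cyc_act^~ p).
Proof.
move=> k x y; have [u ->] := quot_surj p; rewrite !cyc_actE.
by rewrite uea_gen_linear mulrDl -scalerAl quot_pi_linear.
Qed.

Lemma cyc_act_linr x : linear (cyc_act x).
Proof.
move=> k p q; have [u ->] := quot_surj p; have [v ->] := quot_surj q.
by rewrite -quot_pi_linear !cyc_actE mulrDr -scalerAr quot_pi_linear.
Qed.

Lemma cyc_act_br x y p :
  cyc_act (lbr x y) p = cyc_act x (cyc_act y p) - cyc_act y (cyc_act x p).
Proof.
have [u ->] := quot_surj p; rewrite !cyc_actE uea_gen_br mulrBl !mulrA.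
by rewrite addrC -scaleN1r quot_pi_linear scaleN1r addrC.
Qed.

(* U(L) / U(L) S, with L acting by left multiplication                        *)
Definition cyclic_mod : lieMod L := LieMod cyc_act_linl cyc_act_linr cyc_act_br.

(* the image of 1                                                             *)
Definition cyclic_gen : cyclic_mod := [ 1 ]_M.

End CyclicModule.

Section RestrictToConstants.
Variables (F : fieldType) (g : lieAlgType F) (W : lieMod (current g)).

Definition const_act (x : g) (w : W) : W := lact (tpow x 0) w.

Lemma const_act_linl w : linear (const_act^~ w).
Proof. by move=> k x y; rewrite /const_act tpow_lin lact_linl. Qed.

Lemma const_act_linr x : linear (const_act x).
Proof. exact: lact_linr. Qed.

Lemma const_act_br x y w : const_act (lbr x y) w =
  const_act x (const_act y w) - const_act y (const_act x w).
Proof. by rewrite /const_act -[0%N]/(0 + 0)%N -tpow_br lact_br. Qed.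

(* W as a g-module, g being identified with g (x) 1                           *)
Definition res_const : lieMod g :=
  LieMod const_act_linl const_act_linr const_act_br.

End RestrictToConstants.

(******************************************************************************)
(* The simple Lie algebra of type E6                                          *)
(******************************************************************************)

(* The node k of the diagram is the ordinal of value k - 1.                   *)
Definition node3 : 'I_6 := @Ordinal 6 2 isT.

Definition e6_edges : seq (nat * nat) :=
  [:: (1, 2); (2, 3); (3, 4); (4, 5); (3, 6)]%N.

Definition e6_adj (i j : 'I_6) : bool :=
  ((i.+1, j.+1) \in e6_edges) || ((j.+1, i.+1) \in e6_edges).

Definition e6_cartan (i j : 'I_6) : int :=
  if i == j then 2 else if e6_adj i j then -1 else 0.

Section Roots.
Variables (F : fieldType) (g : fdLieAlgType F).

Definition lie_ideal (J : {vspace g}) :=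
  forall x y : g, y \in J -> lbr x y \in J.

Definition lie_simple :=
  (exists x y : g, lbr x y != 0) /\
  forall J : {vspace g}, lie_ideal J -> J = 0%VS \/ J = fullv.

Definition ad_diagonalizable (x : g) :=
  exists b : seq g, basis_of fullv b /\
    forall y, y \in b -> exists c : F, lbr x y = c *: y.

(* Cartan subalgebras of a semisimple complex Lie algebra: abelian,           *)
(* self-centralizing and consisting of ad-diagonalizable elements.            *)
Definition is_cartan (h : {vspace g}) :=
  [/\ {in h &, forall x y, lbr x y = 0},
      forall x : g, {in h, forall y, lbr y x = 0} -> x \in h &
      {in h, forall x, ad_diagonalizable x}].

Variable h : {vspace g}.

Definition dual := 'Hom(subvs_of h, F^o).
Implicit Type a : dual.

Definition root_space a (x : g) :=
  forall t : subvs_of h, lbr (vsval t) x = (a t : F) *: x.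

Definition is_root a := a != 0 /\ exists2 x : g, x != 0 & root_space a x.

Definition pos_comb (alpha : 'I_6 -> dual) a :=
  exists c : 'I_6 -> nat, a = \sum_i alpha i *+ c i.

Definition is_base (alpha : 'I_6 -> dual) :=
  [/\ forall i, is_root (alpha i),
      basis_of fullv [seq alpha i | i : 'I_6] &
      forall a, is_root a -> pos_comb alpha a \/ pos_comb alpha (- a)].

(* t is the coroot of a: t lies in [g_a, g_(-a)] and a(t) = 2.                *)
Definition is_coroot a (t : subvs_of h) :=
  a t = 2 /\ exists x y : g,
    [/\ root_space a x, root_space (- a) y & vsval t = lbr x y].

End Roots.

(* A simple Lie algebra of type E6 with a Cartan subalgebra, a base of its    *)
(* root system labelled by the nodes, the simple coroots, and a generator     *)
(* e6_root_vec a of the root space of every root a.                           *)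
Record e6Data (F : fieldType) (g : fdLieAlgType F) := E6Data {
  e6_h : {vspace g};
  e6_alpha : 'I_6 -> dual e6_h;
  e6_coroot : 'I_6 -> subvs_of e6_h;
  e6_root_vec : dual e6_h -> g;
  e6_simple : lie_simple g;
  e6_is_cartan : is_cartan e6_h;
  e6_is_base : is_base e6_alpha;
  e6_is_coroot : forall i, is_coroot (e6_alpha i) (e6_coroot i);
  e6_cartan_matrix : forall i j,
    e6_alpha j (e6_coroot i) = (e6_cartan i j)%:~R;
  e6_root_vecP : forall a, is_root a ->
    [/\ e6_root_vec a != 0, root_space a (e6_root_vec a) &
        forall x, root_space a x -> exists c : F, x = c *: e6_root_vec a]
}.
Arguments e6_root_vec {F g} _ _.
Arguments e6_root_vecP {F g} _ _ _.

Section E6Modules.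
Variables (F : fieldType) (g : fdLieAlgType F) (D : e6Data g).
Local Notation h := (e6_h D).
Local Notation alpha := (e6_alpha D).

Definition pos_root (a : dual h) := is_root a /\ pos_comb alpha a.

Definition hco (i : 'I_6) : g := vsval (e6_coroot D i).

Definition xminus (a : dual h) : g := e6_root_vec D (- a).

Definition nplus : submod g :=
  lspan (fun x : g => exists2 a, pos_root a & root_space a x).

(* n^+[t] and h (x) tC[t]                                                     *)
Definition nplus_t (f : current g) := forall r, nplus (f r).
Definition h_tt (f : current g) := f 0%N = 0 /\ forall r, f r \in h.

(* Dominant integral weights are given by their coordinates on the            *)
(* fundamental weights: mu stands for the weight taking the value mu i at h_i *)
Definition is_V (mu : 'I_6 -> nat) (V : lieMod g) :=
  irreducible V /\
  exists v : V, [/\ v != 0, forall x, nplus x -> lact x v = 0 &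
    forall i, lact (hco i) v = (mu i)%:R *: v].

Local Notation U := (uea (current g)).
Local Notation "x *t^ r" := (uea_gen (tpow x r) : U) (at level 35, r at level 2).

Section KR.
Variables (i : 'I_6) (m : nat).

Inductive KR_rel : U -> Prop :=
| KR_nplus f : nplus_t f -> KR_rel (uea_gen f)
| KR_htt f : h_tt f -> KR_rel (uea_gen f)
| KR_hj j : j != i -> KR_rel (hco j *t^ 0)
| KR_xj j : j != i -> KR_rel (xminus (alpha j) *t^ 0)
| KR_hi : KR_rel (hco i *t^ 0 - m%:R)
| KR_xi : KR_rel ((xminus (alpha i) *t^ 0) ^+ m.+1)
| KR_xi1 : KR_rel (xminus (alpha i) *t^ 1).

Definition KR : lieMod (current g) := cyclic_mod KR_rel.
Definition KR_gen : KR := cyclic_gen KR_rel.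

Definition R_node (r : nat) (a : dual h) :=
  pos_root a /\ lact (tpow (xminus a) r) KR_gen = 0.

End KR.

Section Mlambda.
Variable lam : 'I_6 -> nat.

Definition R_wt (r : nat) (a : dual h) := forall i, R_node i (lam i) r a.

Inductive M_rel : U -> Prop :=
| M_nplus f : nplus_t f -> M_rel (uea_gen f)
| M_htt f : h_tt f -> M_rel (uea_gen f)
| M_hi i : M_rel (hco i *t^ 0 - (lam i)%:R)
| M_xi i : M_rel ((xminus (alpha i) *t^ 0) ^+ (lam i).+1)
| M_xr r a : R_wt r a -> M_rel (xminus a *t^ r).

Definition M : lieMod (current g) := cyclic_mod M_rel.

End Mlambda.

Definition multiplicity_free (W : lieMod g) :=
  forall (mu : 'I_6 -> nat) (V : lieMod g), is_V mu V -> mult_le V W 1.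

End E6Modules.

(* Main.v *)
Require Import Defs.
From HB Require Import structures.
From mathcomp Require Import all_boot all_order all_algebra.
From mathcomp Require Import zify ring.
From mathcomp Require Import boolp.
From mathcomp Require Import reals complex.

(** Write f_i, h_i, e_i for the Chevalley generators, x_a for a root vector of the
negative root -a, and v for the generator of M = M(lambda), lambda(h_3) = 0.

The size of M. A positive root of E6 has coefficient at most 2 on every simple
root other than alpha_3, and lambda is supported away from node 3, so the
defining relations make t^2 g[t] kill v, hence kill M (M_t2). The elements of
g (x) t therefore act by commuting operators, and x_a (x) t kills v unless a
has a coefficient 2 at some node other than 3. Seven roots have this property:
six that we call special, and epsilon. It follows that M is spanned by the
vectors obtained by applying products of lowering operators from n^- to
monomials in the seven operators x_b (x) t applied to v (M_lowered). Moreover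
f_3 v = 0, and f_3 sends x_delta to a nonzero multiple of x_epsilon and
commutes with the six other x_b, where delta = epsilon - alpha_3 is one of the
special roots. So every monomial with a factor epsilon lies in f_3 M
(mono_epsilon). The special roots are linearly independent (special_indep):
the remaining monomials have pairwise distinct weights, and every weight space
of M / n^- M has dimension at most one (M_mod_nminus).

From M / n^- M to singular vectors. An embedded copy of V(mu) contributes a
singular vector of weight mu, and two independent ones have a nonzero
combination in n^- M. It vanishes by singular_nminus, which holds for any
integrable g-module whose weights lie below a fixed one. There the Casimir
operator acts on a singular vector of dominant weight nu by a scalar that
increases strictly with nu in the dominance order (casv_lt). Climbing with
n^+, one sees that a vector of weight above mu is killed by a product of
factors Casimir - c with c different from the scalar of mu (away_above); hence
so is a vector of weight mu in n^- M, and it cannot be a nonzero eigenvector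
for the scalar of mu.

The Lie algebra. The roots of g are stable under the simple reflections, by
sl2-theory, are nonnegative or nonpositive combinations of simple roots, and
include no proper multiple of a simple root; since the E6 form is positive
definite, this forces the positive roots to be the 36 known ones (isrootP).
The Killing form takes positive values on the coroots, so its radical, an
ideal of the simple algebra g, is zero (killing_nondeg). *)

Set Implicit Arguments.
Unset Strict Implicit.
Unset Printing Implicit Defensive.
Import Order.TTheory GRing.Theory Num.Theory.
Local Open Scope ring_scope.

(** * The root lattice and the roots of E6 *)

(** The root lattice: c stands for the sum of the c i *: alpha_i. *)
Notation rlat := {ffun 'I_6 -> int}.

Notation n1 := (@Ordinal 6 0 isT).
Notation n2 := (@Ordinal 6 1 isT).
Notation n3 := (@Ordinal 6 2 isT).
Notation n4 := (@Ordinal 6 3 isT).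
Notation n5 := (@Ordinal 6 4 isT).
Notation n6 := (@Ordinal 6 5 isT).

Lemma sum6 (V : nmodType) (f : 'I_6 -> V) :
  \sum_i f i = f n1 + f n2 + f n3 + f n4 + f n5 + f n6.
Proof.
rewrite !big_ord_recr big_ord0 /= add0r.
by congr (_ + _ + _ + _ + _ + _); congr f; apply: val_inj.
Qed.

Lemma forall6 (P : 'I_6 -> Prop) :
  P n1 -> P n2 -> P n3 -> P n4 -> P n5 -> P n6 -> forall i, P i.
Proof.
move=> p1 p2 p3 p4 p5 p6 [[|[|[|[|[|[|//]]]]]] hi].
- by rewrite (_ : Ordinal hi = n1) //; apply: val_inj.
- by rewrite (_ : Ordinal hi = n2) //; apply: val_inj.
- by rewrite (_ : Ordinal hi = n3) //; apply: val_inj.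
- by rewrite (_ : Ordinal hi = n4) //; apply: val_inj.
- by rewrite (_ : Ordinal hi = n5) //; apply: val_inj.
- by rewrite (_ : Ordinal hi = n6) //; apply: val_inj.
Qed.

(** The value on the coroot h_j of the weight with simple-root coordinates c. *)
Definition hval (j : 'I_6) (c : rlat) : int := \sum_i e6_cartan j i * c i.

Lemma hvalE c :
  (hval n1 c = 2 * c n1 - c n2) * (hval n2 c = 2 * c n2 - c n1 - c n3) *
  (hval n3 c = 2 * c n3 - c n2 - c n4 - c n6) *
  (hval n4 c = 2 * c n4 - c n3 - c n5) * (hval n5 c = 2 * c n5 - c n4) *
  (hval n6 c = 2 * c n6 - c n3).
Proof. by rewrite /hval !sum6 /e6_cartan /e6_adj /=; do ?split; ring. Qed.

Lemma hval_is_additive j : zmod_morphism (hval j).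
Proof.
by move=> a b; rewrite /hval -sumrB; apply: eq_bigr => i _; rewrite !ffunE mulrBr.
Qed.
HB.instance Definition _ j := GRing.isZmodMorphism.Build _ _ (hval j) (hval_is_additive j).

Lemma hvalD j c d : hval j (c + d) = hval j c + hval j d.
Proof. exact: raddfD. Qed.
Lemma hvalB j c d : hval j (c - d) = hval j c - hval j d.
Proof. exact: raddfB. Qed.
Lemma hvalN j c : hval j (- c) = - hval j c.
Proof. exact: raddfN. Qed.
Lemma hval0 j : hval j 0 = 0.
Proof. exact: raddf0. Qed.
Lemma hvalMz j c k : hval j (c *~ k) = hval j c *~ k.
Proof. exact: raddfMz. Qed.

Definition simple (i : 'I_6) : rlat := [ffun j => (j == i)%:Z].

Lemma hval_simple i j : hval j (simple i) = e6_cartan j i.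
Proof.
rewrite /hval (bigD1 i) //= ffunE eqxx mulr1 big1 ?addr0 // => k /negbTE ki.
by rewrite ffunE ki mulr0.
Qed.

Lemma simpleZ i (n : int) j : (simple i *~ n) j = n *+ (j == i).
Proof.
by rewrite ffunMzE ffunE; case: eqP => _; rewrite ?mul0rz // mulr1n intz.
Qed.

(** The coordinates of the 36 positive roots, by increasing height. *)
Definition e6_list : seq (seq nat) := [::
  [:: 0; 0; 0; 0; 0; 1]; [:: 0; 0; 0; 0; 1; 0]; [:: 0; 0; 0; 1; 0; 0];
  [:: 0; 0; 1; 0; 0; 0]; [:: 0; 1; 0; 0; 0; 0]; [:: 1; 0; 0; 0; 0; 0];
  [:: 0; 0; 0; 1; 1; 0]; [:: 0; 0; 1; 0; 0; 1]; [:: 0; 0; 1; 1; 0; 0];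
  [:: 0; 1; 1; 0; 0; 0]; [:: 1; 1; 0; 0; 0; 0]; [:: 0; 0; 1; 1; 0; 1];
  [:: 0; 0; 1; 1; 1; 0]; [:: 0; 1; 1; 0; 0; 1]; [:: 0; 1; 1; 1; 0; 0];
  [:: 1; 1; 1; 0; 0; 0]; [:: 0; 0; 1; 1; 1; 1]; [:: 0; 1; 1; 1; 0; 1];
  [:: 0; 1; 1; 1; 1; 0]; [:: 1; 1; 1; 0; 0; 1]; [:: 1; 1; 1; 1; 0; 0];
  [:: 0; 1; 1; 1; 1; 1]; [:: 0; 1; 2; 1; 0; 1]; [:: 1; 1; 1; 1; 0; 1];
  [:: 1; 1; 1; 1; 1; 0]; [:: 0; 1; 2; 1; 1; 1]; [:: 1; 1; 1; 1; 1; 1];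
  [:: 1; 1; 2; 1; 0; 1]; [:: 0; 1; 2; 2; 1; 1]; [:: 1; 1; 2; 1; 1; 1];
  [:: 1; 2; 2; 1; 0; 1]; [:: 1; 1; 2; 2; 1; 1]; [:: 1; 2; 2; 1; 1; 1];
  [:: 1; 2; 2; 2; 1; 1]; [:: 1; 2; 3; 2; 1; 1]; [:: 1; 2; 3; 2; 1; 2]
]%N.

Definition of_coefs (s : seq nat) : rlat := [ffun i : 'I_6 => (nth 0%N s i)%:Z].

Definition e6_roots : seq rlat := map of_coefs e6_list.

(** The positive roots with a coefficient 2 at some node other than node 3, apart
from epsilon below. *)
Definition special_list : seq (seq nat) := [::
  [:: 1; 2; 2; 1; 0; 1]; [:: 1; 2; 2; 1; 1; 1];
  [:: 0; 1; 2; 2; 1; 1]; [:: 1; 1; 2; 2; 1; 1];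
  [:: 1; 2; 2; 2; 1; 1]; [:: 1; 2; 3; 2; 1; 2]]%N.
Arguments e6_roots : simpl never.

Definition delta : rlat := of_coefs [:: 1; 2; 2; 2; 1; 1]%N.
Definition epsilon : rlat := of_coefs [:: 1; 2; 3; 2; 1; 1]%N.
Definition special : seq rlat := map of_coefs special_list.

(** The values of hval, computed from a list so that finite verifications on the
roots can be done by evaluation. *)
Definition hval_list (s : seq nat) (j : nat) : int :=
  let c k := Posz (nth 0%N s k) in
  let c1 := c 0%N in let c2 := c 1%N in let c3 := c 2%N in
  let c4 := c 3%N in let c5 := c 4%N in let c6 := c 5%N in
  nth 0 [:: 2 * c1 - c2; 2 * c2 - c1 - c3; 2 * c3 - c2 - c4 - c6;
            2 * c4 - c3 - c5; 2 * c5 - c4; 2 * c6 - c3] j.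

Lemma hval_of_coefs j s : hval j (of_coefs s) = hval_list s j.
Proof. by elim/forall6: j; rewrite hvalE !ffunE. Qed.

Lemma simple_of_coefs i : simple i = of_coefs (mkseq (fun k => (k == i :> nat) : nat) 6).
Proof. by apply/ffunP => j; rewrite !ffunE nth_mkseq. Qed.

Lemma simple_in_roots i : simple i \in e6_roots.
Proof.
rewrite simple_of_coefs; apply: map_f; elim/forall6: i; exact: isT.
Qed.

Definition refl i (c : rlat) : rlat := c - simple i *~ hval i c.

Lemma reflE i c j : refl i c j = c j - hval i c *+ (j == i).
Proof. by rewrite 2!ffunE simpleZ. Qed.

Definition refl_check (s : seq nat) (i : nat) : bool :=
  (s == mkseq (fun k => (k == i) : nat) 6) ||
  has (fun s' => all (fun k => Posz (nth 0%N s' k) ==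
     Posz (nth 0%N s k) - hval_list s i *+ (k == i)) (iota 0 6)) e6_list.

Lemma refl_roots i c : c \in e6_roots -> c != simple i -> refl i c \in e6_roots.
Proof.
case/mapP=> s sl -> {c}.
have : all (fun s => all (refl_check s) (iota 0 6)) e6_list by vm_compute.
move/allP/(_ s sl)/allP/(_ (val i)); rewrite mem_iota ltn_ord => /(_ isT).
case/orP=> [/eqP ->|/hasP[s' s'l /allP h] _]; first by rewrite simple_of_coefs eqxx.
suff -> : refl i (of_coefs s) = of_coefs s' by apply: map_f.
apply/ffunP => k; have /h/eqP : val k \in iota 0 6 by rewrite mem_iota ltn_ord.
by rewrite reflE hval_of_coefs !ffunE => ->.
Qed.

(** A positive root that is not simple pairs to 1 with some simple coroot, so that
subtracting the simple root is a reflection. *)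
Lemma lower_root c : c \in e6_roots -> (forall i, c != simple i) ->
  exists i, [/\ hval i c = 1, c - simple i \in e6_roots & 0 < c i].
Proof.
case/mapP=> s sl -> {c} ns.
have : all (fun s => has (fun i => (s == mkseq (fun k => (k == i) : nat) 6)
    || (hval_list s i == 1) && (0 < nth 0%N s i)%N) (iota 0 6)) e6_list by vm_compute.
move/allP/(_ s sl)/hasP=> [ i]; rewrite mem_iota /= => hi.
have := ns (Ordinal hi); rewrite simple_of_coefs /= => ns'.
case/orP=> [/eqP si|/andP[/eqP h1 h2]]; first by rewrite si eqxx in ns'.
have h1' : hval (Ordinal hi) (of_coefs s) = 1 by rewrite hval_of_coefs.
exists (Ordinal hi); split => //; last by rewrite ffunE ltz_nat.
have := refl_roots (map_f _ sl) (ns (Ordinal hi)).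
by rewrite /refl h1'.
Qed.

Lemma roots_special c : c \in e6_roots ->
  [\/ c = epsilon, c \in special | forall i, i != n3 -> c i <= 1].
Proof.
case/mapP=> s sl -> {c}.
have : all (fun s => [|| s == [:: 1; 2; 3; 2; 1; 1]%N, s \in special_list |
   all (fun i => (i == 2%N) || (nth 0%N s i <= 1)%N) (iota 0 6)]) e6_list by vm_compute.
move/allP/(_ s sl)/or3P=> [/eqP ->|sp|/allP h]; [by constructor 1| |].
  by constructor 2; apply: map_f.
constructor 3 => i i3; rewrite ffunE.
have := h (val i); rewrite mem_iota ltn_ord => /(_ isT).
by rewrite -val_eqE /= in i3; rewrite (negbTE i3).
Qed.

Lemma roots_le2 c i : c \in e6_roots -> i != n3 -> c i <= 2.
Proof.
case/mapP=> s sl -> {c} i3.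
have : all (fun s => all (fun i => (i == 2%N) || (nth 0%N s i <= 2)%N)
  (iota 0 6)) e6_list by vm_compute.
move/allP/(_ s sl)/allP/(_ (val i)); rewrite mem_iota ltn_ord => /(_ isT).
by rewrite -val_eqE /= in i3; rewrite (negbTE i3) ffunE.
Qed.

Lemma roots_ge0 c i : c \in e6_roots -> 0 <= c i.
Proof. by case/mapP=> s _ ->; rewrite ffunE. Qed.

Lemma roots_neq0 c : c \in e6_roots -> c != 0.
Proof.
case/mapP=> s sl -> {c}; apply/eqP => s0.
have : all (fun s => has (fun i => nth 0%N s i != 0%N) (iota 0 6)) e6_list by vm_compute.
move/allP/(_ s sl)/hasP=> [ i]; rewrite mem_iota /= => hi.
by have := congr1 (fun c : rlat => c (Ordinal hi)) s0; rewrite !ffunE /= => -[->].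
Qed.

(** The sum of the positive roots is 2 rho. *)
Lemma hval_sum_roots j : \sum_(c <- e6_roots) hval j c = 2.
Proof.
rewrite big_map (eq_bigr (fun s => hval_list s j)) => [|s _]; last exact: hval_of_coefs.
by elim/forall6: j; rewrite unlock; vm_compute.
Qed.

Lemma uniq_map_of_coefs (l : seq (seq nat)) :
  all (fun s => size s == 6)%N l -> uniq l -> uniq (map of_coefs l).
Proof.
move=> /allP l6 ul; rewrite map_inj_in_uniq // => s t sl tl st.
apply: (@eq_from_nth _ 0%N) => [|i]; first by rewrite !(eqP (l6 _ _)).
rewrite (eqP (l6 _ sl)) => hi.
by have := congr1 (fun c : rlat => c (Ordinal hi)) st; rewrite !ffunE => -[].
Qed.

Lemma uniq_e6_roots : uniq e6_roots.
Proof. exact: uniq_map_of_coefs. Qed.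

Definition nneg (c : rlat) : Prop := forall i, 0 <= c i.

Definition height (c : rlat) : int := \sum_i c i.

(** Otherwise the value of the E6 form at c would be at most 0; but six times that
form is a sum of six weighted squares that vanish together only at 0. *)
Lemma e6_posdef c : nneg c -> c != 0 -> exists i, 0 < c i /\ 0 < hval i c.
Proof.
move=> c0 cn0; apply: contrapT => /forallNP h.
have le0 i : c i * hval i c <= 0.
  have [ci|ci] := ltP 0 (c i); last first.
    rewrite (_ : c i = 0) ?mul0r //.
    by apply/eqP; rewrite eq_le ci (c0 i).
  rewrite pmulr_rle0 // leNgt; apply/negP => hi; exact: (h i).
have : \sum_i c i * hval i c <= 0 by apply: sumr_le0.
apply/negP; rewrite -ltNge sum6 !hvalE.
have : [exists i, c i != 0].
  apply/existsP; apply: contrapT => /forallNP z; case/eqP: cn0.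
  by apply/ffunP => i; rewrite [RHS]ffunE; have /negP := z i; rewrite negbK => /eqP.
move=> /existsP[i ci].
set q := (X in 0 < X).
have id6 : 6 * q = 3 * (2 * c n1 - c n2) ^+ 2 + (3 * c n2 - 2 * c n3) ^+ 2 +
  3 * (2 * c n5 - c n4) ^+ 2 + (3 * c n4 - 2 * c n3) ^+ 2 +
  3 * (2 * c n6 - c n3) ^+ 2 + c n3 ^+ 2 by rewrite /q; ring.
clearbody q.
have := sqr_ge0 (2 * c n1 - c n2); have := sqr_ge0 (3 * c n2 - 2 * c n3).
have := sqr_ge0 (2 * c n5 - c n4); have := sqr_ge0 (3 * c n4 - 2 * c n3).
have := sqr_ge0 (2 * c n6 - c n3); have := sqr_ge0 (c n3).
move=> p1 p2 p3 p4 p5 p6.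
rewrite ltNge; apply/negP => q0.
have z (x : int) : x ^+ 2 = 0 -> x = 0 by move/eqP; rewrite sqrf_eq0 => /eqP.
have aux (r a b d e f k : int) : 6 * r = 3 * a + b + 3 * d + e + 3 * f + k ->
    r <= 0 -> 0 <= a -> 0 <= b -> 0 <= d -> 0 <= e -> 0 <= f -> 0 <= k ->
    [/\ a = 0, b = 0, d = 0, e = 0 & f = 0 /\ k = 0].
  by move=> *; do 5?split; lia.
have [/z e1 /z e2 /z e5 /z e4 [/z e6 /z e3]] := aux _ _ _ _ _ _ _ id6 q0 p6 p5 p4 p3 p2 p1.
have {}e3 : c n3 = 0 := e3.
rewrite e3 in e1 e2 e4 e6; clear id6 q0 p1 p2 p3 p4 p5 p6 aux z le0 h.
have aux (a b d e f k : int) : 2 * a - b = 0 -> 3 * b - 2 * 0 = 0 ->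
    2 * f - e = 0 -> 3 * e - 2 * 0 = 0 -> 2 * k - 0 = 0 ->
    [/\ a = 0, b = 0, e = 0, f = 0 & k = 0] by move=> *; do 4?split; lia.
have [a1 a2 a4 a5 a6] := aux _ _ 0 _ _ _ e1 e2 e5 e4 e6.
by move: ci; elim/forall6: i; rewrite ?e3 ?a1 ?a2 ?a4 ?a5 ?a6 eqxx.
Qed.

Lemma hval_refl i c : hval i (refl i c) = - hval i c.
Proof. by rewrite /refl hvalB hvalMz hval_simple /e6_cartan eqxx; lia. Qed.

Lemma reflK i : involutive (refl i).
Proof.
move=> c; rewrite {1}/refl hval_refl /refl.
by rewrite mulrNz opprK subrK.
Qed.

Lemma height_refl i c : height (refl i c) = height c - hval i c.
Proof.
rewrite /height (eq_bigr _ (fun j _ => reflE i c j)) sumrB; congr (_ - _).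
by rewrite (bigD1 i) //= eqxx big1 ?addr0 // => j /negbTE ->.
Qed.

Lemma height_ge0 c : nneg c -> 0 <= height c.
Proof. by move=> c0; apply: sumr_ge0. Qed.

Lemma nneg_height0 c : nneg c -> height c = 0 -> c = 0.
Proof.
move=> c0 /eqP; rewrite psumr_eq0 // => /allP h; apply/ffunP => i.
by rewrite ffunE; apply/eqP/h; rewrite mem_index_enum.
Qed.

(** The formal properties of the roots of g, proved further on, determine the
positive ones. *)
Section RootSystem.
Variable isroot : rlat -> Prop.
Hypothesis root_neq0 : forall c, isroot c -> c != 0.
Hypothesis root_sign : forall c, isroot c -> nneg c \/ nneg (- c).
Hypothesis root_refl : forall i c, isroot c -> isroot (refl i c).
Hypothesis root_mult : forall i k, isroot (simple i *+ k.+1) -> k = 0%N.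
Hypothesis root_simple : forall i, isroot (simple i).

(** By induction on the height: some simple reflection lowers a nonsimple positive
root, and the list is stable under the reflection back. *)
Lemma isroot_roots c : isroot c -> nneg c -> c \in e6_roots.
Proof.
move: {2}`|height c|%N (leqnn `|height c|%N) => n.
elim: n c => [|n IHn] c hn rc c0.
  have h0 := height_ge0 c0; move: (root_neq0 rc).
  by rewrite (nneg_height0 c0) ?eqxx //; lia.
have [i [ci hi]] := e6_posdef c0 (root_neq0 rc).
have rc' := root_refl i rc; have hrc := height_refl i c.
have [c'0|c'0] := root_sign rc'.
  have c'r : refl i c \in e6_roots.
    apply: IHn => //; have := height_ge0 c0; have := height_ge0 c'0.
    by rewrite hrc; lia.
  have [c'i|c'i] := eqVneq (refl i c) (simple i).
    move: hi; rewrite -[c](reflK i) c'i hval_refl hval_simple.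
    by rewrite /e6_cartan eqxx.
  by rewrite -[c](reflK i); apply: refl_roots.
have ci' : c = simple i *+ `|c i|%N.
  apply/ffunP => j; rewrite pmulrn simpleZ.
  have [->|ji] := eqVneq j i; first by rewrite mulr1n gez0_abs ?(c0 i).
  apply/eqP; rewrite mulr0n eq_le c0 andbT.
  by have := c'0 j; rewrite ffunE reflE (negbTE ji) mulr0n subr0 oppr_ge0.
move: rc; rewrite ci'; have : (0 < `|c i|)%N by lia.
by case: `|c i|%N => // k _ /root_mult ->; apply: simple_in_roots.
Qed.

Lemma roots_isroot c : c \in e6_roots -> isroot c.
Proof.
move: {2}`|height c|%N (leqnn `|height c|%N) => n.
elim: n c => [|n IHn] c hn rc.
  have c0 i : 0 <= c i := roots_ge0 i rc.
  have h0 := height_ge0 c0; move: (roots_neq0 rc).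
  by rewrite (nneg_height0 c0) ?eqxx //; lia.
have [[i ->]|/forallNP ns] := pselect (exists i, c = simple i); first exact: root_simple.
have [i|i [hi ri _]] := lower_root rc; first by apply/eqP/ns.
have re : c - simple i = refl i c by rewrite /refl hi.
rewrite -[c](reflK i) -re; apply/root_refl/IHn => //.
have := height_ge0 (fun j => roots_ge0 j rc); have := height_ge0 (fun j => roots_ge0 j ri).
by rewrite re height_refl hi; lia.
Qed.

End RootSystem.

Lemma sum_special (s : seq rlat) : all [in special] s ->
  \sum_(b <- s) b = \sum_(b <- special) b *+ count_mem b s.
Proof.
have us : uniq special by exact: uniq_map_of_coefs.
elim: s => [_|x s IHs /= /andP[xs /IHs sE]].
  by rewrite big_nil big1.
rewrite big_cons sE (eq_bigr _ (fun b _ => mulrnDr b _ _)) big_split /=; congr (_ + _).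
rewrite (bigD1_seq x) //= eqxx big1 ?addr0 // => b bx.
by rewrite eq_sym (negbTE bx).
Qed.

(** The six special roots are linearly independent, so a sum determines the
multiplicities of its terms. *)
Lemma special_indep (s t : seq rlat) : all [in special] s -> all [in special] t ->
  \sum_(b <- s) b = \sum_(b <- t) b -> perm_eq s t.
Proof.
move=> ss tt; rewrite !sum_special //.
move=> st.
have coord (i : 'I_6) : \sum_(l <- special_list) Posz (nth 0%N l i * count_mem (of_coefs l) s) =
               \sum_(l <- special_list) Posz (nth 0%N l i * count_mem (of_coefs l) t).
  have E u : (\sum_(b <- special) b *+ count_mem b u) i =
      \sum_(l <- special_list) Posz (nth 0%N l i * count_mem (of_coefs l) u).
    rewrite sum_ffunE big_map; apply: eq_bigr => l _.
    by rewrite ffunMnE ffunE -mulr_natr natz -PoszM.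
  by rewrite -!E st.
have ct b : b \in special -> count_mem b s = count_mem b t.
  move: (coord n1) (coord n2) (coord n3) (coord n4) (coord n5) (coord n6).
  rewrite /special /special_list !big_cons !big_nil /= => e1 e2 e3 e4 e5 e6.
  by rewrite !inE => /or4P[| | |/or3P[]] /eqP ->; lia.
apply/allP => b; rewrite mem_cat => /orP bst; apply/eqP/ct.
by case: bst => [/(allP ss)|/(allP tt)].
Qed.

(** * Modules, and representations of sl2 *)

Section LieModTheory.
Variables (F : fieldType) (L : lieAlgType F) (V : lieMod L).
Implicit Types (x y : L) (u v : V).

Lemma lactDr x u v : lact x (u + v) = lact x u + lact x v.
Proof. by have := lact_linr x 1 u v; rewrite !scale1r. Qed.
Lemma lactDl x y v : lact (x + y) v = lact x v + lact y v.
Proof. by have := lact_linl v 1 x y; rewrite !scale1r. Qed.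
Lemma lact0r x : lact x (0 : V) = 0.
Proof. by apply: (addrI (lact x 0)); rewrite -lactDr !addr0. Qed.
Lemma lact0l v : lact (0 : L) v = 0.
Proof. by apply: (addrI (lact 0 v)); rewrite -lactDl !addr0. Qed.
Lemma lactZr c x v : lact x (c *: v) = c *: lact x v.
Proof. by have := lact_linr x c v 0; rewrite !addr0 lact0r addr0. Qed.
Lemma lactZl c x v : lact (c *: x) v = c *: lact x v.
Proof. by have := lact_linl v c x 0; rewrite !addr0 lact0l addr0. Qed.
Lemma lactNl x v : lact (- x) v = - lact x v.
Proof. by rewrite -(scaleN1r x) lactZl scaleN1r. Qed.
Lemma lact_sumr I (r : seq I) (P : pred I) (f : I -> V) x :
  lact x (\sum_(i <- r | P i) f i) = \sum_(i <- r | P i) lact x (f i).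
Proof. by apply: (big_morph (lact x)) => [u v|]; rewrite ?lactDr ?lact0r. Qed.
Lemma lact_suml I (r : seq I) (P : pred I) (f : I -> L) v :
  lact (\sum_(i <- r | P i) f i) v = \sum_(i <- r | P i) lact (f i) v.
Proof.
by apply: (big_morph (fun x => lact x v)) => [x y|]; rewrite ?lactDl ?lact0l.
Qed.
Lemma lact_swap x y v : lact x (lact y v) = lact y (lact x v) + lact (lbr x y) v.
Proof. by rewrite lact_br addrCA subrr addr0. Qed.

End LieModTheory.

Section Adjoint.
Variables (F : fieldType) (L : lieAlgType F).

Lemma ad_br (x y v : L) : lbr (lbr x y) v = lbr x (lbr y v) - lbr y (lbr x v).
Proof.
have := lbr_jacobi x y v; rewrite (lbrC v (lbr x y)) (lbrC v x).
have -> : lbr y (- lbr x v) = - lbr y (lbr x v).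
  by rewrite -scaleN1r lbrZr scaleN1r.
by move/eqP; rewrite subr_eq0 => /eqP.
Qed.

Lemma lbrNl (x y : L) : lbr (- x) y = - lbr x y.
Proof. by rewrite -(scaleN1r x) lbrZl scaleN1r. Qed.

Definition adjoint : lieMod L :=
  @LieMod F L L (@lbr F L) (@lbr_linl F L) (@lbr_linr F L) ad_br.
End Adjoint.

Section LieSpan.
Variables (F : fieldType) (V : lmodType F).

Lemma lspan_sum (S : submod V) I (r : seq I) (P : pred I) (f : I -> V) :
  (forall i, P i -> S (f i)) -> S (\sum_(i <- r | P i) f i).
Proof.
move=> h; elim/big_rec: _ => [|i v Pi Sv]; first exact: submod0.
by apply: submodD => //; apply: h.
Qed.

Lemma lspan_ind (S : V -> Prop) (T : V -> Prop) : (forall v, S v -> T v) -> T 0 ->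
  (forall u v, T u -> T v -> T (u + v)) -> (forall c v, T v -> T (c *: v)) ->
  forall v, lspan S v -> T v.
Proof. by move=> h1 h2 h3 h4 v; elim=> *; [exact: h1|exact: h2|exact: h3|exact: h4]. Qed.

End LieSpan.

Section Sl2.
Variables (F : numFieldType) (L : lieAlgType F) (V : lieMod L) (e f h : L).
Hypotheses (ef : lbr e f = h) (he : lbr h e = 2 *: e) (hf : lbr h f = (-2) *: f).
Implicit Types (c : F) (v : V).
Local Notation E := (lact e).
Local Notation "f ^^ k" := (iter k (lact f)) (at level 20).

Lemma sl2_wt_iter c v k : lact h v = c *: v ->
  lact h ((f ^^ k) v) = (c - k%:R *+ 2) *: (f ^^ k) v.
Proof.
move=> hv; elim: k => [|k IHk]; first by rewrite mul0rn subr0.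
rewrite iterS lact_swap hf IHk lactZr lactZl -scalerDl; congr (_ *: _).
by rewrite -natr1; ring.
Qed.

(** The term with k.-1 has coefficient 0 when k = 0, so the truncation is harmless. *)
Lemma sl2_e_iter c v k : lact h v = c *: v ->
  E ((f ^^ k) v) = (f ^^ k) (E v) + (k%:R * (c - k%:R + 1)) *: (f ^^ k.-1) v.
Proof.
move=> hv; elim: k => [|k IHk]; first by rewrite mul0r scale0r addr0.
rewrite iterS lact_swap ef IHk lactDr lactZr (sl2_wt_iter _ hv) -addrA /=.
congr (_ + _); case: k {IHk} => [|k] /=.
  by rewrite mul0r scale0r add0r; congr (_ *: _); ring.
by rewrite -scalerDl; congr (_ *: _); rewrite -!natr1; ring.
Qed.

Lemma sl2_iterZ x k c v : (x ^^ k) (c *: v) = c *: (x ^^ k) v.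
Proof. by elim: k => // k IHk; rewrite !iterS IHk lactZr. Qed.

Lemma sl2_iter0 x k : (x ^^ k) (0 : V) = 0.
Proof. by elim: k => // k IHk; rewrite !iterS IHk lact0r. Qed.

(** Injectivity of f^n from weight n to weight -n. If f^n v = 0 then
f^(n+2) (e v) = 0 by the commutation rule, so that e v = 0 by induction on the
nilpotency order of e, and then e^n f^n v is a nonzero multiple of v. *)
Lemma sl2_iter_inj n k v : lact h v = n%:R *: v -> (e ^^ k) v = 0 ->
  (f ^^ n) v = 0 -> v = 0.
Proof.
elim: k n v => // k IHk n v hv ek fn.
have Ev0 : E v = 0.
  apply: (IHk n.+2).
  - rewrite lact_swap hv he lactZr lactZl -scalerDl; congr (_ *: _).
    by rewrite -[n.+2]addn2 natrD.
  - by rewrite -iterSr.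
  have fz j : (f ^^ (j + n)) v = 0.
    by rewrite iterD fn; elim: j => // j IHj; rewrite iterS IHj lact0r.
  have := sl2_e_iter n.+2 hv; rewrite (fz 2%N) lact0r (fz 1%N) scaler0 addr0.
  by move=> <-.
have hw m : (m <= n)%N -> (f ^^ (n - m)) v = 0.
  elim: m => [|m IHm] mn; first by rewrite subn0.
  have := sl2_e_iter (n - m)%N hv; rewrite IHm ?(ltnW mn) // lact0r Ev0 sl2_iter0.
  rewrite add0r => /esym/eqP; rewrite scaler_eq0 mulf_eq0 -subnS => /orP[|/eqP //].
  rewrite pnatr_eq0 subn_eq0 leqNgt mn /= natrB 1?ltnW // subKr natr1.
  by rewrite pnatr_eq0.
by have := hw n (leqnn n); rewrite subnn.
Qed.

(** The last nonzero f^j v satisfies 0 = e f^(j+1) v = (j+1) (c - j) f^j v. *)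
Lemma sl2_dominant c k v : v != 0 -> lact h v = c *: v -> E v = 0 ->
  (f ^^ k) v = 0 -> exists n : nat, c = n%:R.
Proof.
move=> v0 hv Ev; elim: k => [/eqP|k IHk fk]; first by rewrite (negbTE v0).
have := sl2_e_iter k.+1 hv; rewrite fk lact0r Ev sl2_iter0 add0r /= => /esym/eqP.
rewrite scaler_eq0 mulf_eq0 pnatr_eq0 /= => /orP[|/eqP /IHk //].
by rewrite -natr1 opprD addrA subrK subr_eq0 => /eqP ->; exists k.
Qed.

(** If e (f v) = 0 then f maps e^(j+1) v to a nonzero multiple of e^j v for all j,
so that no power of e can kill v. *)
Lemma sl2_ef_inj n k v : lact h v = n.+1%:R *: v -> E (lact f v) = 0 ->
  (e ^^ k) v = 0 -> v = 0.
Proof.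
move=> hv efv.
have fe j : lact f ((e ^^ j.+1) v) = - (j.+1%:R * (n.+1%:R + j%:R)) *: (e ^^ j) v.
  elim: j => [|j IHj].
    rewrite /= mul1r addr0 scaleNr; apply/eqP; rewrite -addr_eq0; apply/eqP.
    have := lact_br e f v; rewrite ef hv efv add0r => ->.
    by rewrite subrr.
  have wt : lact h ((e ^^ j.+1) v) = (n.+1%:R + j.+1%:R *+ 2) *: (e ^^ j.+1) v.
    elim: (j.+1) => [|m IHm]; first by rewrite mul0rn addr0.
    rewrite iterS lact_swap he IHm lactZr lactZl -scalerDl; congr (_ *: _).
    by rewrite -[m.+1%:R]natr1; ring.
  rewrite iterS lact_swap (lbrC f e) ef lactNl wt IHj lactZr -iterS -scaleNr.
  by rewrite -scalerDl; congr (_ *: _); rewrite -!natr1; ring.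
elim: k => // k IHk ek; apply: IHk.
have := fe k; rewrite ek lact0r => /esym/eqP.
rewrite scaler_eq0 oppr_eq0 mulf_eq0 pnatr_eq0 -natrD pnatr_eq0 addSn /=.
by move/eqP.
Qed.

End Sl2.

(** * Commuting operators and eigenvectors *)

Section Annihilators.
Variables (F : fieldType) (V : lmodType F) (I : eqType) (op : I -> V -> V).
Hypothesis op_lin : forall i, linear (op i).
Hypothesis op_comm : forall i j v, op i (op j v) = op j (op i v).

(** The product over (i, c) in s of the operators op i - c, applied to v. *)
Definition annih (s : seq (I * F)) (v : V) : V :=
  foldr (fun p w => op p.1 w - p.2 *: w) v s.

Lemma annih_cat s t v : annih (s ++ t) v = annih s (annih t v).
Proof. by rewrite /annih foldr_cat. Qed.

Let opD i u v : op i (u + v) = op i u + op i v.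
Proof. by have := op_lin i 1 u v; rewrite !scale1r. Qed.
Let op0 i : op i 0 = 0.
Proof. by apply: (addrI (op i 0)); rewrite -opD !addr0. Qed.
Let opZ i c v : op i (c *: v) = c *: op i v.
Proof. by have := op_lin i c v 0; rewrite !addr0 op0 addr0. Qed.

Lemma annihD s u v : annih s (u + v) = annih s u + annih s v.
Proof.
by elim: s => //= p s ->; rewrite opD scalerDr opprD addrACA.
Qed.

Lemma annihZ s c v : annih s (c *: v) = c *: annih s v.
Proof.
elim: s => //= p s ->; rewrite opZ scalerBr; congr (_ - _).
by rewrite !scalerA mulrC.
Qed.

Lemma annih0 s : annih s 0 = 0.
Proof. by have := annihZ s 0 0; rewrite !scale0r. Qed.

Lemma annih_comm (T : V -> V) s v : linear T ->
  (forall i w, T (op i w) = op i (T w)) -> T (annih s v) = annih s (T v).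
Proof.
move=> Tl Tc; elim: s => //= p s <-.
have := Tl (- p.2) (annih s v) (op p.1 (annih s v)).
by rewrite !scaleNr ![- _ + _]addrC Tc => ->.
Qed.

Lemma annih_op s i v : op i (annih s v) = annih s (op i v).
Proof. by apply: annih_comm. Qed.

Lemma annih_catC s t v : annih s (annih t v) = annih t (annih s v).
Proof.
elim: s => //= p s ->; apply/esym.
by rewrite -[in LHS]scaleNr annihD annihZ scaleNr -annih_op.
Qed.

Lemma annih_eigen s v (c : I -> F) : (forall p, p \in s -> op p.1 v = c p.1 *: v) ->
  annih s v = (\prod_(p <- s) (c p.1 - p.2)) *: v.
Proof.
elim: s => [|p s IHs] h; first by rewrite big_nil scale1r.
rewrite /= IHs => [|q qs]; last by rewrite h // inE qs orbT.
rewrite opZ h ?mem_head // !scalerA -scalerBl big_cons; congr (_ *: _).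
by rewrite mulrBl mulrC.
Qed.

(** A vector killed by the product of the op i - c over distinct scalars c is a sum
of eigenvectors of op i. The eigenvectors stay in any subspace that contains
the vector and is stable under op i; this is what allows several commuting
operators to be diagonalized in succession. *)
Lemma eigen_decomp i (X : submod V) (s : seq F) x :
  (forall v, X v -> X (op i v)) -> uniq s -> X x ->
  annih [seq (i, c) | c <- s] x = 0 ->
  lspan (fun y => X y /\ exists2 c, c \in s & op i y = c *: y) x.
Proof.
move=> Xi; elim: s x => [|c s IHs] x /= us Xx; first by move=> ->; exact: span_0.
rewrite annih_op -annihZ -[- annih _ _]scaleN1r -annihZ scaleN1r -annihD => sx0.
have {us} [cs us] := andP us.
have Xy : X (op i x - c *: x).
  by apply: submodD; [exact: Xi|rewrite -scaleNr; apply: submodZ].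
have := IHs _ us Xy sx0; set y := op i x - c *: x => ly.
have [z lz zy] : exists2 z,
    lspan (fun y => X y /\ exists2 c', c' \in s & op i y = c' *: y) z &
    op i z - c *: z = y.
  elim/lspan_ind: ly {sx0 Xy} => {y} [y [Xy [c' c's iy]]||u v [z1 l1 <-] [z2 l2 <-]|k u [z lz <-]].
  - exists ((c' - c)^-1 *: y); first by apply: span_Z; apply: span_in; split=> //; exists c'.
    rewrite opZ iy !scalerA -scalerBl [c * _]mulrC -mulrBr mulVf ?scale1r //.
    by rewrite subr_eq0; apply: contraNneq cs => <-.
  - by exists 0; [exact: span_0|rewrite op0 scaler0 subr0].
  - by exists (z1 + z2); [exact: span_D|rewrite opD scalerDr opprD addrACA].
  - exists (k *: z); first exact: span_Z.
    by rewrite opZ scalerBr !scalerA mulrC.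
have sub : forall v, lspan (fun y => X y /\ exists2 c', c' \in s & op i y = c' *: y) v ->
    lspan (fun y => X y /\ exists2 c', c' \in c :: s & op i y = c' *: y) v.
  move=> v; elim/lspan_ind => {v} [v [Xv [c' c's iv]]||u v lu lv|k v lv].
  - by apply: span_in; split=> //; exists c'; rewrite ?inE ?c's ?orbT.
  - exact: span_0.
  - exact: span_D.
  - exact: span_Z.
have Xz : X z.
  elim/lspan_ind: lz {zy} => [v []//||u v|k v]; [exact: submod0|exact: submodD|exact: submodZ].
rewrite -(subrK z x); apply: span_D; last exact: sub.
apply: span_in; split; first by apply: submodD => //; apply: submodN.
exists c; first exact: mem_head.
have opB : op i (x - z) = op i x - op i z by rewrite -scaleN1r opD opZ scaleN1r.
rewrite opB scalerBr; move/eqP: zy; rewrite subr_eq => /eqP ->.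
by rewrite /y opprD opprB addrA [op i x + _]addrC subrK.
Qed.

End Annihilators.

(** * The Cartan matrix *)

Lemma hval_eq0 (c : rlat) : (forall j, hval j c = 0) -> c = 0.
Proof.
move=> h; have := h n1; have := h n2; have := h n3; have := h n4; have := h n5.
have := h n6; rewrite !hvalE => {h} h6 h5 h4 h3 h2 h1.
have aux (a b d e f k : int) : 2 * a - b = 0 -> 2 * b - a - d = 0 ->
    2 * d - b - e - k = 0 -> 2 * e - d - f = 0 -> 2 * f - e = 0 -> 2 * k - d = 0 ->
    [/\ a = 0, b = 0, d = 0, e = 0 & f = 0 /\ k = 0] by move=> *; do 5?split; lia.
have [a1 a2 a3 a4 [a5 a6]] := aux _ _ _ _ _ _ h1 h2 h3 h4 h5 h6.
by apply/ffunP; elim/forall6; rewrite [RHS]ffunE.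
Qed.

(** Three times the inverse of the Cartan matrix of E6. *)
Definition e6_inv (i j : 'I_6) : nat :=
  nth 0 (nth [::] [:: [:: 4; 5; 6; 4; 2; 3]; [:: 5; 10; 12; 8; 4; 6];
    [:: 6; 12; 18; 12; 6; 9]; [:: 4; 8; 12; 10; 5; 6]; [:: 2; 4; 6; 5; 4; 3];
    [:: 3; 6; 9; 6; 3; 6]] i) j.

Lemma e6_invP (F : numFieldType) (a : 'I_6 -> F) j :
  \sum_i (e6_cartan j i)%:~R * (\sum_k (e6_inv i k)%:R * a k / 3) = a j.
Proof.
rewrite !sum6 /e6_inv /= -[X in _ = a X]/j.
by elim/forall6: j; rewrite /e6_cartan /e6_adj /=; field.
Qed.

Lemma e6_cartanC i j : e6_cartan i j = e6_cartan j i.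
Proof. by rewrite /e6_cartan /e6_adj eq_sym orbC. Qed.

(** * Root space decomposition *)

Section Structure.
Variables (F : numFieldType) (g : fdLieAlgType F) (D : e6Data g).
Local Notation h := (e6_h D).
Local Notation al := (e6_alpha D).
Local Notation H := (hco D).
Implicit Types (x y z : g).

Definition root_comb (c : rlat) : dual h := \sum_i al i *~ c i.

Lemma root_comb_is_additive : zmod_morphism root_comb.
Proof.
by move=> a b; rewrite /root_comb -sumrB; apply: eq_bigr => i _; rewrite !ffunE mulrzBr.
Qed.
HB.instance Definition _ := GRing.isZmodMorphism.Build _ _ root_comb root_comb_is_additive.

Lemma root_combN c : root_comb (- c) = - root_comb c. Proof. exact: raddfN. Qed.

Lemma root_comb_simple i : root_comb (simple i) = al i.
Proof.
rewrite /root_comb (bigD1 i) //= ffunE eqxx mulr1z big1 ?addr0 // => j /negbTE ji.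
by rewrite ffunE ji mulr0z.
Qed.

Lemma mulrz_lfun (U W : vectType F) (f : 'Hom(U, W)) n v : (f *~ n) v = f v *~ n.
Proof. by rewrite -!scaler_int scale_lfunE. Qed.

Lemma root_comb_coroot c j : root_comb c (e6_coroot D j) = (hval j c)%:~R.
Proof.
rewrite /root_comb sum_lfunE /hval raddf_sum /=; apply: eq_bigr => i _.
by rewrite mulrz_lfun e6_cartan_matrix -mulrzr -intrM.
Qed.

(** The simple roots span the dual of the Cartan subalgebra. *)
Lemma dual_eq0 (t : subvs_of h) : (forall i, al i t = 0) -> t = 0.
Proof.
move=> alt; have [_ bas _] := e6_is_base D.
have all0 (phi : dual h) : phi t = 0.
  have := @coord_basis _ _ _ _ (in_tuple [seq al i | i : 'I_6]) _ bas (memvf phi).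
  move=> ->; rewrite sum_lfunE big1 // => i _; rewrite scale_lfunE.
  have /mapP[j _ ->] : [seq al i | i : 'I_6]`_i \in [seq al i | i : 'I_6].
    exact: mem_nth.
  by rewrite alt scaler0.
rewrite (coord_vbasis (memvf t)) big1 // => i _.
have := all0 (linfun (coord (vbasis fullv) i : subvs_of h -> F^o)).
by rewrite lfunE /= => ->; rewrite scale0r.
Qed.

(** The coefficients are obtained from the values of the simple roots through the
inverse Cartan matrix. *)
Lemma coroot_span x : x \in h -> exists a : 'I_6 -> F, x = \sum_i a i *: H i.
Proof.
move=> xh; pose t := vsproj h x; have xt : x = vsval t by rewrite vsprojK.
pose a i : F := \sum_k (e6_inv i k)%:R * al k t / 3.
exists a; suff tE : t = \sum_i a i *: e6_coroot D i.
  by rewrite xt tE raddf_sum.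
apply/eqP; rewrite -subr_eq0; apply/eqP/dual_eq0 => j.
rewrite linearB /= linear_sum /=; apply/eqP; rewrite subr_eq0; apply/eqP.
rewrite -[LHS](e6_invP (fun k => al k t : F)); apply: eq_bigr => i _.
by rewrite linearZ /= e6_cartan_matrix e6_cartanC [RHS]mulrC.
Qed.

Lemma h_comm x y : x \in h -> y \in h -> lbr x y = 0.
Proof. by case: (e6_is_cartan D) => h0 _ _; apply: h0. Qed.

Lemma coroot_h i : H i \in h. Proof. exact: subvsP. Qed.

(** The root space of the lattice vector c, or the Cartan subalgebra for c = 0; it is
tested on the simple coroots, which span the Cartan subalgebra. *)
Definition ad_wt (c : rlat) (x : g) := forall j, lbr (H j) x = (hval j c)%:~R *: x.

Lemma ad_wt_root c x : root_space (root_comb c) x <-> ad_wt c x.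
Proof.
split=> rx; first by move=> j; rewrite rx root_comb_coroot.
move=> t; have [a ta] := coroot_span (subvsP t).
have -> : root_comb c t = \sum_j a j * (hval j c)%:~R :> F.
  have -> : t = \sum_j a j *: e6_coroot D j.
    by apply: val_inj; rewrite /= ta raddf_sum.
  rewrite linear_sum; apply: eq_bigr => j _.
  by rewrite linearZ /= root_comb_coroot.
rewrite ta lbr_suml scaler_suml; apply: eq_bigr => j _.
by rewrite lbrZl rx scalerA.
Qed.

Lemma root_comb_eq0 c : root_comb c = 0 -> c = 0.
Proof.
move=> c0; apply: hval_eq0 => j; apply/eqP.
by rewrite -(intr_eq0 F) -root_comb_coroot c0 lfunE.
Qed.

Lemma ad_wt_0 c : ad_wt c 0.
Proof. by move=> j; rewrite lbr0r scaler0. Qed.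
Lemma ad_wt_br c d x y : ad_wt c x -> ad_wt d y -> ad_wt (c + d) (lbr x y).
Proof.
move=> rx ry j; have := lact_swap (V := adjoint g) (H j) x y; rewrite /= => ->.
by rewrite rx ry lbrZr lbrZl -scalerDl hvalD intrD [X in X *: _]addrC.
Qed.
Lemma ad_wt0_h x : ad_wt 0 x -> x \in h.
Proof.
move=> rx; case: (e6_is_cartan D) => _ hh _; apply: hh => y yh.
have [a ->] := coroot_span yh; rewrite lbr_suml big1 // => i _.
by rewrite lbrZl rx hval0 scale0r scaler0.
Qed.
Lemma h_ad_wt0 x : x \in h -> ad_wt 0 x.
Proof. by move=> xh j; rewrite h_comm ?coroot_h // hval0 scale0r. Qed.

Lemma ad_coroot_annih i : exists2 s : seq F, uniq s &
  forall x, annih (fun _ : unit => lbr (H i)) [seq (tt, c) | c <- s] x = 0.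
Proof.
case: (e6_is_cartan D) => _ _ /(_ _ (coroot_h i))[b [bas hb]].
have lin (u : unit) : linear (lbr (H i)) by exact: lbr_linr.
have ev (y : g) : exists c : F, y \in b -> lbr (H i) y = c *: y.
  by have [/hb[c yc]|_] := boolP (y \in b); [exists c|exists 0].
have [c hc] := choice ev.
exists (undup (map c b)); first exact: undup_uniq.
move=> x; have /coord_span -> : x \in <<in_tuple b>>%VS.
  by rewrite (span_basis bas) memvf.
elim/big_rec: _ => [|k y _ IHy]; first exact: annih0.
rewrite annihD // IHy addr0 annihZ //.
have bk : b`_k \in b by exact: mem_nth.
rewrite (@annih_eigen _ _ _ _ lin _ _ (fun=> c b`_k)) => [|p _]; last exact: hc.
rewrite (_ : \prod_(p <- _) _ = 0) ?scale0r ?scaler0 //.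
apply/eqP; rewrite prodf_seq_eq0; apply/hasP; exists (tt, c b`_k); last first.
  by rewrite /= subrr.
by apply: map_f; rewrite mem_undup map_f.
Qed.

(** The vectors (ad z)^k y would be eigenvectors of ad h_i for infinitely many
eigenvalues. *)
Lemma ad_nilp i (z y : g) (a b : F) : lbr (H i) z = a *: z -> a != 0 ->
  lbr (H i) y = b *: y -> exists k, iter k (lbr z) y = 0.
Proof.
move=> Hz a0 Hy; have [s us sx] := ad_coroot_annih i.
have lin (u : unit) : linear (lbr (H i)) by exact: lbr_linr.
apply: contrapT => /forallNP nz.
pose c (k : nat) : F := b + a *+ k.
have wt k : lbr (H i) (iter k (lbr z) y) = c k *: iter k (lbr z) y.
  elim: k => [|k IHk]; first by rewrite Hy /c mulr0n addr0.
  have := lact_swap (V := adjoint g) (H i) z (iter k (lbr z) y).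
  rewrite /= => ->; rewrite IHk Hz lbrZr lbrZl -scalerDl; congr (_ *: _).
  by rewrite /c mulrSr addrA.
have cs k : c k \in s.
  have := sx (iter k (lbr z) y).
  rewrite (@annih_eigen _ _ _ _ lin _ _ (fun=> c k)) => [|p _]; last exact: wt.
  move/eqP; rewrite scaler_eq0 => /orP[|/eqP/nz //].
  by rewrite prodf_seq_eq0 has_map => /hasP[d ds /=]; rewrite subr_eq0 => /eqP ->.
have inj : injective c.
  move=> k l /addrI /eqP; rewrite -[a *+ k]mulr_natr -[a *+ l]mulr_natr.
  by move=> /eqP /(mulfI a0) /eqP; rewrite eqr_nat => /eqP.
have := @uniq_leq_size _ (map c (iota 0 (size s).+1)) s.
rewrite map_inj_uniq // iota_uniq size_map size_iota ltnn => h'.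
by suff: false by []; apply: h' => // _ /mapP[k _ ->].
Qed.

(** Simultaneous diagonalization of the ad h_j, one coroot at a time. *)
Lemma joint_eigen (l : seq 'I_6) x :
  lspan (fun y : g => exists a : 'I_6 -> F,
    forall j, j \in l -> lbr (H j) y = a j *: y) x.
Proof.
elim: l => [|j l IHl].
  by apply: span_in; exists (fun=> 0).
elim/lspan_ind: IHl => {x} [y [a ya]||u v|c v]; last 3 first.
- exact: span_0.
- exact: span_D.
- exact: span_Z.
have [s us sx] := ad_coroot_annih j.
pose P (z : g) := forall i, i \in l -> lbr (H i) z = a i *: z.
have P0 : P 0 by move=> i _; rewrite lbr0r scaler0.
have PD u v : P u -> P v -> P (u + v).
  by move=> pu pv i il; rewrite lbrDr pu // pv // scalerDr.
have PZ c v : P v -> P (c *: v).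
  by move=> pv i il; rewrite lbrZr pv // !scalerA mulrC.
have Hj (z : g) : P z -> P (lbr (H j) z).
  move=> Pz i il; have := lact_swap (V := adjoint g) (H i) (H j) z.
  by rewrite /= => ->; rewrite Pz // (h_comm (coroot_h i) (coroot_h j)) lbr0l addr0 lbrZr.
have := @eigen_decomp _ _ _ (fun _ : unit => lbr (H j)) (fun _ => @lbr_linr _ _ _)
  (fun _ _ _ => erefl) tt (Submod P0 PD PZ) s y (fun z => @Hj z) us ya (sx y).
elim/lspan_ind => {y ya} [y [Py [c _ yc]]||u v|k v]; last 3 first.
- exact: span_0.
- exact: span_D.
- exact: span_Z.
apply: span_in; exists (fun i => if i == j then c else a i) => i; rewrite inE.
by case: eqP => [->|_] //= il; apply: Py.
Qed.

Definition rootv (c : rlat) (x : g) := [/\ c != 0, x != 0 & ad_wt c x].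
Definition isroot (c : rlat) := exists x, rootv c x.

Lemma isroot_is_root c : isroot c -> is_root (root_comb c).
Proof.
case=> x [c0 x0 /ad_wt_root rx]; split; last by exists x.
by apply: contra c0 => /eqP/root_comb_eq0 ->.
Qed.

(** A joint eigenvector spans a root space, to which the base property applies, or
commutes with the Cartan subalgebra, which is self-centralizing. *)
Lemma weight_root (a : 'I_6 -> F) x : x != 0 ->
  (forall j, lbr (H j) x = a j *: x) ->
  x \in h \/ exists c : 'I_6 -> nat,
    let c' : rlat := [ffun i => (c i)%:Z] in ad_wt c' x \/ ad_wt (- c') x.
Proof.
move=> x0 xa; pose phi : dual h := \sum_i (\sum_k (e6_inv i k)%:R * a k / 3) *: al i.
have phiE j : phi (e6_coroot D j) = a j.
  rewrite sum_lfunE -[RHS]e6_invP; apply: eq_bigr => i _.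
  by rewrite scale_lfunE e6_cartan_matrix [LHS]mulrC.
have rphi : root_space phi x.
  move=> t; have [b h_rep] := coroot_span (subvsP t).
  have -> : t = \sum_j b j *: e6_coroot D j.
    by apply: val_inj; rewrite /= h_rep raddf_sum.
  rewrite [phi _]linear_sum scaler_suml raddf_sum lbr_suml; apply: eq_bigr => j _.
  by rewrite linearZ /= phiE lbrZl xa scalerA.
have [phi0|phi0] := eqVneq phi 0.
  left; apply: ad_wt0_h => j; have := rphi (e6_coroot D j).
  by rewrite phi0 hval0 lfunE.
right; have [_ _ /(_ phi)] := e6_is_base D; case; first by split=> //; exists x.
  case=> c phiE'; exists c; left; apply/ad_wt_root.
  by rewrite /root_comb (eq_bigr (fun i => al i *+ c i)) -?phiE' // => i _; rewrite ffunE.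
case=> c phiE'; exists c; right; apply/ad_wt_root; rewrite root_combN.
rewrite /root_comb (eq_bigr (fun i => al i *+ c i)) -?phiE' ?opprK // => i _.
by rewrite ffunE.
Qed.

Lemma ad_wt_uniq c d x : x != 0 -> ad_wt c x -> ad_wt d x -> c = d.
Proof.
move=> x0 rc rd; apply/eqP; rewrite -subr_eq0; apply/eqP/hval_eq0 => j.
have := rc j; rewrite rd => /eqP; rewrite -subr_eq0 -scalerBl scaler_eq0 (negbTE x0).
by rewrite orbF subr_eq0 eqr_int hvalB => /eqP ->; rewrite subrr.
Qed.

Lemma isroot_sign c : isroot c -> nneg c \/ nneg (- c).
Proof.
case=> x [c0 x0 rx].
have [xh|[d []]] := weight_root x0 rx.
- by rewrite (ad_wt_uniq x0 rx (h_ad_wt0 xh)) eqxx in c0.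
- by move/(ad_wt_uniq x0 rx) => ->; left => i; rewrite ffunE.
- by move/(ad_wt_uniq x0 rx) => ->; right => i; rewrite opprK ffunE.
Qed.

Definition root_vec (c : rlat) : g := e6_root_vec D (root_comb c).

Lemma root_vecP c : isroot c ->
  [/\ root_vec c != 0, ad_wt c (root_vec c) &
    forall x, ad_wt c x -> exists k, x = k *: root_vec c].
Proof.
move=> /isroot_is_root/e6_root_vecP[x0 rx h1]; split=> //; first exact/ad_wt_root.
by move=> x /ad_wt_root/h1.
Qed.

Lemma coroot_neq0 i : H i != 0.
Proof.
apply/eqP => H0; have := e6_cartan_matrix D i i.
rewrite (_ : e6_coroot D i = 0); last exact: val_inj.
by rewrite linear0 /e6_cartan eqxx => /esym/eqP; rewrite intr_eq0.
Qed.

Lemma sl2_triple i : exists x y : g,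
  [/\ ad_wt (simple i) x, ad_wt (- simple i) y & lbr x y = H i].
Proof.
have [_ [x [y [rx ry xy]]]] := e6_is_coroot D i.
exists x, y; split=> //; apply/ad_wt_root; first by rewrite root_comb_simple.
by rewrite root_combN root_comb_simple.
Qed.

Definition chev_e i : g := projT1 (cid (sl2_triple i)).
Definition chev_f i : g := projT1 (cid (projT2 (cid (sl2_triple i)))).

Lemma chevP i : [/\ ad_wt (simple i) (chev_e i), ad_wt (- simple i) (chev_f i) &
  lbr (chev_e i) (chev_f i) = H i].
Proof. exact: projT2 (cid (projT2 (cid (sl2_triple i)))). Qed.

Lemma lbr_h_e i : lbr (H i) (chev_e i) = 2 *: chev_e i.
Proof. by have [-> _ _] := chevP i; rewrite hval_simple /e6_cartan eqxx. Qed.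
Lemma lbr_h_f i : lbr (H i) (chev_f i) = -2 *: chev_f i.
Proof. by have [_ -> _] := chevP i; rewrite hvalN hval_simple /e6_cartan eqxx. Qed.
Lemma lbr_e_f i : lbr (chev_e i) (chev_f i) = H i.
Proof. by have [] := chevP i. Qed.
Lemma lbr_f_e i : lbr (chev_f i) (chev_e i) = - H i.
Proof. by rewrite lbrC lbr_e_f. Qed.
Lemma lbr_nh_f i : lbr (- H i) (chev_f i) = 2 *: chev_f i.
Proof. by rewrite -scaleN1r lbrZl lbr_h_f scaleN1r scaleNr opprK. Qed.
Lemma lbr_nh_e i : lbr (- H i) (chev_e i) = -2 *: chev_e i.
Proof. by rewrite -scaleN1r lbrZl lbr_h_e scaleN1r scaleNr. Qed.

Lemma ad_wt_iterF i c x k : ad_wt c x -> ad_wt (c - simple i *+ k) (iter k (lbr (chev_f i)) x).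
Proof.
move=> rx; elim: k => [|k IHk]; first by rewrite mulr0n subr0.
rewrite mulrSr opprD addrA addrC iterS; apply: ad_wt_br => //.
by have [] := chevP i.
Qed.

Lemma ad_wt_iterE i c x k : ad_wt c x -> ad_wt (c + simple i *+ k) (iter k (lbr (chev_e i)) x).
Proof.
move=> rx; elim: k => [|k IHk]; first by rewrite mulr0n addr0.
rewrite mulrSr addrA addrC iterS; apply: ad_wt_br => //.
by have [] := chevP i.
Qed.

Lemma nilpE i c x : ad_wt c x -> exists k, iter k (lbr (chev_e i)) x = 0.
Proof. by move=> rx; apply: ad_nilp (lbr_h_e i) _ (rx i); rewrite pnatr_eq0. Qed.
Lemma nilpF i c x : ad_wt c x -> exists k, iter k (lbr (chev_f i)) x = 0.
Proof. by move=> rx; apply: ad_nilp (lbr_h_f i) _ (rx i); rewrite oppr_eq0 pnatr_eq0. Qed.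

Lemma iterF_neq0 i c x (n : nat) : ad_wt c x -> x != 0 -> hval i c = n ->
  iter n (lbr (chev_f i)) x != 0.
Proof.
move=> rx x0 hn; apply: contra x0 => /eqP fx; have [k ek] := nilpE i rx.
apply/eqP; apply: (sl2_iter_inj (V := adjoint g) (lbr_e_f i) (lbr_h_e i) (lbr_h_f i) _ ek fx).
by rewrite /= rx hn.
Qed.

Lemma iterE_neq0 i c x (n : nat) : ad_wt c x -> x != 0 -> hval i c = - n%:Z ->
  iter n (lbr (chev_e i)) x != 0.
Proof.
move=> rx x0 hn; apply: contra x0 => /eqP fx; have [k ek] := nilpF i rx.
apply/eqP; apply: (sl2_iter_inj (V := adjoint g) (lbr_f_e i) (lbr_nh_f i) (lbr_nh_e i) _ ek fx).
by rewrite /= lbrNl rx hn mulrNz scaleNr opprK.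
Qed.

(** The reflected root space is reached by applying a power of f_i or e_i. *)
Lemma isroot_refl i c : isroot c -> isroot (refl i c).
Proof.
case=> x [c0 x0 rx].
have rc0 : refl i c != 0.
  apply: contra c0 => /eqP rc0; rewrite -(reflK i c) rc0 /refl hval0 mulr0z subr0.
  exact: eqxx.
have [[n hn]|[n hn]] : (exists n : nat, hval i c = n) \/
    (exists n : nat, hval i c = - n%:Z).
  by case: (hval i c) => n; [left; exists n|right; exists n.+1; rewrite NegzE].
- exists (iter n (lbr (chev_f i)) x); split=> //; first exact: iterF_neq0 hn.
  by rewrite /refl hn -pmulrn; apply: ad_wt_iterF.
- exists (iter n (lbr (chev_e i)) x); split=> //; first exact: iterE_neq0 hn.
  by rewrite /refl hn mulrNz opprK -pmulrn; apply: ad_wt_iterE.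
Qed.

Lemma simple_neq0 i : simple i != 0.
Proof. exact/roots_neq0/simple_in_roots. Qed.

Lemma isroot_simple i : isroot (simple i).
Proof.
exists (chev_e i); split; first exact: simple_neq0; last by have [] := chevP i.
apply: contra (coroot_neq0 i) => /eqP E0; have [_ _ <-] := chevP i.
by rewrite E0 lbr0l.
Qed.

(** If (k+2) alpha_i is a root with root vector x, then y = f_i^k x is a nonzero
vector of the root space of 2 alpha_i, and f_i y is proportional to e_i because
the root space of alpha_i is one-dimensional. So e_i (f_i y) = 0, contrary to
sl2_ef_inj. *)
Lemma isroot_mult i k : isroot (simple i *+ k.+1) -> k = 0%N.
Proof.
case: k => // k [x [_ x0 rx]]; exfalso.
have hn : hval i (simple i *+ k.+2) = (k.+2.*2)%N.
  by rewrite pmulrn hvalMz hval_simple /e6_cartan eqxx; lia.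
have nz := iterF_neq0 rx x0 hn.
pose y := iter k (lbr (chev_f i)) x.
have ry : ad_wt (simple i *+ 2) y.
  have := ad_wt_iterF i k rx; congr (ad_wt _ _).
  by rewrite -mulrnBr ?leqW //; congr (_ *+ _); lia.
have y0 : y != 0.
  apply: contra nz => /eqP y0; rewrite (_ : k.+2.*2 = (k.+2.*2 - k) + k)%N; last by lia.
  by rewrite iterD -/y y0 (sl2_iter0 (adjoint g)).
have rFy : ad_wt (simple i) (lbr (chev_f i) y).
  by have := ad_wt_iterF i 1 ry; rewrite mulr1n mulr2n addrK.
have [_ _ one] := root_vecP (isroot_simple i).
have [s sE] := one _ rFy; have [t tE] := one _ (let: And3 rE _ _ := chevP i in rE).
have EFy : lbr (chev_e i) (lbr (chev_f i) y) = 0.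
  by rewrite sE tE lbrZl lbrZr lbrxx !scaler0.
have [m em] := nilpE i ry.
(* The vector y has weight 4 for h_i. *)
move/eqP: y0; apply.
apply: (sl2_ef_inj (V := adjoint g) (lbr_e_f i) (lbr_h_e i) (n := 3) _ EFy em).
by rewrite /= ry pmulrn hvalMz hval_simple /e6_cartan eqxx.
Qed.

Lemma isroot_neq0 c : isroot c -> c != 0.
Proof. by case=> x []. Qed.

Lemma isrootP c : isroot c <-> c \in e6_roots \/ - c \in e6_roots.
Proof.
pose opp (c : rlat) := isroot (- c).
have refl_opp i d : refl i (- d) = - refl i d.
  by rewrite /refl hvalN mulrNz opprB opprK addrC.
have o1 d : opp d -> d != 0 by move/isroot_neq0; rewrite oppr_eq0.
have o2 d : opp d -> nneg d \/ nneg (- d).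
  by move/isroot_sign; rewrite opprK => -[]; [right|left].
have o3 i d : opp d -> opp (refl i d).
  by rewrite /opp -refl_opp; apply: isroot_refl.
have reflS i : refl i (simple i) = - simple i.
  by apply/ffunP => j; rewrite reflE hval_simple /e6_cartan eqxx !ffunE; case: (j == i).
have o4 i k : opp (simple i *+ k.+1) -> k = 0%N.
  move=> /(isroot_refl i); rewrite refl_opp => r; apply: (@isroot_mult i).
  move: r; congr isroot.
  apply/ffunP => j; rewrite ffunE reflE pmulrn hvalMz hval_simple simpleZ.
  by rewrite /e6_cartan eqxx; case: (j == i); lia.
have o5 i : opp (simple i) by rewrite /opp -reflS; apply/isroot_refl/isroot_simple.
split=> [rc|[cr|cr]].
- have [c0|c0] := isroot_sign rc; [left|right].
    exact: (isroot_roots isroot_neq0 isroot_sign isroot_refl isroot_mult rc c0).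
  by apply: (isroot_roots o1 o2 o3 o4 _ c0); rewrite /opp opprK.
- exact: (roots_isroot isroot_refl isroot_simple cr).
- by have := roots_isroot o3 o5 cr; rewrite /opp opprK.
Qed.

End Structure.

(** * Killing form and Casimir operator *)

Section Trace.
Variables (F : fieldType) (V : vectType F) (n : nat) (b : n.-tuple V).
Hypothesis bas : basis_of fullv b.
Local Notation co := (coord b).

(** The trace, computed in the basis b. *)
Definition btr (f : V -> V) : F := \sum_i co i (f b`_i).

Lemma basis_expand v : v = \sum_i co i v *: b`_i.
Proof. exact: (coord_basis bas (memvf v)). Qed.

Lemma btr_comm (f k : V -> V) : linear f -> linear k ->
  btr (f \o k) = btr (k \o f).
Proof.
move=> lf lk.
have exp (f' k' : V -> V) : linear f' -> btr (f' \o k') =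
    \sum_(i < n) \sum_(j < n) co j (k' b`_i) * co i (f' b`_j).
  move=> lf'; pose fl := HB.pack_for {linear V -> V} f' (GRing.isLinear.Build _ _ _ _ f' lf').
  apply: eq_bigr => i _; rewrite /= {1}[k' _]basis_expand.
  rewrite -[f']/(fl : V -> V) linear_sum linear_sum; apply: eq_bigr => j _.
  by rewrite linearZ linearZ.
rewrite !exp // exchange_big; apply: eq_bigr => i _; apply: eq_bigr => j _.
by rewrite mulrC.
Qed.

Lemma btrB (f k : V -> V) : btr (fun v => f v - k v) = btr f - btr k.
Proof. by rewrite /btr -sumrB; apply: eq_bigr => i _; rewrite linearB. Qed.

Lemma btr_lin c (f k : V -> V) : btr (fun v => c *: f v + k v) = c * btr f + btr k.
Proof.
rewrite /btr mulr_sumr -big_split; apply: eq_bigr => i _.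
by rewrite linearD linearZ.
Qed.

Lemma eq_btr (f k : V -> V) : f =1 k -> btr f = btr k.
Proof. by move=> fk; apply: eq_bigr => i _; rewrite fk. Qed.

Lemma btr_eigen (f : V -> V) (c : 'I_n -> F) :
  (forall i : 'I_n, f b`_i = c i *: b`_i) -> btr f = \sum_i c i.
Proof.
move=> fc; apply: eq_bigr => i _; rewrite fc linearZ /= coord_free ?eqxx ?mulr1 //.
exact: basis_free bas.
Qed.

End Trace.

Section Killing.
Variables (F : fieldType) (L : fdLieAlgType F) (n : nat) (b : n.-tuple L).
Hypothesis bas : basis_of fullv b.
Implicit Types x y z : L.

Definition killing x y : F := btr b (fun z => lbr x (lbr y z)).
Local Notation K := killing.

Lemma killing_linl y c x x' : K (c *: x + x') y = c * K x y + K x' y.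
Proof. by rewrite /K -btr_lin; apply: eq_btr => z; rewrite lbr_linl. Qed.

Lemma killingC x y : K x y = K y x.
Proof.
have := @btr_comm _ _ _ _ bas (lbr x) (lbr y) (lbr_linr x) (lbr_linr y).
by [].
Qed.

Lemma killingDl x x' y : K (x + x') y = K x y + K x' y.
Proof. by have := killing_linl y 1 x x'; rewrite scale1r mul1r. Qed.
Lemma killing0l y : K 0 y = 0.
Proof. by apply: (addrI (K 0 y)); rewrite -killingDl !addr0. Qed.
Lemma killingZl c x y : K (c *: x) y = c * K x y.
Proof. by have := killing_linl y c x 0; rewrite !addr0 killing0l addr0. Qed.
Lemma killingZr c x y : K x (c *: y) = c * K x y.
Proof. by rewrite !(killingC x) killingZl. Qed.
Lemma killing_suml I (r : seq I) (P : pred I) (f : I -> L) y :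
  K (\sum_(i <- r | P i) f i) y = \sum_(i <- r | P i) K (f i) y.
Proof.
by apply: (big_morph (fun x => K x y)) => [u v|]; rewrite ?killingDl ?killing0l.
Qed.
Lemma killing_sumr I (r : seq I) (P : pred I) (f : I -> L) y :
  K y (\sum_(i <- r | P i) f i) = \sum_(i <- r | P i) K y (f i).
Proof. by rewrite killingC killing_suml; apply: eq_bigr => i _; rewrite killingC. Qed.
Lemma killingNl x y : K (- x) y = - K x y.
Proof. by rewrite -scaleN1r killingZl mulN1r. Qed.

Lemma killing_inv x y z : K (lbr x y) z = K x (lbr y z).
Proof.
have -> : K (lbr x y) z =
    btr b (fun v => lbr x (lbr y (lbr z v))) - btr b (fun v => lbr y (lbr x (lbr z v))).
  by rewrite -btrB; apply: eq_btr => v; rewrite ad_br.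
have -> : K x (lbr y z) =
    btr b (fun v => lbr x (lbr y (lbr z v))) - btr b (fun v => lbr x (lbr z (lbr y v))).
  rewrite -btrB; apply: eq_btr => v; rewrite ad_br lbrDr.
  by rewrite -[- lbr z _]scaleN1r lbrZr scaleN1r.
congr (_ - _).
have lin : linear (fun v => lbr x (lbr z v)) by move=> c u v; rewrite !lbr_linr.
exact: (btr_comm bas (lbr_linr y) lin).
Qed.

Hypothesis nondeg : forall x, (forall y, K x y = 0) -> x = 0.

(** The Gram matrix of a basis is invertible. *)
Lemma killing_dual : exists b' : 'I_n -> L, forall i j : 'I_n, K b`_i (b' j) = (i == j)%:R.
Proof.
pose G : 'M[F]_n := \matrix_(i, j) K b`_i b`_j.
have Gu : G \in unitmx.
  rewrite unitmxE unitfE; apply/det0P => -[v v0 vG].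
  have x0 : \sum_i v 0 i *: b`_i = 0.
    apply: nondeg => y; rewrite [y](basis_expand bas) killing_sumr big1 // => j _.
    rewrite killingZr killing_suml.
    have := congr1 (fun M : 'rV_n => M 0 j) vG; rewrite !mxE => vGj.
    rewrite (eq_bigr (fun i => v 0 i * G i j)) => [|i _].
      by rewrite vGj mulr0.
    by rewrite killingZl mxE.
  have v0' := elimT freeP (basis_free bas) _ x0.
  by case/eqP: v0; apply/rowP => i; rewrite v0' mxE.
exists (fun j => \sum_k invmx G k j *: b`_k) => i j.
rewrite killing_sumr -[RHS](_ : (G *m invmx G) i j = _); last by rewrite mulmxV // mxE.
by rewrite mxE; apply: eq_bigr => k _; rewrite killingZr mxE mulrC.
Qed.

Definition dbas : 'I_n -> L := projT1 (cid killing_dual).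

Lemma dbasP (i j : 'I_n) : K b`_i (dbas j) = (i == j)%:R.
Proof. by rewrite /dbas; case: cid => b' /= ->. Qed.

Lemma expand_bas x : x = \sum_i K x (dbas i) *: b`_i.
Proof.
rewrite {1}[x](basis_expand bas); apply: eq_bigr => i _; congr (_ *: _).
rewrite [in RHS](basis_expand bas x) killing_suml (bigD1 i) //= killingZl dbasP eqxx.
by rewrite mulr1 big1 ?addr0 // => j /negbTE ji; rewrite killingZl dbasP ji mulr0.
Qed.

Lemma killing_eq x y : (forall i : 'I_n, K x b`_i = K y b`_i) -> x = y.
Proof.
move=> xy; apply/eqP; rewrite -subr_eq0; apply/eqP; apply: nondeg => z.
rewrite [z](basis_expand bas) killing_sumr big1 // => i _.
by rewrite killingZr killingDl killingNl xy subrr mulr0.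
Qed.

Lemma expand_dbas x : x = \sum_(i < n) K x b`_i *: dbas i.
Proof.
apply: killing_eq => j; rewrite killing_suml (bigD1 j) //= killingZl.
rewrite (killingC (dbas j)) dbasP eqxx mulr1 big1 ?addr0 // => i ij.
by rewrite killingZl (killingC (dbas i)) dbasP eq_sym (negbTE ij) mulr0.
Qed.

Variable W : lieMod L.

Definition casimir (w : W) : W := \sum_(i < n) lact b`_i (lact (dbas i) w).

Lemma casimir_lin : linear casimir.
Proof.
move=> c u v; rewrite /casimir scaler_sumr -big_split; apply: eq_bigr => i _.
by rewrite !lact_linr.
Qed.

(** Expanding [x, b_i] in the basis and [x, b'_i] in the dual basis, invariance of the
form makes the two resulting double sums cancel. *)
Lemma casimir_comm x w : lact x (casimir w) = casimir (lact x w).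
Proof.
apply/eqP; rewrite -subr_eq0 /casimir lact_sumr -sumrB.
rewrite (eq_bigr (fun i : 'I_n => lact (lbr x b`_i) (lact (dbas i) w) +
  lact b`_i (lact (lbr x (dbas i)) w))) => [|i _]; last first.
  rewrite lact_swap (lact_swap x (dbas i)) lactDr addrAC addrC.
  by rewrite [X in X - _]addrC addrK addrC.
rewrite big_split /=.
rewrite (eq_bigr (fun i : 'I_n => \sum_(k < n) K (lbr x b`_i) (dbas k) *:
  lact b`_k (lact (dbas i) w)))
  => [|i _]; last first.
  by rewrite {1}[lbr x _]expand_bas lact_suml; apply: eq_bigr => k _; rewrite lactZl.
rewrite [X in _ + X](eq_bigr (fun i : 'I_n => \sum_(k < n) K (lbr x (dbas i)) b`_k *:
  lact b`_i (lact (dbas k) w))) => [|i _]; last first.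
  rewrite {1}[lbr x _]expand_dbas lact_suml lact_sumr.
  by apply: eq_bigr => k _; rewrite lactZl lactZr.
rewrite exchange_big -big_split big1 // => k _ /=; rewrite -big_split big1 // => i _ /=.
rewrite -scalerDl [X in X + _](_ : _ = - K (lbr x (dbas k)) b`_i) ?addNr ?scale0r //.
by rewrite lbrC killingNl killing_inv killingC.
Qed.

End Killing.

(** * Weight vectors, and a basis of g *)

Section WeightModules.
Variables (F : numFieldType) (g : fdLieAlgType F) (D : e6Data g).
Local Notation h := (e6_h D).
Local Notation al := (e6_alpha D).
Local Notation H := (hco D).
Local Notation root_vec := (root_vec D).
Local Notation root_comb := (root_comb D).
Implicit Types (x y z : g).

Lemma dual_with_values (a : 'I_6 -> F) :
  exists phi : dual h, forall j, phi (e6_coroot D j) = a j.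
Proof.
exists (\sum_i (\sum_k (e6_inv i k)%:R * a k / 3) *: al i) => j.
rewrite sum_lfunE -[RHS]e6_invP; apply: eq_bigr => i _.
by rewrite scale_lfunE e6_cartan_matrix [LHS]mulrC.
Qed.

Section Weights.
Variable W : lieMod g.
Implicit Types (m w : W) (kap : 'I_6 -> int).

(** Weight vectors, the weight being given by its values on the simple coroots. *)
Definition wtv kap m := forall j, lact (H j) m = (kap j)%:~R *: m.

Lemma wtvD kap m w : wtv kap m -> wtv kap w -> wtv kap (m + w).
Proof. by move=> hm hw j; rewrite lactDr hm hw scalerDr. Qed.
Lemma wtvZ kap c m : wtv kap m -> wtv kap (c *: m).
Proof. by move=> hm j; rewrite lactZr hm !scalerA mulrC. Qed.
Lemma wtv0 kap : wtv kap 0.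
Proof. by move=> j; rewrite lact0r scaler0. Qed.
Lemma wtv_act kap c x m : ad_wt D c x -> wtv kap m ->
  wtv (fun j => kap j + hval j c) (lact x m).
Proof.
move=> rx hm j; rewrite lact_swap hm rx lactZr lactZl -scalerDl.
by rewrite intrD.
Qed.
Lemma wtv_ext kap kap' m : kap =1 kap' -> wtv kap m -> wtv kap' m.
Proof. by move=> kk hm j; rewrite hm kk. Qed.

Lemma wtv_h kap m (phi : dual h) (t : subvs_of h) : wtv kap m ->
  (forall j, phi (e6_coroot D j) = (kap j)%:~R) -> lact (vsval t) m = (phi t : F) *: m.
Proof.
move=> hm hphi; have [b h_rep] := coroot_span (subvsP t).
have -> : t = \sum_j b j *: e6_coroot D j.
  by apply: val_inj; rewrite /= h_rep raddf_sum.
rewrite [phi _]linear_sum scaler_suml raddf_sum lact_suml; apply: eq_bigr => j _.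
by rewrite linearZ /= hphi lactZl hm scalerA.
Qed.

Let hop := fun j => @lact F g W (H j).
Let hop_lin j : linear (hop j). Proof. exact: lact_linr. Qed.
Let hop_comm i j m : hop i (hop j m) = hop j (hop i m).
Proof. by rewrite /hop lact_swap (h_comm (coroot_h D i) (coroot_h D j)) lact0l addr0. Qed.

Definition other_weights kap : submod W :=
  lspan (fun w => exists kap', (exists j, kap' j != kap j) /\ wtv kap' w).

(** Different weights are separated by some h_j: a sum of vectors of weights other
than kap is killed by a product of factors h_j - c with c different from kap j,
and such a product is a nonzero scalar on vectors of weight kap. *)
Lemma wtv_indep kap m : other_weights kap m -> wtv kap m -> m = 0.
Proof.
rewrite /other_weights => lm hm; suff [s hs sm] : exists2 s : seq ('I_6 * F),
    (forall p, p \in s -> p.2 != (kap p.1)%:~R) & annih hop s m = 0.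
  have := annih_eigen hop_lin (v := m) (c := fun j => (kap j)%:~R) (fun p _ => hm p.1).
  move=> /(_ s)/eqP; rewrite sm eq_sym scaler_eq0 => /orP[|/eqP //].
  by rewrite prodf_seq_eq0 => /hasP[p /hs]; rewrite /= subr_eq0 eq_sym => /negbTE ->.
elim/lspan_ind: lm {hm} => {m} [m [k' [[j kj] hm]]||u v [s hs su] [t ht tv]|c v [s hs sv]].
- exists [:: (j, (k' j)%:~R)]; last by rewrite /= /hop hm subrr.
  by move=> p; rewrite inE => /eqP -> /=; rewrite eqr_int.
- by exists [::].
- exists (s ++ t).
    by move=> p; rewrite mem_cat => /orP[/hs|/ht].
  by rewrite annihD // !annih_cat tv annih_catC // su !annih0 // addr0.
- by exists s => //; rewrite annihZ // sv scaler0.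
Qed.

End Weights.

Lemma ad_wt_indep c x :
  lspan (fun y : g => exists2 d, d != c & ad_wt D d y) x -> ad_wt D c x -> x = 0.
Proof.
move=> lx; apply: (@wtv_indep (adjoint g)).
elim/lspan_ind: lx => {x} [x [d dc rx]||u v hu hv|k v hv];
  [|exact: span_0|exact: span_D|exact: span_Z].
apply: span_in; exists (fun j => hval j d); split=> //.
apply: contrapT => /forallNP dc'; case/eqP: dc; apply/eqP.
rewrite -subr_eq0; apply/eqP/hval_eq0 => j; rewrite hvalB.
by have /negP := dc' j; rewrite negbK => /eqP ->; rewrite subrr.
Qed.

Definition nzroots : seq rlat := e6_roots ++ map -%R e6_roots.
(** The weights of the basis gvecs, the six zeros belonging to the coroots. *)
Definition gwts : seq rlat := nzroots ++ nseq 6 0.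
Definition gvecs : seq g := map root_vec nzroots ++ [seq H i | i : 'I_6].

Lemma size_gvecs : size gvecs = size gwts.
Proof. by rewrite /gvecs /gwts !size_cat !size_map size_nseq -enumT size_enum_ord. Qed.

Lemma mem_nzroots c : c \in nzroots <-> isroot D c.
Proof.
rewrite mem_cat; split=> [/orP[cr|/mapP[d dr ->]]|/isrootP[->//|cr]].
- by apply/isrootP; left.
- by apply/isrootP; right; rewrite opprK.
- by apply/orP; right; rewrite -[c]opprK map_f.
Qed.

Lemma roots_opp c : c \in e6_roots -> - c \notin e6_roots.
Proof.
move=> cr; apply/negP => ncr; have := roots_neq0 cr; case/eqP.
apply/ffunP => i; apply/eqP; rewrite ffunE eq_le (roots_ge0 i cr) andbT.
by have := roots_ge0 i ncr; rewrite ffunE oppr_ge0.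
Qed.

Lemma uniq_nzroots : uniq nzroots.
Proof.
rewrite cat_uniq (map_inj_uniq oppr_inj) uniq_e6_roots andTb andbT.
apply/hasPn => c /mapP[d dr ->]; exact: roots_opp.
Qed.

Lemma gvecs_wt i : (i < size gwts)%N -> ad_wt D gwts`_i gvecs`_i.
Proof.
move=> hi; rewrite /gwts /gvecs (nth_cat 0 nzroots).
rewrite (nth_cat 0 (map root_vec nzroots)) size_map.
have [hin|hin] := ltnP i (size nzroots).
  rewrite (nth_map 0) //.
  by have /mem_nzroots/root_vecP[] : nzroots`_i \in nzroots by exact: mem_nth.
rewrite nth_nseq if_same; apply: h_ad_wt0.
set k := (i - _)%N; have hk : (k < 6)%N.
  by rewrite ltn_subLR //; move: hi; rewrite /gwts size_cat size_nseq.
have : [seq H j | j : 'I_6]`_k \in [seq H j | j : 'I_6].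
  by apply: mem_nth; rewrite size_map size_enum_ord.
by case/mapP=> j _ ->; apply: coroot_h.
Qed.

Lemma free_coroots : free [seq H i | i : 'I_6].
Proof.
have -> : [seq H i | i : 'I_6] = [tuple H i | i < 6] by [].
apply/freeP => k k0 i.
have [phi hphi] := @dual_with_values (fun j => (j == i)%:R).
have t0 : \sum_j k j *: e6_coroot D j = 0.
  apply: val_inj; rewrite /= raddf_sum /= -[RHS]k0; apply: eq_bigr => j _.
  by rewrite -tnth_nth tnth_mktuple.
have := congr1 phi t0; rewrite linear_sum linear0 (bigD1 i) //= linearZ /= hphi eqxx.
rewrite [_ *: _]mulr1 big1 ?addr0 // => j /negbTE ji.
by rewrite linearZ /= hphi ji scaler0.
Qed.

(** A root vector is not in the span of vectors of other weights. *)
Lemma free_gvecs : free gvecs.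
Proof.
rewrite /gvecs; have: {in nzroots, forall c, isroot D c} by move=> c /mem_nzroots.
elim: nzroots uniq_nzroots => [_ _|c l IHl /= /andP[cl ul] lr].
  exact: free_coroots.
have rc := lr c (mem_head _ _); have [xc0 rxc _] := root_vecP rc.
rewrite free_cons IHl ?andbT // => [|d dl]; last by apply: lr; rewrite inE dl orbT.
apply: contra xc0 => xin; apply/eqP/(ad_wt_indep _ rxc).
rewrite (coord_span (X := in_tuple _) xin); apply: lspan_sum => i _.
apply: span_Z; apply: span_in; set y := nth _ _ _.
have : y \in map root_vec l ++ [seq H i | i : 'I_6] by apply: mem_nth.
rewrite mem_cat => /orP[/mapP[d dl ->]|/mapP[j _ ->]].
  exists d; first by apply: contraNneq cl => <-.
  by have /root_vecP[] : isroot D d by apply: lr; rewrite inE dl orbT.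
by exists 0; [rewrite eq_sym (isroot_neq0 rc)|exact/h_ad_wt0/coroot_h].
Qed.

Lemma span_gvecs x : x \in <<gvecs>>%VS.
Proof.
have hin y : y \in h -> y \in <<gvecs>>%VS.
  move=> /coroot_span[a ->]; apply: memv_suml => i _; apply: memvZ.
  by apply: memv_span; rewrite mem_cat; apply/orP; right; apply: map_f; rewrite mem_enum.
have rin c y : ad_wt D c y -> y \in <<gvecs>>%VS.
  move=> ry; have [->|y0] := eqVneq y 0; first exact: mem0v.
  have [c0|c0] := eqVneq c 0; first by apply/hin/ad_wt0_h; rewrite -c0.
  have rc : isroot D c by exists y.
  have [_ _ /(_ _ ry)[k ->]] := root_vecP rc; apply: memvZ; apply: memv_span.
  by rewrite mem_cat map_f //; apply/mem_nzroots.
elim/lspan_ind: (joint_eigen D (enum 'I_6) x) => {x} [x [a xa]||u v|k v].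
- have [->|x0] := eqVneq x 0; first exact: mem0v.
  have {}xa j : lbr (H j) x = a j *: x by apply: xa; rewrite mem_enum.
  by have [/hin//|[c [/rin|/rin]]] := weight_root x0 xa.
- exact: mem0v.
- exact: memvD.
- exact: memvZ.
Qed.

Local Notation n := (size gvecs).
Definition gbasis : n.-tuple g := in_tuple gvecs.

Lemma gbasisP : basis_of fullv gbasis.
Proof.
rewrite basisEfree free_gvecs subvf /=.
have -> : (fullv : {vspace g}) = <<gvecs>>%VS.
  by apply/vspaceP => x; rewrite memvf span_gvecs.
by rewrite (eqnP free_gvecs).
Qed.

Lemma gbasis_wt (i : 'I_n) : ad_wt D gwts`_i gbasis`_i.
Proof. by apply: gvecs_wt; rewrite -size_gvecs. Qed.

Lemma sum_gwts (V : nmodType) (f : rlat -> V) :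
  \sum_(i < n) f gwts`_i = \sum_(c <- gwts) f c.
Proof. by rewrite [RHS](big_nth 0) big_mkord size_gvecs. Qed.

Local Notation K := (killing gbasis).

Lemma killing_coroot i j : K (H i) (H j) = (\sum_(c <- gwts) hval i c * hval j c)%:~R.
Proof.
rewrite (rmorph_sum intr) -sum_gwts /=.
apply: (btr_eigen gbasisP) => k.
by rewrite (gbasis_wt k) lbrZr (gbasis_wt k) scalerA -intrM mulrC.
Qed.

Lemma killing_coroot_gt0 i : 0 < K (H i) (H i).
Proof.
rewrite killing_coroot ltr0z.
have si : simple i \in gwts by rewrite !mem_cat simple_in_roots.
rewrite (big_rem _ si) /= hval_simple /e6_cartan eqxx ltr_wpDr //.
by apply: sumr_ge0 => c _; rewrite -expr2 sqr_ge0.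
Qed.

(** The radical of the form is an ideal and does not contain the coroots. *)
Lemma killing_nondeg x : (forall y, K x y = 0) -> x = 0.
Proof.
pose f x : 'rV[F]_n := \row_(j < n) K x gbasis`_j.
have flin : linear f.
  by move=> c u v; apply/rowP => j; rewrite !mxE killing_linl.
pose fl := HB.pack_for {linear g -> 'rV[F]_n} f (GRing.isLinear.Build _ _ _ _ f flin).
have kerP y : y \in lker (linfun fl) <-> (forall z, K y z = 0).
  rewrite memv_ker lfunE /=; split=> [/eqP /rowP y0 z|yK].
    rewrite [z](basis_expand gbasisP) (killing_sumr gbasisP) big1 // => j _.
    by have := y0 j; rewrite !mxE (killingZr gbasisP) => ->; rewrite mulr0.
  by apply/eqP/rowP => j; rewrite !mxE yK.
have [_ /(_ (lker (linfun fl)))[]] := e6_simple D.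
- move=> u v /kerP vK; apply/kerP => z.
  by rewrite lbrC killingNl killing_inv ?vK ?oppr0 //; exact: gbasisP.
- by move=> k0 /kerP; rewrite k0 memv0 => /eqP.
move=> kf; have := memvf (H n1); rewrite -kf => /kerP/(_ (H n1)) HH.
by have := killing_coroot_gt0 n1; rewrite HH ltxx.
Qed.

End WeightModules.

(** * The Casimir scalar of a singular vector *)

Lemma sum_pos_gwts (V : nmodType) (f : rlat -> V) :
  \sum_(c <- gwts) (if c \in e6_roots then f c else 0) = \sum_(c <- e6_roots) f c.
Proof.
rewrite -big_mkcond -big_filter /gwts /nzroots !filter_cat.
have nil (s : seq rlat) : (forall c, c \in s -> c \notin e6_roots) ->
    [seq c <- s | c \in e6_roots] = [::].
  by move=> h; apply/eqP; rewrite -[_ == _]negbK -has_filter; apply/hasPn.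
rewrite [X in _ ++ X]nil ?cats0 => [|c]; last first.
  rewrite mem_nseq => /andP[_ /eqP ->]; apply/negP => /roots_neq0.
  by rewrite eqxx.
rewrite [X in _ ++ X]nil ?cats0 => [|c /mapP[d dr ->]]; last exact: roots_opp.
by rewrite (_ : filter _ _ = e6_roots) //; apply/all_filterP/allP.
Qed.

Section CasimirValue.
Variables (F : numFieldType) (g : fdLieAlgType F) (D : e6Data g).
Local Notation h := (e6_h D).
Local Notation al := (e6_alpha D).
Local Notation H := (hco D).
Local Notation root_comb := (root_comb D).
Local Notation n := (size (gvecs D)).
Local Notation b := (gbasis D).
Local Notation K := (killing b).
Implicit Types (x y z : g).

Let bas := gbasisP D.
Definition gdual : 'I_n -> g := dbas bas (@killing_nondeg _ _ D).
Definition gcas (W : lieMod g) : W -> W := @casimir _ _ _ _ bas (@killing_nondeg _ _ D) W.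

Lemma gdualP (i j : 'I_n) : K b`_i (gdual j) = (i == j)%:R.
Proof. exact: dbasP. Qed.

(** The basis dual to a basis of weight vectors has opposite weights. *)
Lemma gdual_wt (i : 'I_n) : ad_wt D (- (gwts`_i)) (gdual i).
Proof.
move=> j; apply: (killing_eq bas (@killing_nondeg _ _ D)) => k.
rewrite lbrC killingNl (killing_inv bas) gbasis_wt (killingZr bas) killingZl.
rewrite (killingC bas) gdualP hvalN mulrNz mulNr; congr (- _).
by case: eqP => [->|_]; rewrite ?mulr0.
Qed.

Lemma killing_wt c d x y : ad_wt D c x -> ad_wt D d y -> c + d != 0 -> K x y = 0.
Proof.
move=> rx ry cd0; apply: contrapT => K0; case/eqP: cd0; apply: hval_eq0 => j.
have : K (lbr (H j) x) y = - K x (lbr (H j) y).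
  by rewrite lbrC killingNl (killing_inv bas).
rewrite rx ry killingZl (killingZr bas) => /eqP.
rewrite -subr_eq0 opprK -mulrDl -intrD mulf_eq0 -hvalD intr_eq0 => /orP[/eqP //|/eqP].
by move=> /K0.
Qed.

(** Vectors killed by n^+, tested on the positive root spaces. *)
Definition sing (W : lieMod g) (m : W) :=
  forall c y, c \in e6_roots -> ad_wt D c y -> lact y m = 0.

Let pr x : subvs_of h := vsproj h x.

(** The scalar of the Casimir operator on singular vectors of weight phi: the value
(phi, phi + 2 rho), written in the chosen basis. *)
Definition casv (phi : dual h) : F := \sum_(i < n)
  (if gwts`_i == 0 then phi (pr b`_i) * phi (pr (gdual i)) else
   if gwts`_i \in e6_roots then phi (pr (lbr b`_i (gdual i))) else 0 : F).

Lemma gwts_cases (i : 'I_n) :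
  [\/ gwts`_i = 0, gwts`_i \in e6_roots | - gwts`_i \in e6_roots].
Proof.
have : gwts`_i \in gwts by apply: mem_nth; rewrite -(size_gvecs D).
rewrite mem_cat => /orP[/(mem_nzroots D)/isrootP[cr|cr]|]; [by constructor 2|by constructor 3|].
by rewrite mem_nseq /= => /eqP ->; constructor 1.
Qed.

(** For a basis vector b_i in n^+, swapping it with its dual leaves the action of
[b_i, b'_i], which lies in the Cartan subalgebra; for b_i in n^-, the dual vector
already kills m. *)
Lemma casimir_sing (W : lieMod g) (m : W) kap (phi : dual h) : wtv D kap m ->
  (forall j, phi (e6_coroot D j) = (kap j)%:~R) -> sing m ->
  gcas m = casv phi *: m.
Proof.
move=> hm hphi sm; rewrite /gcas /casimir /casv scaler_suml; apply: eq_bigr => i _.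
rewrite -/(gdual i); have hact x : x \in h -> lact x m = (phi (pr x) : F) *: m.
  by move=> xh; rewrite -(wtv_h _ hm hphi) vsprojK.
have dwt := gdual_wt i; have bwt := gbasis_wt i.
have [c0|cr|cr] := gwts_cases i.
- rewrite c0 eqxx; have bh : b`_i \in h by apply: ad_wt0_h; rewrite -c0.
  have dh : gdual i \in h by apply: ad_wt0_h; rewrite -oppr0 -c0.
  by rewrite (hact _ dh) lactZr (hact _ bh) scalerA mulrC.
- rewrite (negbTE (roots_neq0 cr)) cr lact_swap (sm _ _ cr bwt) lact0r add0r.
  by apply: hact; apply: ad_wt0_h; rewrite -(subrr (gwts`_i)); apply: ad_wt_br.
- rewrite (sm _ _ cr dwt) lact0r; have /negbTE -> : gwts`_i != 0.
    by rewrite -oppr_eq0 roots_neq0.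
  by rewrite -[gwts`_i]opprK (negbTE (roots_opp cr)) scale0r.
Qed.

(** Half of K h_i h_i, by killing_h. *)
Definition snorm i : F := K (chev_e D i) (chev_f D i).

Lemma killing_h i (t : subvs_of h) : K (H i) (vsval t) = snorm i * al i t.
Proof.
have [rE rF <-] := chevP D i; rewrite (killing_inv bas).
have /ad_wt_root -/(_ t) FT := rF.
rewrite lbrC FT root_combN root_comb_simple opp_lfunE scaleNr opprK (killingZr bas).
by rewrite mulrC.
Qed.

Lemma snorm_gt0 i : 0 < snorm i.
Proof.
have := killing_coroot_gt0 D i; rewrite killing_h e6_cartan_matrix /e6_cartan eqxx.
by rewrite pmulr_lgt0 // ltr0z.
Qed.

(** The element of the Cartan subalgebra that represents root_comb c through the
Killing form. *)
Definition h_rep (c : rlat) : subvs_of h := \sum_i ((c i)%:~R / snorm i) *: e6_coroot D i.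

Lemma h_repP c (t : subvs_of h) : K (vsval (h_rep c)) (vsval t) = root_comb c t.
Proof.
rewrite /h_rep raddf_sum /= killing_suml /root_comb sum_lfunE; apply: eq_bigr => i _.
rewrite killingZl killing_h mulrz_lfun mulrA divfK ?gt_eqF ?snorm_gt0 //.
by rewrite mulrzl.
Qed.

Lemma h_repK c x : x \in h -> K (vsval (h_rep c)) x = root_comb c (pr x).
Proof. by move=> xh; rewrite -h_repP vsprojK. Qed.

(** That is, (phi + c, phi + c + 2 rho) - (phi, phi + 2 rho) = (c, 2 phi + c + 2 rho). *)
Lemma casv_diff (phi : dual h) c : casv (phi + root_comb c) - casv phi =
  (phi + phi + root_comb c) (h_rep c) + \sum_(d <- e6_roots) root_comb d (h_rep c).
Proof.
move: (h_rep c) (@h_repP c) (@h_repK c) => T tP tK.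
have Th : vsval T \in h := subvsP _.
have Tr := h_ad_wt0 Th.
have zero (i : 'I_n) : gwts`_i != 0 ->
   K (vsval T) b`_i = 0 /\ K (vsval T) (gdual i) = 0.
  move=> w0; split; first by apply: (killing_wt Tr (gbasis_wt i)); rewrite add0r.
  by apply: (killing_wt Tr (gdual_wt i)); rewrite add0r oppr_eq0.
have ex1 (psi : dual h) : psi T = \sum_(i < n)
    (if gwts`_i == 0 then root_comb c (pr b`_i) * psi (pr (gdual i)) else 0) :> F.
  have := congr1 (fun x => psi (pr x)) (expand_dbas bas (@killing_nondeg _ _ D) (vsval T)).
  rewrite /= {1}/pr vsvalK => ->; rewrite [pr _]linear_sum linear_sum.
  apply: eq_bigr => i _; rewrite !linearZ /=.
  have [w0|w0] := eqVneq gwts`_i 0.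
    by rewrite tK //; apply: ad_wt0_h; have := gbasis_wt i; rewrite w0.
  by have [-> _] := zero i w0; rewrite scale0r.
have ex2 (psi : dual h) : psi T = \sum_(i < n)
    (if gwts`_i == 0 then psi (pr b`_i) * root_comb c (pr (gdual i)) else 0) :> F.
  have := congr1 (fun x => psi (pr x)) (expand_bas bas (@killing_nondeg _ _ D) (vsval T)).
  rewrite /= {1}/pr vsvalK => ->; rewrite [pr _]linear_sum linear_sum.
  apply: eq_bigr => i _; rewrite !linearZ /= -/(gdual i).
  have [w0|w0] := eqVneq gwts`_i 0.
    have dh : gdual i \in h by apply: ad_wt0_h; have := gdual_wt i; rewrite w0 oppr0.
    by rewrite tK //; apply: mulrC.
  by have [_ ->] := zero i w0; rewrite scale0r.
have ex3 : \sum_(d <- e6_roots) root_comb d T = \sum_(i < n)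
    (if gwts`_i \in e6_roots then root_comb c (pr (lbr b`_i (gdual i))) else 0) :> F.
  transitivity (\sum_(i < n) (if gwts`_i \in e6_roots then root_comb gwts`_i T : F else 0)).
    rewrite (sum_gwts D (fun d => if d \in e6_roots then root_comb d T : F else 0)).
    by rewrite sum_pos_gwts.
  apply: eq_bigr => i _; case: ifP => // wr.
  rewrite -tK; last first.
    by apply: ad_wt0_h; rewrite -(subrr (gwts`_i)); apply: ad_wt_br (gbasis_wt i) (gdual_wt i).
  rewrite -(killing_inv bas); have /ad_wt_root -/(_ T) -> := gbasis_wt i.
  by rewrite killingZl gdualP eqxx mulr1.
rewrite ex3 !add_lfunE {1}(ex1 phi) (ex2 phi) (ex1 (root_comb c)) /casv -sumrB -!big_split.
apply: eq_bigr => i _ /=; rewrite !add_lfunE.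
have [w0|w0] := eqVneq gwts`_i 0.
  have /negbTE -> : gwts`_i \notin e6_roots.
    by apply/negP => z0; have := roots_neq0 z0; rewrite w0 eqxx.
  by rewrite addr0 mulrDl !mulrDr; ring.
case: ifP => _; last by rewrite !addr0 subrr.
by rewrite !add0r addrAC subrr add0r.
Qed.

(** In the expression of casv_diff, each simple root occurring in c contributes a
positive multiple of k i + k' i + 2, where the 2 comes from 2 rho. *)
Lemma casv_lt (phi : dual h) c (k k' : 'I_6 -> nat) :
  (forall j, phi (e6_coroot D j) = (k j)%:R) ->
  (forall j, (k' j)%:Z = (k j)%:Z + hval j c) -> nneg c -> c != 0 ->
  casv phi < casv (phi + root_comb c).
Proof.
move=> phiE k'E c0 cn0; rewrite -subr_gt0 casv_diff.
have -> : (phi + phi + root_comb c) (h_rep c) + \sum_(d <- e6_roots) root_comb d (h_rep c) =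
   \sum_i (c i)%:~R / snorm i * (k i + k' i + 2)%:R :> F.
  have -> : \sum_(d <- e6_roots) root_comb d (h_rep c) =
      (\sum_(d <- e6_roots) root_comb d : dual h) (h_rep c) :> F.
    by rewrite sum_lfunE.
  rewrite -add_lfunE linear_sum; apply: eq_bigr => i _; rewrite linearZ /=; congr (_ * _).
  have S : (\sum_(d <- e6_roots) root_comb d : dual h) (e6_coroot D i) = 2 :> F.
    rewrite sum_lfunE; transitivity (\sum_(d <- e6_roots) (hval i d)%:~R : F).
      by apply: eq_bigr => d _; apply: root_comb_coroot.
    by rewrite -(rmorph_sum intr) /= hval_sum_roots.
  rewrite !add_lfunE [X in _ + X]S phiE root_comb_coroot.
  have k'F : (k' i)%:R = (k i)%:R + (hval i c)%:~R :> F.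
    by rewrite -[LHS]/((k' i)%:Z%:~R) k'E intrD.
  by rewrite !natrD k'F; ring.
have pos i : 0 <= (c i)%:~R / snorm i * (k i + k' i + 2)%:R.
  by rewrite mulr_ge0 ?ler0n // divr_ge0 ?ler0z ?c0 // ltW // snorm_gt0.
have [i ci] : exists i, 0 < c i.
  by have [i []] := e6_posdef c0 cn0; exists i.
rewrite (bigD1 i) //= ltr_wpDr //; first by apply: sumr_ge0.
by rewrite mulr_gt0 ?divr_gt0 ?ltr0z ?snorm_gt0 // ltr0n addn2.
Qed.

End CasimirValue.

(** * Singular vectors in integrable modules *)

Section SingularVectors.
Variables (F : numFieldType) (g : fdLieAlgType F) (D : e6Data g).
Local Notation H := (hco D).
Local Notation root_vec := (root_vec D).
Local Notation root_comb := (root_comb D).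
Variables (W : lieMod g) (lam : 'I_6 -> int).
Implicit Types (m w u : W) (c k : rlat).

(** The weight lam minus the root lattice vector c. *)
Definition lamwt c : 'I_6 -> int := fun j => lam j - hval j c.

Hypothesis W_wts : forall m, lspan (fun w => exists2 c, nneg c & wtv D (lamwt c) w) m.
Hypothesis W_int : forall i m, exists n, iter n (lact (chev_f D i)) m = 0.

Lemma lamwt_inj c d : lamwt c =1 lamwt d -> c = d.
Proof.
move=> cd; apply/eqP; rewrite -subr_eq0; apply/eqP/hval_eq0 => j; rewrite hvalB.
by apply/eqP; rewrite subr_eq0 -eqr_opp -(inj_eq (addrI (lam j))); apply/eqP/cd.
Qed.

Lemma wt_bound kap m : wtv D kap m -> m != 0 -> exists2 c, nneg c & kap =1 lamwt c.
Proof.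
move=> hm m0; apply: contrapT => nk; case/eqP: m0; apply: (wtv_indep _ hm).
elim/lspan_ind: (W_wts m) => [w [c c0 hw]||u v|k v]; last 3 first.
- exact: span_0.
- exact: span_D.
- exact: span_Z.
apply: span_in; exists (lamwt c); split=> //.
apply: contrapT => /forallNP h; apply: nk; exists c => // j.
by have /negP := h j; rewrite negbK => /eqP.
Qed.

Lemma lamwt_bound c m : wtv D (lamwt c) m -> m != 0 -> nneg c.
Proof. by move=> hm /(wt_bound hm)[d d0 /lamwt_inj ->]. Qed.

Lemma lamwt_raise c d y m : ad_wt D d y -> wtv D (lamwt c) m ->
  wtv D (lamwt (c - d)) (lact y m).
Proof.
move=> ry hm; apply: wtv_ext (wtv_act ry hm) => j.
by rewrite /lamwt hvalB opprB addrA addrAC.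
Qed.

Let cas (_ : unit) : W -> W := @gcas _ _ D W.
Let cas_lin (i : unit) : linear (cas i). Proof. exact: casimir_lin. Qed.
Let cas_act (i : unit) x m : lact x (cas i m) = cas i (lact x m).
Proof. exact: casimir_comm. Qed.
Let cas_cas (i j : unit) m : cas i (cas j m) = cas j (cas i m).
Proof. by case: i; case: j. Qed.

(** Some product of factors Casimir - c, with c != a throughout, kills m. *)
Definition away (a : F) m : Prop :=
  exists2 s : seq (unit * F), (forall p, p \in s -> p.2 != a) & annih cas s m = 0.

Lemma away0 a : away a 0.
Proof. by exists [::]. Qed.

Lemma awayD a m w : away a m -> away a w -> away a (m + w).
Proof.
move=> [s hs sm] [t ht tw]; exists (s ++ t).
  by move=> p; rewrite mem_cat => /orP[/hs|/ht].
by rewrite annihD // !annih_cat tw annih_catC // sm !annih0 // addr0.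
Qed.

Lemma away_act a x m : away a m -> away a (lact x m).
Proof.
case=> s hs sm; exists s => //.
by rewrite -annih_comm ?sm ?lact0r //; exact: lact_linr.
Qed.

Lemma awayZ a (b : F) m : away a m -> away a (b *: m).
Proof. by case=> s hs sm; exists s => //; rewrite annihZ // sm scaler0. Qed.

Lemma away_eigen a m : cas tt m = a *: m -> away a m -> m = 0.
Proof.
move=> cm [s hs sm].
have cm' p : p \in s -> cas p.1 m = a *: m by case: p => -[].
have := annih_eigen cas_lin (c := fun=> a) cm'.
rewrite sm => /esym/eqP.
rewrite scaler_eq0 => /orP[|/eqP //].
by rewrite prodf_seq_eq0 => /hasP[p /hs]; rewrite /= subr_eq0 eq_sym => /negbTE ->.
Qed.

Variables (mu : 'I_6 -> nat) (k0 : rlat) (phi : dual (e6_h D)).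
Hypothesis mu_k0 : forall j, (mu j)%:Z = lamwt k0 j.
Hypothesis phi_mu : forall j, phi (e6_coroot D j) = (mu j)%:R.
Local Notation a0 := (casv phi).

(** The products attached to the roots in l commute, so their product works for all
of them at once. *)
Lemma away_list m (l : seq rlat) : (forall c, c \in l -> away a0 (lact (root_vec c) m)) ->
  exists2 s : seq (unit * F), (forall p, p \in s -> p.2 != a0) &
    forall c, c \in l -> annih cas s (lact (root_vec c) m) = 0.
Proof.
elim: l => [|c l IHl] h; first by exists [::].
have [s hs sl] := IHl (fun d dl => h d (mem_behead (s := c :: l) dl)).
have [t ht tc] := h c (mem_head _ _).
exists (s ++ t) => [p|d]; first by rewrite mem_cat => /orP[/hs|/ht].
rewrite inE annih_cat => /orP[/eqP ->|dl]; first by rewrite tc annih0.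
by rewrite annih_catC // sl // annih0.
Qed.

Lemma heightD c d : height (c + d) = height c + height d.
Proof. by rewrite /height -big_split; apply: eq_bigr => i _; rewrite ffunE. Qed.

Lemma heightN c : height (- c) = - height c.
Proof. by rewrite /height -sumrN; apply: eq_bigr => i _; rewrite ffunE. Qed.

Lemma height_root_gt0 c : c \in e6_roots -> 0 < height c.
Proof.
move=> cr; have c0 : nneg c := fun i => roots_ge0 i cr.
rewrite lt_neqAle (height_ge0 c0) andbT; apply: contraNneq (roots_neq0 cr) => e.
by rewrite (nneg_height0 c0).
Qed.

(** By induction on the distance to lam. Every e_a m is of higher weight, so a
product of admissible factors turns m into a singular vector m'. If m' is
nonzero its weight is dominant, because W is integrable, and lies strictly
above mu; one more factor, for the Casimir scalar of m', finishes. *)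
Lemma away_above N k m : (height k < N%:Z) -> wtv D (lamwt k) m ->
  nneg (k0 - k) -> k0 != k -> away a0 m.
Proof.
elim: N k m => [|N IHN] k m hk hm k0k k0nk; have [->|m0] := eqVneq m 0; try exact: away0.
  by have := height_ge0 (lamwt_bound hm m0); rewrite leNgt hk.
have step c : c \in e6_roots -> away a0 (lact (root_vec c) m).
  move=> cr; have /root_vecP[_ rx _] : isroot D c by apply/isrootP; left.
  have cge i := roots_ge0 i cr; have cgt := height_root_gt0 cr.
  apply: (IHN (k - c)); first by rewrite heightD heightN; lia.
  - exact: lamwt_raise.
  - by rewrite opprB addrCA addrC => i; rewrite ffunE addr_ge0 // k0k.
  - apply: contraNneq (roots_neq0 cr) => e; apply/eqP/ffunP => i.
    apply/eqP; rewrite ffunE eq_le cge andbT.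
    by have := k0k i; rewrite e addrAC subrr add0r ffunE oppr_ge0.
have [s hs sl] := away_list step.
pose m' := annih cas s m.
have m'w : wtv D (lamwt k) m'.
  move=> j; rewrite /m' annih_comm //; last exact: lact_linr.
  by rewrite hm annihZ.
have m's : sing D m'.
  move=> c y cr ry; have /root_vecP[_ _ one] : isroot D c by apply/isrootP; left.
  have [t ->] := one _ ry; rewrite lactZl /m' annih_comm //; last exact: lact_linr.
  by rewrite sl // scaler0.
have [m'0|m'0] := eqVneq m' 0; first by exists s.
have dom j : exists nu : nat, nu%:Z = lamwt k j.
  have [p pm] := W_int j m'; have [rE _ _] := chevP D j.
  have [nu nuE] := sl2_dominant (lbr_e_f D j) (lbr_h_f D j) m'0 (m'w j)
     (m's _ _ (simple_in_roots j) rE) pm.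
  by exists nu; apply/eqP; rewrite -(eqr_int F) nuE.
have [nu hnu] := choice dom.
have lt : a0 < casv (phi + root_comb (k0 - k)).
  apply: (casv_lt (k' := nu) phi_mu) => //; last by rewrite subr_eq0.
  by move=> j; rewrite mu_k0 hnu /lamwt hvalB; ring.
exists ((tt, casv (phi + root_comb (k0 - k))) :: s).
  by move=> p; rewrite inE => /orP[/eqP ->|/hs //]; rewrite gt_eqF.
rewrite /= -/m' /cas (casimir_sing (kap := lamwt k) (phi := phi + root_comb (k0 - k))) ?subrr //.
move=> j; rewrite add_lfunE phi_mu root_comb_coroot -[(mu j)%:R]/((mu j)%:Z%:~R) mu_k0 -intrD.
by congr (_%:~R); rewrite /lamwt hvalB; ring.
Qed.

End SingularVectors.

(** The part of weight kap of n^- W. *)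
Definition nminus_part (F : numFieldType) (g : fdLieAlgType F) (D : e6Data g)
    (W : lieMod g) (kap : 'I_6 -> int) : submod W :=
  lspan (fun w => exists c y w', [/\ c \in e6_roots, ad_wt D (- c) y,
    wtv D (fun j => kap j + hval j c) w' & w = lact y w']).

(** On u the Casimir acts by the scalar of mu, while the vectors w' of higher weight,
hence also their images in n^- W, are killed by products of factors Casimir - c
that avoid this scalar. *)
Lemma singular_nminus (F : numFieldType) (g : fdLieAlgType F) (D : e6Data g)
    (W : lieMod g) (lam : 'I_6 -> int) (mu : 'I_6 -> nat) (u : W) :
  (forall m : W, lspan (fun w => exists2 c, nneg c & wtv D (lamwt lam c) w) m) ->
  (forall i (m : W), exists n, iter n (lact (chev_f D i)) m = 0) ->
  wtv D (fun j => (mu j)%:Z) u -> sing D u ->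
  nminus_part D W (fun j => (mu j)%:Z) u -> u = 0.
Proof.
rewrite /nminus_part => W_wts W_int uw us un; apply: contrapT => /eqP u0.
have [k0 _ muE] := wt_bound W_wts uw u0.
have [phi hphi] := dual_with_values D (fun j => (mu j)%:R).
have phiE j : phi (e6_coroot D j) = ((mu j)%:Z)%:~R by rewrite hphi.
case/eqP: u0; apply: (away_eigen (D := D) (a := casv phi)).
  exact: casimir_sing uw phiE us.
elim/lspan_ind: un => {u uw us} [w [c [y [w' [cr ry w'w ->]]]]||u v|t u]; last 3 first.
- exact: away0.
- exact: awayD.
- exact: awayZ.
have [->|w'0] := eqVneq w' 0; first by rewrite lact0r; apply: away0.
apply: away_act.
have {}w'w : wtv D (lamwt lam (k0 - c)) w'.
  by apply: wtv_ext w'w => j; rewrite muE /lamwt hvalB opprB addrA addrAC.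
have k_ge := lamwt_bound W_wts w'w w'0.
apply: (away_above (N := `|height (k0 - c)|.+1) W_wts W_int muE hphi _ w'w).
- by have := height_ge0 k_ge; lia.
- by rewrite opprB addrC subrK => i; apply: roots_ge0.
- by rewrite -subr_eq0 opprB addrC subrK roots_neq0.
Qed.

(** * Cyclic modules over the current algebra *)

Section CyclicModules.
Variables (F : fieldType) (L : lieAlgType F) (S : uea L -> Prop).
Local Notation C := (cyclic_mod S).
Local Notation v := (cyclic_gen S).
Implicit Types (x : L) (u : uea L).

Lemma cyclic_act x u : lact x (quot_pi (left_ideal S) u : C) =
  quot_pi (left_ideal S) (uea_gen x * u).
Proof. exact: cyc_actE. Qed.

Lemma cyclic_ind (P : submod C) : P v ->
  (forall x m, P m -> P (lact x m)) -> forall m, P m.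
Proof.
move=> Pv Pact m; have [u ->] := quot_surj m.
suff h u' : forall w, P (quot_pi (left_ideal S) w) -> P (quot_pi (left_ideal S) (u' * w)).
  by rewrite -[u]mulr1; apply: h.
elim/uea_ind: u' => [x|k|a b ha hb|a b ha hb] w Pw.
- by rewrite -cyclic_act; apply: Pact.
- rewrite -scalerAl mul1r -[k *: w]addr0.
  have -> : quot_pi (left_ideal S) (k *: w + 0) = k *: (quot_pi (left_ideal S) w : C).
    by rewrite quot_pi_linear (_ : quot_pi _ 0 = 0) ?addr0 //; apply/quot_pi_eq0/submod0.
  exact: submodZ.
- rewrite mulrDl -[a * w]scale1r quot_pi_linear scale1r.
  by apply: (@submodD _ _ P); [apply: ha|apply: hb].
- by rewrite -mulrA; apply/ha/hb.
Qed.

Lemma cyclic_gen0 x : S (uea_gen x) -> lact x v = 0.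
Proof. by move=> Sx; rewrite cyclic_act mulr1; apply/quot_pi_eq0/lideal_in. Qed.

Lemma cyclic_iter0 x k : S (uea_gen x ^+ k) -> iter k (lact x) v = 0.
Proof.
move=> Sx; have -> : iter k (lact x) v = quot_pi (left_ideal S) (uea_gen x ^+ k) :> C.
  elim: k {Sx} => [|k IHk]; first by rewrite expr0.
  by rewrite iterS IHk cyclic_act exprS.
exact/quot_pi_eq0/lideal_in.
Qed.

Lemma cyclic_eigen x (k : nat) : S (uea_gen x - k%:R) -> lact x v = k%:R *: v.
Proof.
move=> Sx; rewrite cyclic_act mulr1; apply/eqP; rewrite -subr_eq0; apply/eqP.
have := proj2 (quot_pi_eq0 (left_ideal S) _) (lideal_in Sx).
by rewrite addrC -scaler_nat -scaleNr quot_pi_linear addrC scaleNr.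
Qed.

End CyclicModules.

Section Currents.
Variables (F : fieldType) (L : lieAlgType F) (W : lieMod (current L)).
Implicit Types (x y : L) (m : W).

Lemma tpowD x y r : tpow (x + y) r = tpow x r + tpow y r.
Proof. by have := tpow_lin r 1 x y; rewrite !scale1r. Qed.
Lemma tpow0 r : tpow (0 : L) r = 0.
Proof. by apply: (addrI (tpow 0 r)); rewrite -tpowD !addr0. Qed.
Lemma tpowZ c x r : tpow (c *: x) r = c *: tpow x r.
Proof. by have := tpow_lin r c x 0; rewrite !addr0 tpow0 addr0. Qed.

Lemma current_expand (f : current L) : exists n : nat, f = \sum_(r < n) tpow (f r) r.
Proof.
have /asboolP[n hn] := coef_fin f; exists n; apply: current_eqP => s.
have -> : (\sum_(r < n) tpow (f r) r) s = \sum_(r < n) (if s == r then f r else 0).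
  have E := big_morph (fun k : current L => coef k s) (fun a b => Defs.coefD a b s)
    (Defs.coef0 L s).
  by rewrite E; apply: eq_bigr => r _; apply: coef_tpow.
have [ns|sn] := leqP n s.
  by rewrite hn // big1 // => r _; rewrite gtn_eqF // (leq_trans _ ns).
rewrite (bigD1 (Ordinal sn)) //= eqxx big1 ?addr0 // => r /negbTE rs.
by rewrite eq_sym -[_ == _]/(r == Ordinal sn) rs.
Qed.

Lemma act_tpow (P : submod W) m :
  (forall x r, P (lact (tpow x r) m)) -> forall f, P (lact f m).
Proof.
move=> h f; have [n ->] := current_expand f; rewrite lact_suml.
by apply: lspan_sum => r _; apply: h.
Qed.

Lemma tact_swap x y r s m : lact (tpow x r) (lact (tpow y s) m) =
  lact (tpow y s) (lact (tpow x r) m) + lact (tpow (lbr x y) (r + s)) m.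
Proof. by rewrite lact_swap tpow_br. Qed.

Lemma tactDl x y r m : lact (tpow (x + y) r) m = lact (tpow x r) m + lact (tpow y r) m.
Proof. by rewrite tpowD lactDl. Qed.
Lemma tactZl c x r m : lact (tpow (c *: x) r) m = c *: lact (tpow x r) m.
Proof. by rewrite tpowZ lactZl. Qed.
Lemma tact0l r m : lact (tpow (0 : L) r) m = 0.
Proof. by rewrite tpow0 lact0l. Qed.

End Currents.

(** The Leibniz rule: the nilpotency orders of ad f on z and of f on m add up. *)
Lemma iter_act_nilp (F : fieldType) (L : lieAlgType F) (W : lieMod L) (f z : L) (m : W) k n :
  iter k (lbr f) z = 0 -> iter n (lact f) m = 0 ->
  iter (k + n) (lact f) (lact z m) = 0.
Proof.
have i0 j : iter j (lact f) (0 : W) = 0.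
  by elim: j => //= j ->; rewrite lact0r.
have iD j u w : iter j (lact f) (u + w) = iter j (lact f) u + iter j (lact f) w :> W.
  by elim: j => //= j ->; rewrite lactDr.
elim: k z m n => [|k IHk] z m n; first by rewrite /= => -> _; rewrite lact0l i0.
elim: n m => [|n IHn] m fz fm; first by rewrite /= in fm; rewrite fm lact0r i0.
rewrite addnS iterSr lact_swap iD IHn -?iterSr // add0r addSnnS.
by apply: IHk => //; rewrite -iterSr.
Qed.

(** * Triangular decomposition *)

Section GSpan.
Variables (F : numFieldType) (g : fdLieAlgType F) (D : e6Data g).

(** g is the sum of the Cartan subalgebra and of the positive and negative root
spaces. *)
Lemma g_ind (P : submod g) : (forall t, t \in e6_h D -> P t) ->
  (forall c x, c \in e6_roots -> ad_wt D c x -> P x) ->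
  (forall c x, c \in e6_roots -> ad_wt D (- c) x -> P x) -> forall x, P x.
Proof.
move=> P0 Pp Pn x; elim/lspan_ind: (joint_eigen D (enum 'I_6) x) => {x} [x [a xa]||u v|k v].
- have [->|x0] := eqVneq x 0; first exact: submod0.
  have {}xa j : lbr (hco D j) x = a j *: x by apply: xa; rewrite mem_enum.
  have rP c : ad_wt D c x -> P x.
    move=> rx; have [c0|c0] := eqVneq c 0; first by apply/P0/ad_wt0_h; rewrite -c0.
    have /isrootP[cr|cr] : isroot D c by exists x.
      exact: Pp cr rx.
    by apply: (Pn _ _ cr); rewrite opprK.
  by have [/P0//|[c [/rP|/rP]]] := weight_root x0 xa.
- exact: submod0.
- exact: submodD.
- exact: submodZ.
Qed.

Lemma adF_nilp i x : exists k, iter k (lbr (chev_f D i)) x = 0.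
Proof.
pose P (x : g) := exists k, iter k (lbr (chev_f D i)) x = 0.
have it0 j n (y : g) :
    iter n (lbr (chev_f D i)) y = 0 -> iter (j + n) (lbr (chev_f D i)) y = 0.
  by move=> yn; rewrite iterD yn (sl2_iter0 (adjoint g)).
have itD n (y z : g) : iter n (lbr (chev_f D i)) (y + z) =
   iter n (lbr (chev_f D i)) y + iter n (lbr (chev_f D i)) z.
  by elim: n => //= n ->; rewrite lbrDr.
have P0 : P 0 by exists 0%N.
have PD y z : P y -> P z -> P (y + z).
  move=> [a ya] [b zb]; exists (a + b)%N.
  by rewrite itD (it0 a b _ zb) addr0 addnC (it0 b a _ ya).
have PZ c y : P y -> P (c *: y).
  by move=> [a ya]; exists a; rewrite (sl2_iterZ (V := adjoint g)) /= ya scaler0.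
apply: (g_ind (P := Submod P0 PD PZ)) => [t th|c y _ ry|c y _ ry]; rewrite /=.
- exact: (nilpF _ (h_ad_wt0 th)).
- exact: nilpF ry.
- exact: nilpF ry.
Qed.

Lemma pos_root_comb c : c \in e6_roots -> pos_root (root_comb D c).
Proof.
move=> cr; split; first by apply: isroot_is_root; apply/isrootP; left.
exists (fun i => `|c i|%N); apply: eq_bigr => i _.
by rewrite -[in LHS](gez0_abs (roots_ge0 i cr)) -pmulrn.
Qed.

Lemma nplus_ad_wt c x : c \in e6_roots -> ad_wt D c x -> nplus D x.
Proof.
move=> cr rx; apply: span_in; exists (root_comb D c); first exact: pos_root_comb.
exact/ad_wt_root.
Qed.

Lemma xminus_root_comb c : xminus (root_comb D c) = root_vec D (- c).
Proof. by rewrite /xminus /root_vec root_combN. Qed.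

Lemma isroot_neg c : c \in e6_roots -> isroot D (- c).
Proof. by move=> cr; apply/isrootP; right; rewrite opprK. Qed.

Lemma nplus_t_tpow c x r : c \in e6_roots -> ad_wt D c x -> nplus_t D (tpow x r).
Proof.
move=> cr rx s; rewrite coef_tpow; case: ifP => _; first exact: nplus_ad_wt rx.
exact: span_0.
Qed.

Lemma h_tt_tpow t r : t \in e6_h D -> (0 < r)%N -> h_tt D (tpow t r).
Proof.
move=> th r0; split; first by rewrite coef_tpow ltn_eqF.
by move=> s; rewrite coef_tpow; case: ifP => // _; rewrite mem0v.
Qed.

(** Here y' = [e_j, y], which [f_j, -] sends back to a nonzero multiple of y because y'
has weight 1 for h_j. *)
Lemma neg_root_bracket c j y : c \in e6_roots -> hval j c = 1 -> ad_wt D (- c) y ->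
  exists2 y', ad_wt D (- (c - simple j)) y' & exists t : F, y = t *: lbr (chev_f D j) y'.
Proof.
move=> cr hc ry; have [->|y0] := eqVneq y 0.
  by exists 0; [exact: ad_wt_0|exists 0; rewrite scale0r].
have [rE rF _] := chevP D j.
have ry' : ad_wt D (- (c - simple j)) (lbr (chev_e D j) y).
  by rewrite opprB; apply: ad_wt_br.
have y'0 : lbr (chev_e D j) y != 0.
  by apply: (iterE_neq0 (n := 1) ry y0); rewrite hvalN hc.
exists (lbr (chev_e D j) y) => //.
have ryy : ad_wt D (- c) (lbr (chev_f D j) (lbr (chev_e D j) y)).
  by have := ad_wt_br rF ry'; rewrite opprB addrA addNr add0r.
have yy0 : lbr (chev_f D j) (lbr (chev_e D j) y) != 0.
  apply: (iterF_neq0 (n := 1) ry' y'0).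
  by rewrite hvalN hvalB hc hval_simple /e6_cartan eqxx.
have [xc0 _ one] := root_vecP (isroot_neg cr).
have [a aE] := one _ ry; have [b bE] := one _ ryy.
exists (a / b); rewrite bE scalerA divfK //.
by apply: contraNneq yy0 => b0; rewrite bE b0 scale0r.
Qed.

End GSpan.

(** * Kirillov-Reshetikhin modules *)

Section KRModules.
Variables (F : numFieldType) (g : fdLieAlgType F) (D : e6Data g).
Variables (i : 'I_6) (mm : nat).
Local Notation v := (KR_gen D i mm).

(** Bracketing with h_j (x) t^(s - r), which kills the generator, raises the power
of t. *)
Lemma KR_raise j y r s : lbr (hco D j) y = -2 *: y ->
  lact (tpow y r) v = 0 -> (r <= s)%N -> lact (tpow y s) v = 0.
Proof.
move=> hy yr; rewrite leq_eqVlt => /orP[/eqP <- //|rs].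
have hv : lact (tpow (hco D j) (s - r)) v = 0.
  by apply/cyclic_gen0/KR_htt/h_tt_tpow; [exact: coroot_h|rewrite subn_gt0].
have := tact_swap (hco D j) y (s - r) r v.
rewrite yr hv !lact0r add0r subnK 1?ltnW // hy tactZl => /esym/eqP.
by rewrite scaler_eq0 oppr_eq0 pnatr_eq0 => /eqP.
Qed.

(** By induction on the height of c. A nonsimple root vector is, up to a scalar, a
bracket [f_j, y']; one power of t is spent on f_j if j = i, the others go to y'.
When the highest weight is zero, all of n^- kills the generator and no power of
t is needed. *)
Lemma KR_kill c r y : c \in e6_roots -> mm = 0%N \/ c i <= r%:Z ->
  ad_wt D (- c) y -> lact (tpow y r) v = 0.
Proof.
have killed j s z : (mm = 0%N) \/ ((j == i) <= s)%N -> ad_wt D (- simple j) z ->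
    lact (tpow z s) v = 0.
  move=> hs rz.
  have hz : lbr (hco D j) z = -2 *: z.
    by rewrite rz hvalN hval_simple /e6_cartan eqxx.
  have [_ _ one] := root_vecP (isroot_neg D (simple_in_roots j)); have [t zE] := one _ rz.
  have xE : xminus (e6_alpha D j) = root_vec D (- simple j).
    by rewrite -xminus_root_comb root_comb_simple.
  have [ji|ji] := eqVneq j i; last first.
    apply: (KR_raise (r := 0) hz) => //; rewrite zE tactZl -xE.
    by rewrite (cyclic_gen0 (KR_xj _ _ ji)) scaler0.
  have [m0|m0] := eqVneq mm 0%N.
    apply: (KR_raise (r := 0) hz) => //; rewrite zE tactZl -xE.
    have := cyclic_iter0 (KR_xi D i mm); rewrite m0 /= -ji => ->; exact: scaler0.
  apply: (KR_raise (r := 1) hz) => //; last first.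
    by case: hs => [/eqP|]; [rewrite (negbTE m0)|rewrite ji eqxx].
  by rewrite zE tactZl -xE ji (cyclic_gen0 (KR_xi1 D i mm)) scaler0.
move: {2}`|height c|%N (leqnn `|height c|%N) => n.
elim: n c r y => [|n IHn] c r y hn cr hr ry.
  by have := height_root_gt0 cr; lia.
have [[j cj]|/forallNP ns] := pselect (exists j, c = simple j).
  apply: (killed j) => //; last by rewrite -cj.
  case: hr => [->|hr]; [by left|right].
  by move: hr; rewrite cj ffunE eq_sym; case: (j == i) => //; case: r {ry}.
have [j|j [hj dr cj]] := lower_root cr; first by apply/eqP/ns.
have [y' ry' [t ->]] := neg_root_bracket cr hj ry.
(* r1 is the power of t spent on f_j. *)
pose r1 : nat := if mm == 0%N then 0%N else (j == i).
have r1r : (r1 <= r)%N.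
  rewrite /r1; case: eqP => // m0; case: hr => // cir.
  by have [ji|//] := eqVneq j i; move: cj; rewrite ji; lia.
have -> : r = (r1 + (r - r1))%N by rewrite subnKC.
rewrite tactZl -tpow_br lact_br.
rewrite (killed j r1); first last.
- by have [] := chevP D j.
- by rewrite /r1; have [m0|m0] := eqVneq mm 0%N; [left|right].
rewrite (IHn (c - simple j) (r - r1)%N) //.

- by rewrite !lact0r subrr scaler0.
- have := height_root_gt0 dr; have : height (simple j) = 1.
    by rewrite /height (bigD1 j) //= ffunE eqxx big1 // => k /negbTE kj; rewrite ffunE kj.
  by rewrite heightD heightN; lia.
- case: hr => [->|cir]; [by left|].
  have [m0|m0] := eqVneq mm 0%N; [by left|right].
  have r1E : r1 = (i == j) by rewrite /r1 (negbTE m0) eq_sym.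
  rewrite r1E in r1r *; rewrite !ffunE; move: cir r1r.
  by move: (c i : int) => ci; case: (i == j) => /=; lia.
Qed.

End KRModules.

(** * Special roots and the simple root of node 3 *)

Lemma special_add3 b : b \in special -> b != delta -> b + simple n3 \notin e6_roots.
Proof.
case/mapP=> l ll -> {b} ld; apply/negP => /mapP[s sl e].
have : all (fun l => (l == [:: 1; 2; 2; 2; 1; 1]%N) || all (fun s => has (fun k =>
  nth 0%N s k != (nth 0%N l k + (k == 2%N))%N) (iota 0 6)) e6_list) special_list.
  by vm_compute.
move/allP/(_ l ll)/orP=> [/eqP lE|/allP/(_ s sl)/hasP[k]].
  by rewrite lE eqxx in ld.
rewrite mem_iota /= => hk; have := congr1 (fun c : rlat => c (Ordinal hk)) e.
rewrite !ffunE -val_eqE /= => sk; rewrite -eqz_nat PoszD -sk eqxx //.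
Qed.

Lemma epsilon_add3 : epsilon + simple n3 \notin e6_roots.
Proof.
apply/negP => /mapP[s sl e].
have : all (fun s => nth 0%N s 2 != 4%N) e6_list by vm_compute.
move/allP/(_ s sl); have := congr1 (fun c : rlat => c n3) e.
by rewrite !ffunE /= => -[<-].
Qed.

Lemma delta_add3 : delta + simple n3 = epsilon.
Proof. by apply/ffunP; elim/forall6; rewrite !ffunE. Qed.

Lemma delta_hval3 : hval n3 delta = -1.
Proof. by rewrite hval_of_coefs. Qed.

Lemma delta_special : delta \in special.
Proof. by apply: map_f. Qed.

Lemma special_roots b : b \in special -> b \in e6_roots.
Proof. by case/mapP=> l ll ->; apply: map_f; move: l ll; apply/allP. Qed.

Lemma epsilon_roots : epsilon \in e6_roots.
Proof. exact: map_f. Qed.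

(** * The module M(lambda) with lambda(h_3) = 0 *)

Section Mmodule.
Variables (F : numFieldType) (g : fdLieAlgType F) (D : e6Data g) (lam : 'I_6 -> nat).
Hypothesis lam3 : lam n3 = 0%N.
Local Notation W := (M D lam).
Local Notation v := (cyclic_gen (M_rel D lam)).
Local Notation wt c := (wtv (W := res_const W) D (lamwt (fun j => (lam j)%:Z) c)).
Implicit Types (x y : g) (m w : W).

Lemma Mgen_plus c x r : c \in e6_roots -> ad_wt D c x -> lact (tpow x r) v = 0.
Proof. by move=> cr rx; apply/cyclic_gen0/M_nplus; apply: nplus_t_tpow rx. Qed.

Lemma Mgen_h t r : t \in e6_h D -> (0 < r)%N -> lact (tpow t r) v = 0.
Proof. by move=> th r0; apply/cyclic_gen0/M_htt/h_tt_tpow. Qed.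

Lemma Mgen_wt : wt 0 v.
Proof.
move=> j; rewrite /lamwt hval0 subr0.
exact: (cyclic_eigen (M_hi D lam j)).
Qed.

Lemma neg_rootE c y : c \in e6_roots -> ad_wt D (- c) y ->
  exists t : F, y = t *: xminus (root_comb D c).
Proof.
by move=> cr ry; have [_ _ /(_ _ ry)] := root_vecP (isroot_neg D cr); rewrite xminus_root_comb.
Qed.

Lemma Mgen_minus c y r : c \in e6_roots -> ad_wt D (- c) y ->
  (forall i, lam i = 0%N \/ c i <= r%:Z) -> lact (tpow y r) v = 0.
Proof.
move=> cr ry hr; have [t ->] := neg_rootE cr ry; rewrite tactZl cyclic_gen0 ?scaler0 //.
apply: M_xr => i; split; first exact: pos_root_comb.
apply: (KR_kill cr (hr i)); rewrite xminus_root_comb.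
by have [] := root_vecP (isroot_neg D cr).
Qed.

Lemma Mgen_minus2 c y r : c \in e6_roots -> ad_wt D (- c) y -> (1 < r)%N ->
  lact (tpow y r) v = 0.
Proof.
move=> cr ry r1; apply: (Mgen_minus cr ry) => i.
have [->|i3] := eqVneq i n3; [by left|right].
by have := roots_le2 cr i3; move: (c i : int) => ci; lia.
Qed.

Lemma Mgen_minus1 c y : c \in e6_roots -> ad_wt D (- c) y -> c != epsilon ->
  c \notin special -> lact (tpow y 1) v = 0.
Proof.
move=> cr ry ce cs; apply: (Mgen_minus cr ry) => i.
have [->|i3] := eqVneq i n3; [by left|right].
have [ceq|csp|c1] := roots_special cr.
- by rewrite ceq eqxx in ce.
- by rewrite csp in cs.
- exact: c1.
Qed.

Lemma Mgen_f3 y : ad_wt D (- simple n3) y -> lact (tpow y 0) v = 0.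
Proof.
move=> ry; have [t ->] := neg_rootE (simple_in_roots n3) ry.
rewrite root_comb_simple tactZl.
have := cyclic_iter0 (M_xi D lam n3); rewrite lam3 /= => ->.
exact: scaler0.
Qed.

(** The negative root vectors are covered by roots_le2: at node 3, where a coefficient
3 occurs, lambda vanishes. *)
Lemma Mgen_t2 x r : (1 < r)%N -> lact (tpow x r) v = 0.
Proof.
move=> r1.
have P0 : lact (tpow (0 : g) r) v = 0 by rewrite tact0l.
have PD (y z : g) : lact (tpow y r) v = 0 -> lact (tpow z r) v = 0 ->
    lact (tpow (y + z) r) v = 0.
  by move=> py pz; rewrite tactDl py pz addr0.
have PZ c (y : g) : lact (tpow y r) v = 0 -> lact (tpow (c *: y) r) v = 0.
  by move=> py; rewrite tactZl py scaler0.
apply: (g_ind (D := D) (P := Submod (submod_set := fun y => lact (tpow y r) v = 0) P0 PD PZ)).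
- by move=> t th; apply: Mgen_h => //; apply: ltnW.
- by move=> c y cr ry; apply: Mgen_plus ry.
- by move=> c y cr ry; apply: Mgen_minus2 ry r1.
Qed.

(** The elements of g (x) t^2 C[t] form an ideal of g[t], so they kill M as soon as they
kill its generator. *)
Lemma M_t2 x r m : (1 < r)%N -> lact (tpow x r) m = 0.
Proof.
pose P m := forall x r, (1 < r)%N -> lact (tpow x r) m = 0.
have P0 : P 0 by move=> *; rewrite lact0r.
have PD u w : P u -> P w -> P (u + w).
  by move=> pu pw y s s1; rewrite lactDr pu // pw // addr0.
have PZ c u : P u -> P (c *: u) by move=> pu y s s1; rewrite lactZr pu // scaler0.
have : Submod P0 PD PZ m; last by apply.
apply: cyclic_ind => [y s|f u pu]; first exact: Mgen_t2.
apply: act_tpow => y s z q q1; rewrite tact_swap pu // lact0r add0r.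
by apply: pu; rewrite (leq_trans q1) // leq_addr.
Qed.

Lemma M_tcomm x y m :
  lact (tpow x 1) (lact (tpow y 1) m) = lact (tpow y 1) (lact (tpow x 1) m).
Proof. by rewrite tact_swap (@M_t2 _ (1 + 1)) // addr0. Qed.

Definition mact (s : seq rlat) (m : W) : W :=
  foldr (fun b w => lact (tpow (root_vec D (- b)) 1) w) m s.
(** The monomials in the commuting operators x_b (x) t, applied to the generator. *)
Definition mono s := mact s v.

Lemma mact_cons b s m : mact (b :: s) m = lact (tpow (root_vec D (- b)) 1) (mact s m).
Proof. by []. Qed.

Lemma mact_cat s t m : mact (s ++ t) m = mact s (mact t m).
Proof. by rewrite /mact foldr_cat. Qed.

Lemma mact_t x s m : lact (tpow x 1) (mact s m) = mact s (lact (tpow x 1) m).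
Proof. by elim: s => // b s IHs; rewrite !mact_cons M_tcomm IHs. Qed.

Lemma mact_comm s t m : mact s (mact t m) = mact t (mact s m).
Proof. by elim: s => // b s IHs; rewrite !mact_cons IHs mact_t. Qed.

Lemma mact0 s : mact s 0 = 0.
Proof. by elim: s => // b s IHs; rewrite mact_cons IHs lact0r. Qed.

Lemma mono_perm s t : perm_eq s t -> mono s = mono t.
Proof.
apply: catCA_perm_subst => s1 s2 s3.
by rewrite /mono !mact_cat mact_comm.
Qed.

Local Notation S7 := (epsilon :: special).

Lemma S7_roots b : b \in S7 -> b \in e6_roots.
Proof. by rewrite inE => /orP[/eqP ->|/special_roots]; first exact: epsilon_roots. Qed.

Lemma mono_wt s : all [in S7] s -> wt (\sum_(b <- s) b) (mono s).
Proof.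
elim: s => [_|b s IHs /andP[bS sS]]; first by rewrite big_nil; apply: Mgen_wt.
have [_ rb _] := root_vecP (isroot_neg D (S7_roots bS)).
move=> j; have -> : @lact _ _ (res_const W) (hco D j) (mono (b :: s)) =
  lact (tpow (hco D j) 0) (lact (tpow (root_vec D (- b)) 1) (mono s)) by [].
rewrite tact_swap rb tactZl.
have -> : lact (tpow (hco D j) 0) (mono s) = @lact _ _ (res_const W) (hco D j) (mono s) by [].
rewrite (IHs sS j) lactZr -scalerDl -intrD; congr (_%:~R *: _).
by rewrite big_cons /lamwt hvalD hvalN; ring.
Qed.

Definition is_mono (w : W) := exists2 s, all [in S7] s & w = mono s.

(** Being commuting operators, the elements of g (x) t can be moved to the generator,
which they kill unless they belong to one of the seven roots. *)
Lemma mono_act1 x s : all [in S7] s -> lspan is_mono (lact (tpow x 1) (mono s)).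
Proof.
move=> sS; pose P x := lspan is_mono (lact (tpow x 1) (mono s)).
have P0 : P 0 by rewrite /P tact0l; apply: span_0.
have PD y z : P y -> P z -> P (y + z) by move=> py pz; rewrite /P tactDl; apply: span_D.
have PZ c y : P y -> P (c *: y) by move=> py; rewrite /P tactZl; apply: span_Z.
apply: (g_ind (D := D) (P := Submod P0 PD PZ)); rewrite /= /P.
- by move=> t th; rewrite mact_t Mgen_h // mact0; apply: span_0.
- by move=> c y cr ry; rewrite mact_t (Mgen_plus _ cr ry) mact0; apply: span_0.
move=> c y cr ry; have [cS|cS] := boolP (c \in S7).
  have [_ _ /(_ _ ry)[t ->]] := root_vecP (isroot_neg D cr); rewrite tactZl.
  by apply/span_Z/span_in; exists (c :: s) => //=; rewrite cS.
move: cS; rewrite inE negb_or => /andP[ce cs].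
by rewrite mact_t (Mgen_minus1 cr ry) // mact0; apply: span_0.
Qed.

Lemma mono_act1_span x m : lspan is_mono m -> lspan is_mono (lact (tpow x 1) m).
Proof.
elim/lspan_ind => {m} [m [s sS ->]||u w hu hw|c w hw].
- exact: mono_act1.
- by rewrite lact0r; apply: span_0.
- by rewrite lactDr; apply: span_D.
- by rewrite lactZr; apply: span_Z.
Qed.

(** An element of the Borel subalgebra acts on monomials by derivations with values
in g (x) t. *)
Lemma mono_actb x s : all [in S7] s ->
  (x \in e6_h D \/ exists2 c, c \in e6_roots & ad_wt D c x) ->
  lspan is_mono (lact (tpow x 0) (mono s)).
Proof.
move=> + hx; elim: s => [_|b s IHs /andP[bS sS]].
  case: hx => [xh|[c cr rx]]; last by rewrite (Mgen_plus _ cr rx); apply: span_0.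
  have [a ->] := coroot_span xh.
  have -> : lact (tpow (\sum_i a i *: hco D i) 0) v =
    lact (\sum_i a i *: hco D i) (v : res_const W) by [].
  rewrite lact_suml; apply: lspan_sum => i _; rewrite lactZl Mgen_wt.
  by do 2!apply: span_Z; apply: span_in; exists [::].
rewrite /mono mact_cons tact_swap; apply: span_D; first exact/mono_act1_span/IHs.
exact: mono_act1.
Qed.

(** Products of lowering operators of degree zero applied to monomials. *)
Inductive lowered : W -> Prop :=
| lowered_mono s : all [in S7] s -> lowered (mono s)
| lowered_act c y w : c \in e6_roots -> ad_wt D (- c) y -> lowered w ->
    lowered (lact (tpow y 0) w).

Lemma lowered_wt w : lowered w -> exists2 c, nneg c & wt c w.
Proof.
elim=> [s sS|c y {}w cr ry _ [d d0 dw]].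
  exists (\sum_(b <- s) b); last exact: mono_wt.
  move=> i; rewrite sum_ffunE big_seq; apply: sumr_ge0 => b bs.
  by apply: roots_ge0; apply: S7_roots; apply: (allP sS).
exists (d + c).
  by move=> i; rewrite ffunE addr_ge0 ?d0 // roots_ge0.
have := lamwt_raise (W := res_const W) ry dw; rewrite opprK; exact.
Qed.

Lemma mono_lowered m : lspan is_mono m -> lspan lowered m.
Proof.
elim/lspan_ind => {m} [m [s sS ->]||u w hu hw|c w hw].
- by apply/span_in/lowered_mono.
- exact: span_0.
- exact: span_D.
- exact: span_Z.
Qed.

Lemma lowered_span_act c y m : c \in e6_roots -> ad_wt D (- c) y ->
  lspan lowered m -> lspan lowered (lact (tpow y 0) m).
Proof.
move=> cr ry; elim/lspan_ind => {m} [m hm||u w hu hw|k w hw].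
- by apply/span_in/(lowered_act cr ry).
- by rewrite lact0r; apply: span_0.
- by rewrite lactDr; apply: span_D.
- by rewrite lactZr; apply: span_Z.
Qed.

Lemma lowered_stable w : lowered w -> forall x r, lspan lowered (lact (tpow x r) w).
Proof.
elim=> [s sS|c y {}w cr ry _ IHw] x r; last first.
  rewrite tact_swap; apply: span_D; last exact: IHw.
  exact: lowered_span_act cr ry (IHw _ _).
case: r => [|[|r]]; last by rewrite M_t2 //; apply: span_0.
  pose P x := lspan lowered (lact (tpow x 0) (mono s)).
  have P0 : P 0 by rewrite /P tact0l; apply: span_0.
  have PD y z : P y -> P z -> P (y + z) by move=> py pz; rewrite /P tactDl; apply: span_D.
  have PZ c y : P y -> P (c *: y) by move=> py; rewrite /P tactZl; apply: span_Z.
  apply: (g_ind (D := D) (P := Submod P0 PD PZ)); rewrite /= /P.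
  - by move=> t th; apply/mono_lowered/mono_actb => //; left.
  - by move=> c y cr ry; apply/mono_lowered/mono_actb => //; right; exists c.
  - by move=> c y cr ry; apply/span_in/(lowered_act cr ry)/lowered_mono.
exact/mono_lowered/mono_act1.
Qed.

Lemma M_lowered m : lspan lowered m.
Proof.
move: m; apply: cyclic_ind => [|f m].
  by apply: span_in; apply: (@lowered_mono [::]).
elim/lspan_ind => {m} [m hm||u w hu hw|k w hw].
- by apply: act_tpow => x r; apply: lowered_stable.
- by rewrite lact0r; apply: span_0.
- by rewrite lactDr; apply: span_D.
- by rewrite lactZr; apply: span_Z.
Qed.

Lemma M_wts m : lspan (fun w => exists2 c, nneg c & wt c w) m.
Proof.
elim/lspan_ind: (M_lowered m) => {m} [m /lowered_wt hm||u w hu hw|c w hw].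
- exact: span_in.
- exact: span_0.
- exact: span_D.
- exact: span_Z.
Qed.

(** f_i acts nilpotently on the generator, and ad f_i is nilpotent on g. *)
Lemma M_int i m : exists n, iter n (lact (l := res_const W) (chev_f D i)) m = 0.
Proof.
pose f := tpow (chev_f D i) 0.
have -> : lact (l := res_const W) (chev_f D i) = lact f by [].
pose P m := exists n, iter n (lact f) m = 0 :> W.
have it0 n : iter n (lact f) (0 : W) = 0 by elim: n => // n IHn; rewrite iterS IHn lact0r.
have itD n u w : iter n (lact f) (u + w) = iter n (lact f) u + iter n (lact f) w :> W.
  by elim: n => // n IHn; rewrite !iterS IHn lactDr.
have P0 : P 0 by exists 0%N.
have PD u w : P u -> P w -> P (u + w).
  move=> [a ua] [b wb]; exists (a + b)%N.
  by rewrite itD [in X in X + _]addnC !iterD ua wb !it0 addr0.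
have PZ c u : P u -> P (c *: u).
  move=> [a ua]; exists a.
  have -> : iter a (lact f) (c *: u) = c *: iter a (lact f) u.
    by elim: (a) => // n IHn; rewrite !iterS IHn lactZr.
  by rewrite ua scaler0.
have : Submod P0 PD PZ m; last by [].
apply: cyclic_ind => [|h u [n nu]].
  have [_ rF _] := chevP D i; have [t tF] := neg_rootE (simple_in_roots i) rF.
  exists (lam i).+1; rewrite /f tF root_comb_simple tpowZ.
  have itZ n u : iter n (lact (t *: tpow (xminus (e6_alpha D i)) 0)) u =
      t ^+ n *: iter n (lact (tpow (xminus (e6_alpha D i)) 0)) u :> W.
    elim: n => [|n IHn]; first by rewrite scale1r.
    by rewrite !iterS IHn lactZr lactZl scalerA exprS mulrC.
  by rewrite itZ (cyclic_iter0 (M_xi D lam i)) scaler0.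
apply: act_tpow => x r; have [k kx] := adF_nilp D i x.
exists (k + n)%N; apply: iter_act_nilp nu.
have -> : iter k (lbr f) (tpow x r) = tpow (iter k (lbr (chev_f D i)) x) r.
  by elim: k {kx} => // k IHk; rewrite !iterS IHk tpow_br.
by rewrite kx tpow0.
Qed.

Lemma neg_root_comm c b x y : c \in e6_roots -> b \in e6_roots ->
  b + c \notin e6_roots -> ad_wt D (- c) x -> ad_wt D (- b) y -> lbr x y = 0.
Proof.
move=> cr br bc rx ry; apply: contrapT => /eqP xy0.
have := ad_wt_br rx ry; rewrite -opprD addrC => rxy.
have npos : ~ forall i, (b + c) i <= 0.
  move=> le0; case/eqP: (roots_neq0 br); apply/ffunP => i; apply/eqP.
  rewrite [X in _ == X]ffunE eq_le (roots_ge0 i br) andbT.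
  apply: le_trans (le0 i); rewrite ffunE lerDl; exact: roots_ge0.
have bc0 : - (b + c) != 0.
  by rewrite oppr_eq0; apply/eqP => e; apply: npos => i; rewrite e ffunE.
have /isrootP : isroot D (- (b + c)) by exists (lbr x y).
rewrite opprK (negbTE bc) => -[bcr|//]; apply: npos => i.
by have := roots_ge0 i bcr; rewrite ffunE oppr_ge0.
Qed.

(** f_3 kills the generator and commutes with all factors except delta, which it turns
into a multiple of epsilon. Each of the occurrences of delta in s gives rise to
the same monomial. *)
Lemma f3_mono : exists2 t : F, t != 0 & forall s, all [in S7] s ->
  lact (tpow (chev_f D n3) 0) (mono s) =
  (t * (count_mem delta s)%:R) *: mono (epsilon :: rem delta s).
Proof.
have [_ rF _] := chevP D n3.
have [xd0 rd _] := root_vecP (isroot_neg D (special_roots delta_special)).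
have [xe0 re one] := root_vecP (isroot_neg D epsilon_roots).
have := ad_wt_br rF rd; rewrite -opprD addrC delta_add3 => /one[t tE].
exists t.
  have : lbr (chev_f D n3) (root_vec D (- delta)) != 0.
    by apply: (iterF_neq0 (n := 1) rd xd0); rewrite hvalN delta_hval3.
  by apply: contraNneq => t0; rewrite tE t0 scale0r.
elim=> [_|b s IHs /andP[bS sS]].
  by rewrite (Mgen_f3 rF) mulr0 scale0r.
have -> : mono (b :: s) = lact (tpow (root_vec D (- b)) 1) (mono s) by [].
rewrite tact_swap IHs //.
have monoE c u : lact (tpow (root_vec D (- c)) 1) (mono u) = mono (c :: u) by [].
have [bd|bd] := eqVneq b delta; last first.
  have nb : b + simple n3 \notin e6_roots.
    move: bS; rewrite inE => /orP[/eqP ->|bs]; first exact: epsilon_add3.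
    exact: special_add3.
  have [_ rb _] := root_vecP (isroot_neg D (S7_roots bS)).
  rewrite (neg_root_comm (simple_in_roots n3) (S7_roots bS) nb rF rb) tact0l addr0.
  rewrite lactZr monoE; have -> : rem delta (b :: s) = b :: rem delta s.
    by rewrite /= (negbTE bd).
  rewrite [count_mem _ (_ :: _)]/= (negbTE bd) add0n; congr (_ *: _).
  by apply: mono_perm; apply: (permEl (perm_catCA [:: b] [:: epsilon] _)).
have remE : rem delta (b :: s) = s by rewrite bd /= eqxx.
have countE : count_mem delta (b :: s) = (count_mem delta s).+1 by rewrite bd /= eqxx.
rewrite remE countE bd tE tactZl !monoE lactZr monoE -natr1 mulrDr mulr1 scalerDl.
congr (_ + _); have [ds|ds] := boolP (delta \in s); last first.
  by rewrite (count_memPn ds) mulr0 !scale0r.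
congr (_ *: _); apply: mono_perm.
apply: perm_trans (permEl (perm_catCA [:: delta] [:: epsilon] _)) _.
by rewrite /= perm_cons perm_sym perm_to_rem.
Qed.

(** Replace a factor epsilon by delta and apply f_3. *)
Lemma mono_epsilon s : all [in S7] s -> epsilon \in s ->
  exists2 u, all [in S7] u & exists t : F, mono s = t *: lact (tpow (chev_f D n3) 0) (mono u).
Proof.
move=> sS es; have [t t0 tE] := f3_mono.
pose u := rem epsilon s.
have uS : all [in S7] u by apply/allP => b /mem_rem; apply: (allP sS).
have dS : all [in S7] (delta :: u).
  by rewrite [all _ _]/= uS andbT inE delta_special orbT.
exists (delta :: u) => //; rewrite (tE _ dS).
have -> : rem delta (delta :: u) = u by rewrite /= eqxx.
rewrite -(mono_perm (perm_to_rem es)).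
set k := t * _; have k0 : k != 0.
  by rewrite mulf_neq0 // pnatr_eq0 /= eqxx.
by exists k^-1; rewrite scalerA mulVf // scale1r.
Qed.

(** The vector w0 is the monomial of weight mu in the special roots, if there is one,
and is unique by special_indep. *)
Lemma M_mod_nminus (mu : 'I_6 -> nat) : exists w0 : W, forall m, exists z a r,
  [/\ m = z + a *: w0 + r,
     nminus_part D (res_const W) (fun j => (mu j)%:Z) z &
     other_weights D (res_const W) (fun j => (mu j)%:Z) r].
Proof.
pose hasmu (s : seq rlat) := all [in special] s /\
  forall j, (mu j)%:Z = lamwt (fun j => (lam j)%:Z) (\sum_(b <- s) b) j.
have [w0 hw0] : exists w0 : W, forall s, hasmu s -> mono s = w0.
  have [[s0 [s0S s0w]]|ns] := pselect (exists s, hasmu s); last first.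
    by exists 0 => s hs; case: ns; exists s.
  exists (mono s0) => s [sS sw]; apply: mono_perm; apply: special_indep => //.
  by apply: (@lamwt_inj (fun j => (lam j)%:Z)) => j; rewrite -sw s0w.
exists w0 => m.
set Z := nminus_part D (res_const W) _; set Y := other_weights D (res_const W) _.
pose dec (m : W) := exists z a r, [/\ m = z + a *: w0 + r, Z z & Y r].
have decY (w : res_const W) kap : wtv D kap w -> ~ (forall j, kap j = (mu j)%:Z) -> dec w.
  move=> ww nk; exists 0, 0, w; split; [by rewrite scale0r !add0r|exact: span_0|].
  apply: span_in; exists kap; split=> //.
  by apply: contrapT => /forallNP h; apply: nk => j; have /negP := h j; rewrite negbK => /eqP.
have low c y w : c \in e6_roots -> ad_wt D (- c) y -> lowered w -> dec (lact (tpow y 0) w).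
  move=> cr ry /lowered_wt[d d0 dw].
  have dyw := lamwt_raise (W := res_const W) ry dw; rewrite opprK in dyw.
  have [e|ne] := pselect (forall j, lamwt (fun j => (lam j)%:Z) (d + c) j = (mu j)%:Z); last first.
    exact: decY dyw ne.
  exists (lact (tpow y 0) w), 0, 0; split; [by rewrite scale0r !addr0| |exact: span_0].
  apply: span_in; exists c, y, w; split=> //.
  by apply: wtv_ext dw => j; rewrite -e /lamwt hvalD opprD addrA subrK.
have decD u w : dec u -> dec w -> dec (u + w).
  move=> [z [a [y [-> hz hy]]]] [z' [a' [y' [-> hz' hy']]]].
  exists (z + z'), (a + a'), (y + y'); split; [|exact: submodD|exact: submodD].
  by rewrite scalerDl addrACA; congr (_ + _); rewrite addrACA.
have decZ c u : dec u -> dec (c *: u).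
  move=> [z [a [y [-> hz hy]]]]; exists (c *: z), (c * a), (c *: y).
  by split; [rewrite !scalerDr scalerA|exact: submodZ|exact: submodZ].
have dec0 : dec 0.
  by exists 0, 0, 0; split; [rewrite scale0r !addr0|exact: span_0|exact: span_0].
elim/lspan_ind: (M_lowered m) => {m} [m [s sS|c y w cr ry lw]||u w|c u]; last 4 first.
- exact: low cr ry lw.
- exact: dec0.
- exact: decD.
- exact: decZ.
have [es|es] := boolP (epsilon \in s).
  have [u uS [t ->]] := mono_epsilon sS es; apply: decZ.
  have [_ rF _] := chevP D n3.
  by apply: (low _ _ _ (simple_in_roots n3) rF); apply: lowered_mono.
have sS' : all [in special] s.
  apply/allP => b bs; have := allP sS b bs; rewrite inE => /orP[/eqP be|//].
  by rewrite be in bs; rewrite bs in es.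
have sw := mono_wt sS.
have [e|ne] := pselect (forall j, lamwt (fun j => (lam j)%:Z) (\sum_(b <- s) b) j = (mu j)%:Z);
  last exact: decY sw ne.
exists 0, 1, 0; split; [|exact: span_0|exact: span_0].
by rewrite scale1r add0r addr0; apply: hw0; split=> // j; rewrite e.
Qed.

(** The combination is chosen so that the multiples of w0 cancel; what remains lies in
n^- M, up to vectors of other weights. *)
Lemma M_sing_unique (mu : 'I_6 -> nat) (u1 u2 : res_const W) :
  wtv D (fun j => (mu j)%:Z) u1 -> wtv D (fun j => (mu j)%:Z) u2 ->
  sing D u1 -> sing D u2 ->
  exists a b : F, (a != 0 \/ b != 0) /\ a *: u1 + b *: u2 = 0.
Proof.
move=> w1 w2 s1 s2; have [w0 dec] := M_mod_nminus mu.
have key (u z r : res_const W) : wtv D (fun j => (mu j)%:Z) u -> sing D u -> u = z + r ->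
    nminus_part D (res_const W) (fun j => (mu j)%:Z) z ->
    other_weights D (res_const W) (fun j => (mu j)%:Z) r -> u = 0.
  move=> uw us uzy hz hy; apply: (singular_nminus (W := res_const W) M_wts M_int uw us).
  suff r0 : r = 0 by rewrite uzy r0 addr0.
  apply: (wtv_indep hy).
  have -> : r = u + (-1) *: z by rewrite uzy scaleN1r addrAC subrr add0r.
  apply: wtvD => //; apply: wtvZ.
  elim/lspan_ind: hz => {z uzy} [z [c [x [w' [cr rx ww ->]]]]||p q hp hq|k p hp].
  - apply: wtv_ext (wtv_act rx ww) => j; rewrite hvalN addrK //.
  - exact: wtv0.
  - exact: wtvD.
  - exact: wtvZ.
have [z1 [a1 [y1 [e1 hz1 hy1]]]] := dec u1; have [z2 [a2 [y2 [e2 hz2 hy2]]]] := dec u2.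
have [a10|a10] := eqVneq a1 0.
  exists 1, 0; split; [by left; apply: oner_neq0|].
  rewrite scale1r scale0r addr0; apply: key hz1 hy1 => //.
  by rewrite e1 a10 scale0r addr0.
exists a2, (- a1); split; first by right; rewrite oppr_eq0.
apply: (key _ (a2 *: z1 + (- a1) *: z2) (a2 *: y1 + (- a1) *: y2)).
- by apply: wtvD; apply: wtvZ.
- by move=> c y cr ry; rewrite lactDr !lactZr (s1 _ _ cr ry) (s2 _ _ cr ry) !scaler0 addr0.
- rewrite e1 e2 !scalerDr !scalerA [a2 * a1]mulrC mulNr (scaleNr (a1 * a2)).
  by rewrite addrACA [X in X + _]addrACA subrr addr0.
- by apply: span_D; apply: span_Z.
- by apply: span_D; apply: span_Z.
Qed.

Lemma M_multiplicity_free : multiplicity_free D (res_const W).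
Proof.
move=> mu V [irr [v0 [v0n vplus vwt]]] k [f [fhom finj]].
rewrite leqNgt; apply/negP => k1.
pose i0 : 'I_k := Ordinal (ltnW k1); pose i1 : 'I_k := Ordinal k1.
have fact i x (p : V) : f i (lact x p) = lact x (f i p) by have [_ ->] := fhom i.
have fZ i c (p : V) : f i (c *: p) = c *: f i p.
  have [fl _] := fhom i; have f00 : f i 0 = 0.
    have := fl 1 0 0; rewrite scaler0 addr0 scale1r => /esym/eqP.
    by rewrite -subr_eq0 addrK => /eqP.
  by have := fl c p 0; rewrite !addr0 f00 addr0.
have fw i : wtv (W := res_const W) D (fun j => (mu j)%:Z) (f i v0).
  by move=> j; rewrite -fact vwt fZ.
have fs i : sing (W := res_const W) D (f i v0).
  move=> c y cr ry; rewrite -fact (vplus _ (nplus_ad_wt cr ry)).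
  by rewrite -(scale0r (0 : V)) fZ scale0r.
have [a [b [ab e]]] := M_sing_unique (fw i0) (fw i1) (fs i0) (fs i1).
pose u (j : 'I_k) := if j == i0 then a *: v0 else if j == i1 then b *: v0 else 0 : V.
have i10 : i1 != i0 by [].
have : \sum_j f j (u j) = 0.
  rewrite (bigD1 i0) //= (bigD1 i1) //= /u eqxx (negbTE i10) eqxx !fZ addrA e add0r.
  rewrite big1 // => j /andP[/negbTE -> /negbTE ->].
  by rewrite -(scale0r (0 : V)) fZ scale0r.
move=> /finj u0; have := u0 i0; have := u0 i1; rewrite /u eqxx (negbTE i10) eqxx.
move=> /eqP; rewrite scaler_eq0 (negbTE v0n) orbF => /eqP b0.
move=> /eqP; rewrite scaler_eq0 (negbTE v0n) orbF => /eqP a0.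
by case: ab; rewrite ?a0 ?b0 eqxx.
Qed.

End Mmodule.

Local Close Scope ring_scope.

Theorem mainTheorem6 (R : realType) (g : fdLieAlgType R[i]%C) (D : e6Data g)
    (lam : 'I_6 -> nat) (lam3 : lam node3 = 0) :
  multiplicity_free D (res_const (M D lam)).
Proof. exact: M_multiplicity_free lam3. Qed.
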